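(* Let $\Gamma$ be a distance-regular graph of diameter $D\ge3$, fix a base vertex $x$ and let $T=T(x)$. Fix complex scalars $q,\eta,\eta^*,u,u^*,v,v^*$ with $q,u,u^*,v,v^*$ nonzero and $q^{2i}\neq1$ for $1\le i\le D$, and assume $\Gamma$ has a $Q$-polynomial structure $E_0,\dots,E_D$ with eigenvalue sequence $\theta_i=\eta+uq^{2i-D}+vq^{D-2i}$ and dual eigenvalue sequence $\theta^*_i=\eta^*+u^*q^{2i-D}+v^*q^{D-2i}$ ($0\le i\le D$), and that every irreducible $T$-module is thin. Then there exists a $\mathbb C$-algebra homomorphism $\vartheta:\boxtimes_q\to T$ such that $$A=\eta I+u\Phi\Psi^{-1}\vartheta(x_{01})+v\Psi\Phi^{-1}\vartheta(x_{12}),\qquad A^*=\eta^*I+u^*\Phi\Psi\vartheta(x_{23})+v^*\Psi^{-1}\Phi^{-1}\vartheta(x_{30}).$$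
   Context: Distance-regular: $\Gamma=(X,R)$ finite connected simple graph with path-length distance $\partial$, diameter $D$, such that $p^h_{ij}=|\{z:\partial(x,z)=i,\partial(z,y)=j\}|$ depends only on $h=\partial(x,y),i,j$. $V=\mathbb C^X$ with inner product $\langle u,v\rangle=u^t\overline v$. Distance matrices $A_i$ span the Bose–Mesner algebra $M$ with primitive idempotents $E_0,\dots,E_D$; $A=A_1$ is the adjacency matrix and $A=\sum_i\theta_iE_i$. Krein parameters: $E_i\circ E_j=|X|^{-1}\sum_hq^h_{ij}E_h$; $Q$-polynomial with respect to $E_0,\dots,E_D$ means $q^h_{ij}=0$ whenever one of $h,i,j$ exceeds the sum of the other two and $q^h_{ij}\ne0$ whenever one equals the sum of the other two; $\theta_i$ is the eigenvalue sequence. $E^*_i=E^*_i(x)$ is diagonal with $(y,y)$-entry $1$ if $\partial(x,y)=i$, else $0$. The dual adjacency matrix $A^*$ is the diagonal matrix with $(y,y)$-entry $|X|(E_1)_{xy}$, and $A^*=\sum_i\theta^*_iE^*_i$ defines the dual eigenvalue sequence. $T=T(x)$ is the algebra generated by $M$ and the span of the $E^*_i$. An irreducible $T$-module $W$ is thin if $\dim E^*_iW\le1$ for all $i$. For $-1\le i,j\le D$ let $V^{\downarrow\downarrow}_{i,j}=(E^*_0V+\cdots+E^*_iV)\cap(E_0V+\cdots+E_jV)$ and $V^{\downarrow\uparrow}_{i,j}=(E^*_0V+\cdots+E^*_iV)\cap(E_DV+\cdots+E_{D-j}V)$ (both $0$ if $i=-1$ or $j=-1$); for $0\le i,j\le D$,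 $\tilde V^{\mu\nu}_{i,j}$ is the orthogonal complement of $V^{\mu\nu}_{i-1,j}+V^{\mu\nu}_{i,j-1}$ in $V^{\mu\nu}_{i,j}$. One has $V=\bigoplus_{i,j}\tilde V^{\downarrow\downarrow}_{i,j}=\bigoplus_{i,j}\tilde V^{\downarrow\uparrow}_{i,j}$. $\Phi$ (resp. $\Psi$) is the unique matrix acting on $\tilde V^{\downarrow\downarrow}_{i,j}$ (resp. $\tilde V^{\downarrow\uparrow}_{i,j}$) as $q^{i+j-D}I$; both are invertible. The $q$-tetrahedron algebra $\boxtimes_q$ (for $q\ne0$, $q^2\ne1$) is the unital associative $\mathbb C$-algebra with generators $x_{ij}$, $i,j\in\mathbb Z_4$ with $j-i\in\{1,2\}$, and relations: (1) $x_{ij}x_{ji}=1$ whenever $j-i=2$; (2) $\frac{qx_{hi}x_{ij}-q^{-1}x_{ij}x_{hi}}{q-q^{-1}}=1$ whenever $(i-h,j-i)\in\{(1,1),(1,2),(2,1)\}$; (3) $x_{hi}^3x_{jk}-[3]_qx_{hi}^2x_{jk}x_{hi}+[3]_qx_{hi}x_{jk}x_{hi}^2-x_{jk}x_{hi}^3=0$ whenever $i-h=j-i=k-j=1$, where $[3]_q=(q^3-q^{-3})/(q-q^{-1})$. *)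

(* Defs.v *)
From HB Require Import structures.
From mathcomp Require Import all_boot all_order all_algebra.
From mathcomp Require Import boolp.

Set Implicit Arguments.
Unset Strict Implicit.
Unset Printing Implicit Defensive.

Import Order.TTheory GRing.Theory Num.Theory.
Local Open Scope ring_scope.

(** The K-algebra with generators [G] and relations [rel] is the type of formal
    expressions modulo the congruence generated by the algebra axioms and [rel].
    It may be the zero ring, so it is a [pzRingType] and an [lmodType] but not an
    [algType], which has to be nonzero; the algebra axioms linking the scaling to
    the product are [presalg_scalerAl] and [presalg_scalerAr]. *)

Section Presentation.
Variables (K : pzRingType) (G : Type).

Inductive expr : Type :=
| EGen of G
| EZero
| EOne
| EAdd of expr & expr
| EOpp of expr
| EMul of expr & expr
| EScale of K & expr.

HB.instance Definition _ := gen_eqMixin expr.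
HB.instance Definition _ := gen_choiceMixin expr.

Variable rel : expr -> expr -> Prop.

Inductive expr_cong : expr -> expr -> Prop :=
| cong_rel a b : rel a b -> expr_cong a b
| cong_refl a : expr_cong a a
| cong_sym a b : expr_cong a b -> expr_cong b a
| cong_trans b a c : expr_cong a b -> expr_cong b c -> expr_cong a c
| cong_add a a' b b' :
    expr_cong a a' -> expr_cong b b' -> expr_cong (EAdd a b) (EAdd a' b')
| cong_opp a a' : expr_cong a a' -> expr_cong (EOpp a) (EOpp a')
| cong_mul a a' b b' :
    expr_cong a a' -> expr_cong b b' -> expr_cong (EMul a b) (EMul a' b')
| cong_scale k a a' : expr_cong a a' -> expr_cong (EScale k a) (EScale k a')
| cong_addA a b c : expr_cong (EAdd a (EAdd b c)) (EAdd (EAdd a b) c)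
| cong_addC a b : expr_cong (EAdd a b) (EAdd b a)
| cong_add0 a : expr_cong (EAdd EZero a) a
| cong_addN a : expr_cong (EAdd (EOpp a) a) EZero
| cong_mulA a b c : expr_cong (EMul a (EMul b c)) (EMul (EMul a b) c)
| cong_mul1l a : expr_cong (EMul EOne a) a
| cong_mul1r a : expr_cong (EMul a EOne) a
| cong_mulDl a b c : expr_cong (EMul (EAdd a b) c) (EAdd (EMul a c) (EMul b c))
| cong_mulDr a b c : expr_cong (EMul a (EAdd b c)) (EAdd (EMul a b) (EMul a c))
| cong_scaleA k l a : expr_cong (EScale k (EScale l a)) (EScale (k * l) a)
| cong_scale1 a : expr_cong (EScale 1 a) a
| cong_scaleDr k a b :
    expr_cong (EScale k (EAdd a b)) (EAdd (EScale k a) (EScale k b))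
| cong_scaleDl a k l :
    expr_cong (EScale (k + l) a) (EAdd (EScale k a) (EScale l a))
| cong_scaleAl k a b : expr_cong (EScale k (EMul a b)) (EMul (EScale k a) b)
| cong_scaleAr k a b : expr_cong (EScale k (EMul a b)) (EMul a (EScale k b)).

Definition expr_congb (a b : expr) : bool := `[< expr_cong a b >].

Lemma expr_congb_refl : reflexive expr_congb.
Proof. by move=> a; apply/asboolP; apply: cong_refl. Qed.

Lemma expr_congb_sym : symmetric expr_congb.
Proof. by move=> a b; apply/asboolP/asboolP; apply: cong_sym. Qed.

Lemma expr_congb_trans : transitive expr_congb.
Proof. by move=> b a c /asboolP ab /asboolP bc; apply/asboolP/(cong_trans ab). Qed.

Canonical expr_equiv :=
  EquivRel expr_congb expr_congb_refl expr_congb_sym expr_congb_trans.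

Definition presalg : Type := {eq_quot expr_equiv}%qT.
HB.instance Definition _ := Choice.on presalg.

Definition presalg_of (a : expr) : presalg := (\pi_({eq_quot expr_equiv}%qT) a)%qT.
Definition expr_of (a : presalg) : expr := repr (a : {eq_quot expr_equiv}%qT).

Lemma expr_ofK : cancel expr_of presalg_of.
Proof. exact: reprK. Qed.

Lemma presalg_ofP (a b : expr) : expr_cong a b <-> presalg_of a = presalg_of b.
Proof. by split=> [ab|/eqmodP/asboolP //]; apply/eqmodP/asboolP. Qed.

Lemma expr_of_cong (a : expr) : expr_cong (expr_of (presalg_of a)) a.
Proof. by apply/presalg_ofP; rewrite expr_ofK. Qed.

Lemma presalg_surj (a : presalg) : exists a', a = presalg_of a'.
Proof. by exists (expr_of a); rewrite expr_ofK. Qed.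

Definition presalg_zero : presalg := presalg_of EZero.
Definition presalg_one : presalg := presalg_of EOne.
Definition presalg_add (a b : presalg) : presalg :=
  presalg_of (EAdd (expr_of a) (expr_of b)).
Definition presalg_opp (a : presalg) : presalg := presalg_of (EOpp (expr_of a)).
Definition presalg_mul (a b : presalg) : presalg :=
  presalg_of (EMul (expr_of a) (expr_of b)).
Definition presalg_scale (k : K) (a : presalg) : presalg :=
  presalg_of (EScale k (expr_of a)).

Lemma presalg_of_add a b :
  presalg_add (presalg_of a) (presalg_of b) = presalg_of (EAdd a b).
Proof. by apply/presalg_ofP; apply: cong_add; apply: expr_of_cong. Qed.

Lemma presalg_of_opp a : presalg_opp (presalg_of a) = presalg_of (EOpp a).
Proof. by apply/presalg_ofP; apply: cong_opp; apply: expr_of_cong. Qed.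

Lemma presalg_of_mul a b :
  presalg_mul (presalg_of a) (presalg_of b) = presalg_of (EMul a b).
Proof. by apply/presalg_ofP; apply: cong_mul; apply: expr_of_cong. Qed.

Lemma presalg_of_scale k a :
  presalg_scale k (presalg_of a) = presalg_of (EScale k a).
Proof. by apply/presalg_ofP; apply: cong_scale; apply: expr_of_cong. Qed.

Let presalg_ofE :=
  (presalg_of_add, presalg_of_opp, presalg_of_mul, presalg_of_scale).

Fact presalg_addA : associative presalg_add.
Proof.
move=> a b c; have [a' ->] := presalg_surj a; have [b' ->] := presalg_surj b; have [c' ->] := presalg_surj c.
by rewrite !presalg_ofE; apply/presalg_ofP; exact: cong_addA.
Qed.

Fact presalg_addC : commutative presalg_add.
Proof.
move=> a b; have [a' ->] := presalg_surj a; have [b' ->] := presalg_surj b.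
by rewrite !presalg_ofE; apply/presalg_ofP; exact: cong_addC.
Qed.

Fact presalg_add0 : left_id presalg_zero presalg_add.
Proof.
move=> a; have [a' ->] := presalg_surj a.
by rewrite /presalg_zero; rewrite !presalg_ofE; apply/presalg_ofP; exact: cong_add0.
Qed.

Fact presalg_addN : left_inverse presalg_zero presalg_opp presalg_add.
Proof.
move=> a; have [a' ->] := presalg_surj a.
by rewrite !presalg_ofE; apply/presalg_ofP; exact: cong_addN.
Qed.

HB.instance Definition _ := GRing.isZmodule.Build presalg
  presalg_addA presalg_addC presalg_add0 presalg_addN.

Fact presalg_mulA : associative presalg_mul.
Proof.
move=> a b c; have [a' ->] := presalg_surj a; have [b' ->] := presalg_surj b; have [c' ->] := presalg_surj c.
by rewrite !presalg_ofE; apply/presalg_ofP; exact: cong_mulA.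
Qed.

Fact presalg_mul1l : left_id presalg_one presalg_mul.
Proof.
move=> a; have [a' ->] := presalg_surj a.
by rewrite /presalg_one; rewrite !presalg_ofE; apply/presalg_ofP; exact: cong_mul1l.
Qed.

Fact presalg_mul1r : right_id presalg_one presalg_mul.
Proof.
move=> a; have [a' ->] := presalg_surj a.
by rewrite /presalg_one; rewrite !presalg_ofE; apply/presalg_ofP; exact: cong_mul1r.
Qed.

Fact presalg_mulDl : left_distributive presalg_mul presalg_add.
Proof.
move=> a b c; have [a' ->] := presalg_surj a; have [b' ->] := presalg_surj b; have [c' ->] := presalg_surj c.
by rewrite !presalg_ofE; apply/presalg_ofP; exact: cong_mulDl.
Qed.

Fact presalg_mulDr : right_distributive presalg_mul presalg_add.
Proof.
move=> a b c; have [a' ->] := presalg_surj a; have [b' ->] := presalg_surj b; have [c' ->] := presalg_surj c.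
by rewrite !presalg_ofE; apply/presalg_ofP; exact: cong_mulDr.
Qed.

HB.instance Definition _ := GRing.Zmodule_isPzRing.Build presalg
  presalg_mulA presalg_mul1l presalg_mul1r presalg_mulDl presalg_mulDr.

Fact presalg_scaleA k l a :
  presalg_scale k (presalg_scale l a) = presalg_scale (k * l) a.
Proof.
have [a' ->] := presalg_surj a.
by rewrite !presalg_ofE; apply/presalg_ofP; exact: cong_scaleA.
Qed.

Fact presalg_scale1 : left_id 1 presalg_scale.
Proof.
move=> a; have [a' ->] := presalg_surj a.
by rewrite !presalg_ofE; apply/presalg_ofP; exact: cong_scale1.
Qed.

Fact presalg_scaleDr : right_distributive presalg_scale presalg_add.
Proof.
move=> k a b; have [a' ->] := presalg_surj a; have [b' ->] := presalg_surj b.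
by rewrite !presalg_ofE; apply/presalg_ofP; exact: cong_scaleDr.
Qed.

Fact presalg_scaleDl a :
  {morph presalg_scale^~ a : k l / k + l >-> presalg_add k l}.
Proof.
move=> k l; have [a' ->] := presalg_surj a.
by rewrite !presalg_ofE; apply/presalg_ofP; exact: cong_scaleDl.
Qed.

HB.instance Definition _ := GRing.Zmodule_isLmodule.Build K presalg
  presalg_scaleA presalg_scale1 presalg_scaleDr presalg_scaleDl.

Lemma presalg_scalerAl (k : K) (a b : presalg) : k *: (a * b) = k *: a * b.
Proof.
have [a' ->] := presalg_surj a; have [b' ->] := presalg_surj b.
by rewrite /GRing.mul /GRing.scale /=; rewrite !presalg_ofE; apply/presalg_ofP; exact: cong_scaleAl.
Qed.

Lemma presalg_scalerAr (k : K) (a b : presalg) : k *: (a * b) = a * (k *: b).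
Proof.
have [a' ->] := presalg_surj a; have [b' ->] := presalg_surj b.
by rewrite /GRing.mul /GRing.scale /=; rewrite !presalg_ofE; apply/presalg_ofP; exact: cong_scaleAr.
Qed.

Definition presgen (g : G) : presalg := presalg_of (EGen g).

End Presentation.

Arguments EZero {K G}.
Arguments EOne {K G}.
Arguments EGen {K G} _.

Definition tet_adj (i j : 'Z_4) : bool := (j - i == 1) || (j - i == 2%:R).

Definition tet_gen : Type := {p : 'Z_4 * 'Z_4 | tet_adj p.1 p.2}.

Section QTetrahedron.
Variables (K : fieldType) (q : K).

Definition qthree : K := (q ^+ 3 - q ^- 3) / (q - q^-1).

Local Notation expr := (expr K tet_gen).
Local Notation X ij :=
  (EGen (exist (fun p : 'Z_4 * 'Z_4 => is_true (tet_adj p.1 p.2)) (_, _) ij)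
     : expr).
Local Notation "a '+e' b" := (EAdd a b) (at level 50, left associativity).
Local Notation "a '-e' b" := (EAdd a (EOpp b)) (at level 50, left associativity).
Local Notation "a '*e' b" := (EMul a b) (at level 40, left associativity).
Local Notation "k '*:e' a" := (EScale k a) (at level 40, left associativity).

Inductive qtet_rel : expr -> expr -> Prop :=
| qtet_inv (i j : 'Z_4) (ij : tet_adj i j) (ji : tet_adj j i) :
    j - i = 2%:R -> qtet_rel (X ij *e X ji) EOne
| qtet_weyl (h i j : 'Z_4) (hi : tet_adj h i) (ij : tet_adj i j) :
    (i - h, j - i) \in [:: (1, 1); (1, 2%:R); (2%:R, 1)] ->
    qtet_rel ((q - q^-1)^-1 *:e (q *:e (X hi *e X ij) -e q^-1 *:e (X ij *e X hi)))
      EOne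
| qtet_serre (h i j k : 'Z_4) (hi : tet_adj h i) (jk : tet_adj j k) :
    i - h = 1 -> j - i = 1 -> k - j = 1 ->
    qtet_rel (X hi *e X hi *e X hi *e X jk
                -e qthree *:e (X hi *e X hi *e X jk *e X hi)
                +e qthree *:e (X hi *e X jk *e X hi *e X hi)
                -e X jk *e X hi *e X hi *e X hi)
      EZero.

Definition qtet : Type := presalg qtet_rel.
HB.instance Definition _ := GRing.PzRing.on qtet.
HB.instance Definition _ := GRing.Lmodule.on qtet.

Definition qtet_x (i j : 'Z_4) (ij : tet_adj i j) : qtet :=
  presgen qtet_rel
    (exist (fun p : 'Z_4 * 'Z_4 => is_true (tet_adj p.1 p.2)) (i, j) ij).

End QTetrahedron.

Definition tet01 : tet_adj 0 1 := isT.
Definition tet12 : tet_adj 1 2%:R := isT.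
Definition tet23 : tet_adj 2%:R 3%:R := isT.
Definition tet30 : tet_adj 3%:R 0 := isT.

Section Graph.
Variables (X : finType) (e : rel X).

Definition walk (k : nat) (y z : X) : bool :=
  [exists p : k.-tuple X, path e y p && (last y p == z)].

(* The length of a shortest walk from y to z; #|X| if there is none. *)
Definition gdist (y z : X) : nat := find (fun k => walk k y z) (iota 0 #|X|).

Definition diameter : nat := \max_(y : X) \max_(z : X) gdist y z.

Definition distance_regular : Prop :=
  [/\ symmetric e, irreflexive e, forall y z, connect e y z
    & forall (i j : nat) (y z y' z' : X), gdist y z = gdist y' z' ->
        #|[set w | (gdist y w == i) && (gdist w z == j)]| =
        #|[set w | (gdist y' w == i) && (gdist w z' == j)]| ].

End Graph.

(** Matrices with rows and columns indexed by [X] are square matrices of size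
    [#|X|], through the enumeration [enum_val : 'I_#|X| -> X]. *)

Section Algebras.
Variables (C : numClosedFieldType) (X : finType) (e : rel X) (D : nat).

Local Notation mxX := 'M[C]_#|X|.
Local Notation V := 'cV[C]_#|X|.

Definition distmx (i : nat) : mxX :=
  \matrix_(y, z) (gdist e (enum_val y) (enum_val z) == i)%:R.

Definition adjmx : mxX := distmx 1.

Definition bose_mesner : {vspace mxX} := <<[seq distmx i | i : 'I_D.+1]>>%VS.

Definition primitive_idempotents (E : 'I_D.+1 -> mxX) : Prop :=
  [/\ basis_of bose_mesner [seq E i | i : 'I_D.+1],
      forall i j, E i *m E j = if i == j then E i else 0
    & \sum_i E i = 1%:M].

Definition krein_parameters (E : 'I_D.+1 -> mxX)
    (p : 'I_D.+1 -> 'I_D.+1 -> 'I_D.+1 -> C) : Prop :=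
  forall i j,
    map2_mx *%R (E i) (E j) = #|X|%:R^-1 *: \sum_h p h i j *: E h.

Definition Q_polynomial (E : 'I_D.+1 -> mxX) : Prop :=
  primitive_idempotents E /\
  exists2 p, krein_parameters E p &
    forall h i j : 'I_D.+1,
      ([|| (i + j < h)%N, (h + j < i)%N | (h + i < j)%N] -> p h i j = 0) /\
      ([|| h == (i + j)%N :> nat, i == (h + j)%N :> nat | j == (h + i)%N :> nat] ->
        p h i j != 0).

Variable x : X.

Definition dual_idempotent (i : nat) : mxX :=
  diag_mx (\row_y (gdist e x (enum_val y) == i)%:R).

Definition dual_adjmx (E : 'I_D.+1 -> mxX) : mxX :=
  diag_mx (\row_y (#|X|%:R * E (inord 1) (enum_rank x) y)).

Definition eigenvalue_sequence (E : 'I_D.+1 -> mxX) (theta : 'I_D.+1 -> C) :=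
  adjmx = \sum_i theta i *: E i.

Definition dual_eigenvalue_sequence (E : 'I_D.+1 -> mxX)
    (thetas : 'I_D.+1 -> C) :=
  dual_adjmx E = \sum_i thetas i *: dual_idempotent i.

Definition dual_bose_mesner : {vspace mxX} :=
  <<[seq dual_idempotent i | i : 'I_D.+1]>>%VS.

Inductive terwilliger : mxX -> Prop :=
| terw_bm B : B \in bose_mesner -> terwilliger B
| terw_dual_bm B : B \in dual_bose_mesner -> terwilliger B
| terw_one : terwilliger 1%:M
| terw_add B B' : terwilliger B -> terwilliger B' -> terwilliger (B + B')
| terw_scale c B : terwilliger B -> terwilliger (c *: B)
| terw_mul B B' : terwilliger B -> terwilliger B' -> terwilliger (B *m B').

Definition mxact (B : mxX) : 'End(V) := linfun (mulmx B).

Definition T_module (W : {vspace V}) : Prop :=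
  forall B, terwilliger B -> forall w, w \in W -> B *m w \in W.

Definition irreducible_T_module (W : {vspace V}) : Prop :=
  [/\ T_module W, W != 0%VS
    & forall U, T_module U -> (U <= W)%VS -> U = 0%VS \/ U = W].

Definition thin (W : {vspace V}) : Prop :=
  forall i : 'I_D.+1, (\dim (mxact (dual_idempotent i) @: W)%VS <= 1)%N.

(** In [Vdd] and [Vdu] the indices are integers, so that the index -1 gives
    empty sums. *)

Definition Vdd (E : 'I_D.+1 -> mxX) (i j : int) : {vspace V} :=
  ((\sum_(k < D.+1 | (k%:Z <= i)%R) limg (mxact (dual_idempotent k)))
   :&: \sum_(k < D.+1 | (k%:Z <= j)%R) limg (mxact (E k)))%VS.

Definition Vdu (E : 'I_D.+1 -> mxX) (i j : int) : {vspace V} :=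
  ((\sum_(k < D.+1 | (k%:Z <= i)%R) limg (mxact (dual_idempotent k)))
   :&: \sum_(k < D.+1 | (D%:Z - j <= k%:Z)%R) limg (mxact (E k)))%VS.

Definition inner (u v : V) : C := \sum_y u y 0 * (v y 0)^*.

Definition split_tilde (F : int -> int -> {vspace V}) (i j : int) (v : V) : Prop :=
  v \in F i j /\
  forall w, w \in (F (i - 1)%R j + F i (j - 1)%R)%VS -> inner v w = 0.

(** This determines [P], as the vector space is the direct sum of the subspaces
    [split_tilde F i j] for [F] either [Vdd E] or [Vdu E]. *)
Definition acts_as_displacement (q : C) (F : int -> int -> {vspace V})
    (P : mxX) : Prop :=
  forall (i j : 'I_D.+1) (v : V), split_tilde F i%:Z j%:Z v ->
    P *m v = q ^ (i%:Z + j%:Z - D%:Z) *: v.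

End Algebras.

(* Main.v *)
(* Let W be an irreducible T-module of endpoint r, dual endpoint t and diameter d. The
   matrices Phi and Psi act on W as q^(r+t+d-D) and q^(r-t), so on W one needs an action of
   the q-tetrahedron algebra with
     A - eta = a x_01 + b x_12  and  A* - eta* = as x_23 + bs x_30,
   where a = u q^(2t+d-D), b = v q^(D-2t-d), as = us q^(2r+d-D), bs = vs q^(D-2r-d).
   By thinness W carries a Leonard system; in its split basis A is lower bidiagonal with
   subdiagonal 1 and A* is upper bidiagonal with superdiagonal phi_1, ..., phi_d. The
   tridiagonal relation is a third-order linear recurrence for phi, and its solution factors as
     phi_i = (1 - q^(-2i)) (1 - q^(2d-2i+2)) (a + b c q^(2i-d-1)) (bs + as c^-1 q^(2i-d-1)).
   The scalar c determines evaluation matrices x_01, x_12, x_23, x_30, x_13 = diag(q^(2i-d))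
   explicitly; the existence of x_20 amounts to 1 + c q^(2i-d-1) being nonzero, which is the
   nonvanishing of the second split sequence of W.
   These matrices depend on (r, t, d, phi) only, an isomorphism invariant by Schur's lemma.
   Hence their direct sum over an orthogonal decomposition of V commutes with the commutant
   of T, and lies in T by the double centralizer theorem. *)

(* Only i <= D is excluded in q^(2i) = 1, so q^(2D+2) = 1 may hold. The recurrence for phi has
   characteristic roots 1, q^2, q^-2, and when q^(2d+2) = 1 the vanishing of phi_(d+1) says nothing
   beyond phi_0 = 0. The missing condition is the value of phi_d. It comes from comparing two split
   sequences of W, for the given and for the reversed order of the eigenvalues of A. With t =
   q^(2i-d-1) the solution is (1 - q^(-2i)) (1 - q^(2d-2i+2)) (a bs + Y t + b as t^2), and c arises
   from splitting this quadratic over the complex numbers, with Y = b bs c + a as / c. The element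
   x_20 is sought as x_01^-1 + N. Its relations reduce to x_01 N = q^2 N x_01 and to one equation
   for N, solved by a polynomial in x_01. That x_20 is invertible cannot be read off its entries; a
   kernel vector is excluded by following it through the split basis of x_30 and x_01. *)
Require Import Defs.
From HB Require Import structures.
From mathcomp Require Import all_boot all_order all_algebra reals complex.
From mathcomp Require Import boolp zify ring.
Set Implicit Arguments.
Unset Strict Implicit.
Unset Printing Implicit Defensive.
Import Order.TTheory GRing.Theory Num.Theory.
Local Open Scope ring_scope.

(** * A decision procedure for linear combinations *)

Section LinearExpressions.
Variables (K : pzRingType) (V : lmodType K).

Inductive lexp := LAtom of nat | LZero | LAdd of lexp & lexp | LOpp of lexp | LScale of K & lexp.

Fixpoint leval (env : seq V) (t : lexp) : V :=
  match t with
  | LAtom i => nth 0 env i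
  | LZero => 0
  | LAdd t1 t2 => leval env t1 + leval env t2
  | LOpp t1 => - leval env t1
  | LScale k t1 => k *: leval env t1
  end.

Fixpoint lcoef (i : nat) (t : lexp) : K :=
  match t with
  | LAtom j => if eqn i j then 1 else 0
  | LZero => 0
  | LAdd t1 t2 => lcoef i t1 + lcoef i t2
  | LOpp t1 => - lcoef i t1
  | LScale k t1 => k * lcoef i t1
  end.

Lemma leval_coef env t : leval env t = \sum_(i < size env) lcoef i t *: nth 0 env i.
Proof.
elim: t => [j||t1 IH1 t2 IH2|t1 IH1|k t1 IH1] /=.
- have [jlt|jge] := ltnP j (size env).
    rewrite (bigD1 (Ordinal jlt)) //= (introT eqnP erefl) scale1r big1 ?addr0 // => i /eqP ne.
    case: eqnP => [ij|_]; last by rewrite scale0r.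
    by case: ne; apply/val_inj.
  rewrite nth_default // big1 // => i _; case: eqnP => [ij|_]; last by rewrite scale0r.
  by move: (ltn_ord i); rewrite ij ltnNge jge.
- by rewrite big1 // => i _; rewrite scale0r.
- by rewrite IH1 IH2 -big_split; apply: eq_bigr => i _; rewrite scalerDl.
- by rewrite IH1 -sumrN; apply: eq_bigr => i _; rewrite scaleNr.
- by rewrite IH1 scaler_sumr; apply: eq_bigr => i _; rewrite scalerA.
Qed.

(** A recursive conjunction, so that after computation one scalar identity per atom is left for
    [field] or [ring]. *)
Fixpoint lcoefs_eq (n : nat) (t1 t2 : lexp) : Prop :=
  if n is m.+1 then lcoef m t1 = lcoef m t2 /\ lcoefs_eq m t1 t2 else True.

Lemma leval_eq env t1 t2 : lcoefs_eq (size env) t1 t2 -> leval env t1 = leval env t2.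
Proof.
move=> h; rewrite !leval_coef; apply: eq_bigr => i _; congr (_ *: _).
elim: (size env) (i : nat) (ltn_ord i) h => //= m IH k; rewrite ltnS leq_eqVlt.
by case/orP=> [/eqP-> []|km [_ /IH]] //; apply.
Qed.

End LinearExpressions.

(* Structure instances are reached through several paths, hence [lsame]. *)
Ltac lsame x y :=
  first [constr_eq x y |
  lazymatch x with
  | 1%:M => lazymatch y with 1%:M => idtac end
  | (?a *m ?b) => lazymatch y with (?c *m ?d) => lsame a c; lsame b d end
  end].

Ltac lfind x env :=
  lazymatch env with
  | ?y :: ?env' => match constr:(x) with
                   | _ => let _ := match constr:(x) with _ => lsame x y end in constr:(0%N)
                   | _ => let i := lfind x env' in constr:(S i)
                   end
  end.

Ltac latoms e env :=
  lazymatch e with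
  | (?a + ?b)%R => let env1 := latoms a env in latoms b env1
  | (- ?a)%R => latoms a env
  | (?k *: ?a)%R => latoms a env
  | 0%R => env
  | _ => match constr:(e) with
         | _ => let _ := lfind e env in env
         | _ => constr:(e :: env)
         end
  end.

Ltac lquote K e env :=
  lazymatch e with
  | (?a + ?b)%R => let x := lquote K a env in let y := lquote K b env in constr:(@LAdd K x y)
  | (- ?a)%R => let x := lquote K a env in constr:(@LOpp K x)
  | (?k *: ?a)%R => let x := lquote K a env in constr:(@LScale K k x)
  | 0%R => constr:(@LZero K)
  | _ => let i := lfind e env in constr:(@LAtom K i)
  end.

Ltac lincomb K :=
  lazymatch goal with
  | |- ?a = ?b =>
    let T := type of a in
    let env0 := constr:(@nil T) in
    let env1 := latoms a env0 in
    let env := latoms b env1 in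
    let x := lquote K a env in
    let y := lquote K b env in
    refine (@leval_eq K _ env x y _);
    cbn [size lcoefs_eq lcoef eqn];
    repeat (refine (conj _ _)); try exact I
  end.

(** * Evaluation modules of the q-tetrahedron algebra *)

Section ScaleMul.
Variables (K : fieldType) (n : nat).

Lemma scalemxAl' k (x y : 'M[K]_n) : k *: x *m y = k *: (x *m y). Proof. by rewrite scalemxAl. Qed.
Lemma scalemxAr' k (x y : 'M[K]_n) : x *m (k *: y) = k *: (x *m y). Proof. by rewrite scalemxAr. Qed.

End ScaleMul.

Ltac ncexpand := rewrite ?(mulmxDl, mulmxDr, mulNmx, mulmxN, scalemxAl', scalemxAr', mulmxA, mulmx1, mul1mx).

Section Weyl.
Variables (K : fieldType) (n : nat) (q : K).
Local Notation B := 'M[K]_n.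
Hypothesis q0 : q != 0.
Implicit Types x y z t : B.

(** Relation (2) of the algebra, solved for [x *m y] so that it can be used as a rewriting rule. *)
Definition qweyl x y := x *m y = q ^- 2 *: (y *m x) + (1 - q ^- 2) *: 1%:M.

Lemma qweyl_swap x y : qweyl x y -> y *m x = q ^+ 2 *: (x *m y) + (1 - q ^+ 2) *: 1%:M.
Proof. by move=> ->; lincomb K; rewrite /=; field. Qed.

Lemma qweylP x y : q ^+ 2 != 1 ->
  (q - q^-1)^-1 *: (q *: (x *m y) - q^-1 *: (y *m x)) = 1%:M <-> qweyl x y.
Proof.
move=> q1; have qq : q ^+ 2 - 1 != 0 by rewrite subr_eq0.
have qv : q - q^-1 != 0.
  apply: contra qq => /eqP h; have -> : q ^+ 2 - 1 = q * (q - q^-1) by field.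
  by rewrite h mulr0.
split=> [h|->].
  have : q^-1 * (q - q^-1) *: ((q - q^-1)^-1 *: (q *: (x *m y) - q^-1 *: (y *m x))) = q^-1 * (q - q^-1) *: 1%:M.
    by rewrite h.
  rewrite scalerA mulfK // /qweyl => h'.
  have -> : x *m y = q^-1 *: (q *: (x *m y) - q^-1 *: (y *m x)) + q ^- 2 *: (y *m x).
    by lincomb K; rewrite /=; field.
  by rewrite h'; lincomb K; rewrite /=; field.
by lincomb K; rewrite /=; field; rewrite ?q0 ?qq.
Qed.

Lemma qthreeE : q ^+ 2 != 1 -> qthree q = q ^+ 2 + 1 + q ^- 2.
Proof. by move=> q1; rewrite /qthree; field; rewrite q0 subr_eq0 q1. Qed.

(* The q-Serre expression is D_{q^2} D_{q^-2} D_1 t, where D_a t = y t - a t y. *)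
Lemma qserreE y t : q ^+ 2 != 1 -> forall t1 t2, t1 = y *m t - t *m y -> t2 = y *m t1 - q ^- 2 *: (t1 *m y) ->
  y *m y *m y *m t - qthree q *: (y *m y *m t *m y) + qthree q *: (y *m t *m y *m y) - t *m y *m y *m y
   = y *m t2 - q ^+ 2 *: (t2 *m y).
Proof.
move=> q1 t1 t2 -> ->; rewrite qthreeE //; ncexpand.
by lincomb K; rewrite /=; field.
Qed.

(** In D_1 t the commutator of [y] and [z] is killed by D_{q^-2}. The rest is a multiple of [z - x],
    which D_{q^-2} sends to a multiple of [x *m y - 1], and this is killed by D_{q^2}. *)
Lemma qserre_left x y z k t : q ^+ 2 != 1 -> qweyl x y -> qweyl y z -> t = z + k *: (x *m z - 1%:M) ->
  y *m y *m y *m t - (qthree q) *: (y *m y *m t *m y) + (qthree q) *: (y *m t *m y *m y) - t *m y *m y *m y = 0.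
Proof.
move=> q1 wxy wyz tE; have yx := qweyl_swap wxy; have zy := qweyl_swap wyz.
rewrite (qserreE q1 erefl erefl).
have -> : y *m t - t *m y = y *m z - z *m y + (k * (1 - q ^+ 2)) *: (z - x).
  rewrite tE; ncexpand; rewrite yx; ncexpand; rewrite -(mulmxA x z y) zy; ncexpand.
  by lincomb K; rewrite /=; field.
have e1 : y *m (y *m z - z *m y) = q ^- 2 *: ((y *m z - z *m y) *m y).
  by ncexpand; rewrite zy; ncexpand; rewrite -!(mulmxA y z y) zy; ncexpand; lincomb K; rewrite /=; field.
have -> : forall c, y *m (y *m z - z *m y + c *: (z - x)) - q ^- 2 *: ((y *m z - z *m y + c *: (z - x)) *m y)
   = c *: ((1 - q ^- 2) *: 1%:M - (y *m x - q ^- 2 *: (x *m y))).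
  move=> c; rewrite mulmxDr mulmxDl e1; ncexpand; rewrite zy; ncexpand.
  rewrite -!(mulmxA y z y) zy; ncexpand.
  by lincomb K; rewrite /=; field.
have -> : (1 - q ^- 2) *: 1%:M - (y *m x - q ^- 2 *: (x *m y)) = (q ^- 2 - q ^+ 2) *: (x *m y) + (q ^+ 2 - q ^- 2) *: 1%:M.
  by rewrite yx; lincomb K; rewrite /=; field.
by ncexpand; rewrite yx; ncexpand; lincomb K; rewrite /=; field.
Qed.

(** The mirror image of [qserre_left]: the commutator of [x] and [z] now survives D_{q^-2} up to a
    scalar and is killed by D_{q^2}. *)
Lemma qserre_right x y z k t : q ^+ 2 != 1 -> qweyl z x -> qweyl x y -> t = z + k *: (y *m z - 1%:M) ->
  x *m x *m x *m t - (qthree q) *: (x *m x *m t *m x) + (qthree q) *: (x *m t *m x *m x) - t *m x *m x *m x = 0.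
Proof.
move=> q1 wzx wxy tE; have xz := qweyl_swap wzx; have yx := qweyl_swap wxy.
rewrite (qserreE q1 erefl erefl).
have -> : x *m t - t *m x = x *m z - z *m x + (k * (1 - q ^- 2)) *: (z - y).
  rewrite tE; ncexpand; rewrite wxy; ncexpand; rewrite -(mulmxA y x z) -(mulmxA y z x) xz; ncexpand.
  by lincomb K; rewrite /=; field.
have e1 : x *m (x *m z - z *m x) = q ^+ 2 *: ((x *m z - z *m x) *m x).
  by ncexpand; rewrite -!(mulmxA x x z) xz; ncexpand; rewrite xz; ncexpand; lincomb K; rewrite /=; field.
have -> : forall c, x *m (x *m z - z *m x + c *: (z - y)) - q ^- 2 *: ((x *m z - z *m x + c *: (z - y)) *m x)
   = (q ^+ 2 - q ^- 2) *: ((x *m z - z *m x) *m x) + c *: (x *m z - q ^- 2 *: (z *m x) - (1 - q ^- 2) *: 1%:M).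
  move=> c; rewrite mulmxDr mulmxDl e1; ncexpand; rewrite wxy; ncexpand.
  by lincomb K; rewrite /=; field.
have e2 : x *m z = q ^+ 2 *: (z *m x) + (1 - q ^+ 2) *: 1%:M by rewrite xz; lincomb K; rewrite /=; field.
ncexpand; rewrite -!(mulmxA x x z) e2; ncexpand; rewrite !e2; ncexpand; rewrite ?e2; ncexpand.
by lincomb K; rewrite /=; field.
Qed.
End Weyl.

(** Products are kept left-associated, so a rule for [x *m y] does not match inside [a *m x *m y];
    this is the version that does. *)
Lemma mulmx_tail (K : pzRingType) (n : nat) (x y z : 'M[K]_n) :
  x *m y = z -> forall a : 'M[K]_n, a *m x *m y = a *m z.
Proof. by move=> <- a; rewrite mulmxA. Qed.

(* [w] is x_13, an eigenbasis of which is shifted one way by [r] and the other way by [l]. *)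
Section Evaluation.
Variables (K : fieldType) (n : nat) (q kap : K).
Hypotheses (q0 : q != 0) (kap0 : kap != 0).
Variables (w wi r l : 'M[K]_n).
Hypotheses (wwi : w *m wi = 1%:M) (wiw : wi *m w = 1%:M).
Hypotheses (wr : w *m r = q ^+ 2 *: (r *m w)) (wl : w *m l = q ^- 2 *: (l *m w)).
Hypothesis lr : l *m r = q ^- 2 *: (r *m l) + (1 - q ^- 2) *: (1%:M - wi *m wi).

Let x01 := wi + r.
Let x12 := w + kap *: (r *m w).
Let x23 := w + kap^-1 *: (l *m w).
Let x30 := wi + l.

Let wir : wi *m r = q ^- 2 *: (r *m wi).
Proof.
have: wi *m (w *m r) *m wi = wi *m (q ^+ 2 *: (r *m w)) *m wi by rewrite wr.
rewrite mulmxA wiw mul1mx -scalemxAr -scalemxAl -!mulmxA wwi mulmx1 => ->.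
by lincomb K; rewrite /=; field.
Qed.

Let wil : wi *m l = q ^+ 2 *: (l *m wi).
Proof.
have: wi *m (w *m l) *m wi = wi *m (q ^- 2 *: (l *m w)) *m wi by rewrite wl.
rewrite mulmxA wiw mul1mx -scalemxAr -scalemxAl -!mulmxA wwi mulmx1 => ->.
by lincomb K; rewrite /=; field.
Qed.

Ltac norm := do 6? (rewrite ?(wr, wl, wir, wil, wwi, wiw, lr, mulmx_tail wr, mulmx_tail wl,
   mulmx_tail wir, mulmx_tail wil, mulmx_tail wwi, mulmx_tail wiw, mulmx_tail lr); ncexpand).

(** In this and the next relations, [norm] moves [w] and [wi] to the right and [r] to the left of
    [l], and both sides reach the same normal form. Only the pairs 12-23 and 30-01 mix [r] and [l]
    and depend on [lr]. *)
Lemma eval_weyl01_12 : qweyl q x01 x12.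
Proof. rewrite /qweyl /x01 /x12; ncexpand; norm; by lincomb K; rewrite /=; field. Qed.
Lemma eval_weyl12_23 : qweyl q x12 x23.
Proof. rewrite /qweyl /x23 /x12; ncexpand; norm; by lincomb K; rewrite /=; field; rewrite ?q0 ?kap0. Qed.
Lemma eval_weyl23_30 : qweyl q x23 x30.
Proof. rewrite /qweyl /x23 /x30; ncexpand; norm; by lincomb K; rewrite /=; field; rewrite ?q0 ?kap0. Qed.
Lemma eval_weyl30_01 : qweyl q x30 x01.
Proof. rewrite /qweyl /x01 /x30; ncexpand; norm; by lincomb K; rewrite /=; field; rewrite ?q0 ?kap0. Qed.
Lemma eval_weyl01_13 : qweyl q x01 w.
Proof. rewrite /qweyl /x01; ncexpand; norm; by lincomb K; rewrite /=; field; rewrite ?q0 ?kap0. Qed.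
Lemma eval_weyl13_30 : qweyl q w x30.
Proof. rewrite /qweyl /x30; ncexpand; norm; by lincomb K; rewrite /=; field; rewrite ?q0 ?kap0. Qed.
Lemma eval_weyl23_31 : qweyl q x23 wi.
Proof. rewrite /qweyl /x23; ncexpand; norm; by lincomb K; rewrite /=; field; rewrite ?q0 ?kap0. Qed.
Lemma eval_weyl31_12 : qweyl q wi x12.
Proof. rewrite /qweyl /x12; ncexpand; norm; by lincomb K; rewrite /=; field; rewrite ?q0 ?kap0. Qed.

(** The four identities from here on have the shape that [qserre_left] and [qserre_right] demand of
    [t]; they are the source of the cubic relations. *)
Lemma eval_x12E : x12 = w + kap *: (x01 *m w - 1%:M).
Proof. rewrite /x12 /x01; ncexpand; norm; by lincomb K; rewrite /=; field. Qed.
Lemma eval_x23E : x23 = w + kap^-1 *: (x30 *m w - 1%:M).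
Proof. rewrite /x23 /x30; ncexpand; norm; by lincomb K; rewrite /=; field. Qed.
Lemma eval_x01E : x01 = wi + kap^-1 *: (x12 *m wi - 1%:M).
Proof. rewrite /x12 /x01; ncexpand; norm; by lincomb K; rewrite /=; field. Qed.
Lemma eval_x30E : x30 = wi + kap *: (x23 *m wi - 1%:M).
Proof. rewrite /x23 /x30; ncexpand; norm; by lincomb K; rewrite /=; field. Qed.
End Evaluation.

(** Derives an identity from a known one when the two differences agree formally, which [lincomb] or
    [ring] can check. *)
Lemma subr_transfer (V : zmodType) (a b c d : V) : a = b -> c - d = a - b -> c = d.
Proof. by move=> ->; rewrite subrr => /eqP; rewrite subr_eq0 => /eqP. Qed.

(* Construction of x_20 as [k20], with [x] = x_30, [y] = x_01 and [w] = x_13: [N] is the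
   solution of x_30 - x_01^-1 = N (1 + kap x_01). *)
Section Corner.
Variables (K : fieldType) (n : nat) (q kap : K).
Hypotheses (q0 : q != 0) (kap0 : kap != 0).
Variables (w x y yi N rho : 'M[K]_n).
Hypotheses (yyi : y *m yi = 1%:M) (yiy : yi *m y = 1%:M).
Hypotheses (wyw : qweyl q y w) (wwx : qweyl q w x).
Hypothesis yN : y *m N = q ^+ 2 *: (N *m y).
Hypothesis wE : w = yi + rho.
Hypothesis xE : x = yi + N *m (1%:M + kap *: y).

Let k20 := yi + N.
Let x12 := w + kap *: (y *m w - 1%:M).
Let x23 := w + kap^-1 *: (x *m w - 1%:M).

Let Ny : N *m y = q ^- 2 *: (y *m N).
Proof. by rewrite yN; lincomb K; rewrite /=; field. Qed.

Let Nyi : N *m yi = q ^+ 2 *: (yi *m N).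
Proof.
have: yi *m (y *m N) *m yi = yi *m (q ^+ 2 *: (N *m y)) *m yi by rewrite yN.
by rewrite mulmxA yiy mul1mx -scalemxAr -scalemxAl -!mulmxA yyi mulmx1.
Qed.

Let rhoy : rho *m y = q ^+ 2 *: (y *m rho).
Proof.
have := qweyl_swap q0 wyw; rewrite wE; ncexpand; rewrite yyi yiy => e.
apply: (addrI (1%:M : 'M_n)); rewrite e.
by lincomb K; rewrite /=; field.
Qed.

Let rhoyi : rho *m yi = q ^- 2 *: (yi *m rho).
Proof.
have: yi *m (rho *m y) *m yi = yi *m (q ^+ 2 *: (y *m rho)) *m yi by rewrite rhoy.
rewrite -scalemxAr -scalemxAl !mulmxA yiy mul1mx -!mulmxA yyi mulmx1 => e.
by rewrite e; lincomb K; rewrite /=; field.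
Qed.

Ltac norm := do 6? (rewrite ?(Ny, Nyi, rhoy, rhoyi, yyi, yiy, mulmx_tail Ny, mulmx_tail Nyi,
   mulmx_tail rhoy, mulmx_tail rhoyi, mulmx_tail yyi, mulmx_tail yiy); ncexpand).

Ltac lin := lincomb K; rewrite /=; field; rewrite ?q0 ?kap0.

(** The Weyl relation of x_13 and x_30, read as a commutation rule between [rho] and [N], the two
    corrections added to [yi]. *)
Let rhoN : rho *m N = q ^- 2 *: (N *m rho) + (kap * q ^- 4) *: (y *m N *m rho) +
   (1 - q ^- 2) *: (1%:M - yi *m yi) - kap *: (y *m rho *m N).
Proof.
have := wwx; rewrite /qweyl xE wE; ncexpand; norm => e.
apply: (subr_transfer e); by lin.
Qed.

Lemma corner_weyl20_01 : qweyl q k20 y.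
Proof. rewrite /qweyl /k20; ncexpand; norm; by lin. Qed.

Lemma corner_weyl12_20 : qweyl q x12 k20.
Proof. rewrite /qweyl /k20 /x12 wE; ncexpand; norm.
by apply: (subr_transfer rhoN); lin. Qed.

Lemma corner_x23E : x23 = k20 + (q ^+ 2 / kap) *: (x12 *m k20 - 1%:M).
Proof. rewrite /x23 /k20 /x12 xE wE; ncexpand; norm.
have /= e := congr1 (fun z : 'M_n => (- (q ^+ 2 / kap)) *: z) rhoN.
by apply: (subr_transfer e); lin. Qed.

(** Serves twice: it leads to [corner_x30_20], and it makes every kernel vector of [k20] an
    eigenvector of x_30 with eigenvalue -kap/q^2. *)
Lemma corner_x30E : x + (kap / q ^+ 2) *: 1%:M = (1%:M + (kap / q ^+ 2) *: y) *m k20.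
Proof. rewrite /k20 xE; ncexpand; norm; by lin. Qed.

(** The Weyl relation of x_30 and x_02, multiplied by x_20 on both sides so that it can be stated
    before x_20 is known to be invertible. The lemma [corner_x23_20] does the same for x_02 and
    x_23. *)
Lemma corner_x30_20 : k20 *m x = q ^- 2 *: (x *m k20) + (1 - q ^- 2) *: (k20 *m k20).
Proof.
move: corner_weyl20_01 corner_x30E; rewrite /qweyl; clearbody k20 => e2 e1.
have -> : x = k20 + (kap / q ^+ 2) *: (y *m k20 - 1%:M).
  by apply: (subr_transfer e1); ncexpand; lin.
ncexpand; rewrite e2; ncexpand; by lin.
Qed.

Lemma corner_x23_20 : x23 *m k20 = q ^- 2 *: (k20 *m x23) + (1 - q ^- 2) *: (k20 *m k20).
Proof.
have e2 : x12 *m k20 = q ^- 2 *: (k20 *m x12) + (1 - q ^- 2) *: 1%:M := corner_weyl12_20.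
move: e2 corner_x23E; clearbody k20 x12 x23 => e2 ->; ncexpand; rewrite e2; ncexpand.
by rewrite -(mulmxA k20 x12 k20) e2; ncexpand; lin.
Qed.

Variable ki : 'M[K]_n.
Hypotheses (kki : k20 *m ki = 1%:M) (kik : ki *m k20 = 1%:M).

Lemma corner_weyl30_02 : qweyl q x ki.
Proof.
have : ki *m (k20 *m x) *m ki = ki *m (q ^- 2 *: (x *m k20) + (1 - q ^- 2) *: (k20 *m k20)) *m ki.
  by rewrite corner_x30_20.
clearbody k20; ncexpand; by rewrite kik !mul1mx -!(mulmxA _ k20 ki) kki !mulmx1.
Qed.

Lemma corner_weyl02_23 : qweyl q ki x23.
Proof.
have : ki *m (x23 *m k20) *m ki = ki *m (q ^- 2 *: (k20 *m x23) + (1 - q ^- 2) *: (k20 *m k20)) *m ki.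
  by rewrite corner_x23_20.
clearbody k20 x23; ncexpand; by rewrite kik !mul1mx -!(mulmxA _ k20 ki) kki !mulmx1.
Qed.
End Corner.

(** * Diagonal, subdiagonal and superdiagonal matrices *)

Section Band.
Variables (K : fieldType) (d : nat).
Local Notation M := 'M[K]_d.+1.

Definition diagm (s : nat -> K) : M := \matrix_(i, j) (if i == j then s j else 0).
Definition subm (s : nat -> K) : M := \matrix_(i, j) (if i == j.+1 :> nat then s j else 0).
Definition supm (s : nat -> K) : M := \matrix_(i, j) (if j == i.+1 :> nat then s j else 0).

Lemma addmxij (A B : M) i j : (A + B) i j = A i j + B i j.
Proof. by rewrite mxE. Qed.

Lemma scalemxij k (A : M) i j : (k *: A) i j = k * A i j.
Proof. by rewrite mxE. Qed.

Lemma mul_diagm s (B : M) i j : (diagm s *m B) i j = s i * B i j.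
Proof.
rewrite mxE (bigD1 i) //= !mxE eqxx big1 ?addr0 // => k ne.
by rewrite !mxE eq_sym (negPf ne) mul0r.
Qed.

Lemma mul_mx_diagm s (B : M) i j : (B *m diagm s) i j = B i j * s j.
Proof.
rewrite mxE (bigD1 j) //= !mxE eqxx big1 ?addr0 // => k ne.
by rewrite !mxE (negPf ne) mulr0.
Qed.

Lemma diagmM s t : diagm s *m diagm t = diagm (fun i => s i * t i).
Proof. by apply/matrixP => i j; rewrite mul_diagm !mxE; case: eqP => [->|]; rewrite ?mulr0. Qed.

Lemma diagm1 : diagm (fun=> 1) = 1%:M.
Proof. by apply/matrixP => i j; rewrite !mxE; case: eqP. Qed.

Lemma supm_subm s t : supm s *m subm t = diagm (fun j => if (j < d)%N then s j.+1 * t j else 0).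
Proof.
apply/matrixP => i j; rewrite !mxE.
have [jd|dj] := ltnP j d.
  have jd1 : (j.+1 < d.+1)%N by [].
  rewrite (bigD1 (Ordinal jd1)) //= !mxE eqxx eqSS big1 ?addr0.
    by rewrite [_ == i :> nat]eq_sym -val_eqE /=; case: eqP => // _; rewrite mul0r.
  move=> k ne; rewrite !mxE (_ : (k == j.+1 :> nat) = false) ?mulr0 //.
  by apply: contraNF ne => /eqP kj; apply/eqP/val_inj.
rewrite if_same big1 // => k _; rewrite !mxE (_ : (k == j.+1 :> nat) = false) ?mulr0 //.
by apply/eqP => kj; move: (ltn_ord k); rewrite kj ltnS ltnNge dj.
Qed.

Lemma subm_supm s t : subm t *m supm s = diagm (fun j => if j is k.+1 then t k * s j else 0).
Proof.
apply/matrixP => i j; rewrite !mxE.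
case: j => -[|j] jd /=.
  by rewrite if_same big1 // => k _; rewrite !mxE /= mulr0.
have jd1 : (j < d.+1)%N by apply: ltnW.
rewrite (bigD1 (Ordinal jd1)) //= !mxE /= eqxx big1 ?addr0.
  by rewrite -val_eqE /=; case: eqP => // _; rewrite mul0r.
move=> k ne; rewrite !mxE /= eqSS (_ : (j == k :> nat) = false) ?mulr0 //.
by apply: contraNF ne => /eqP kj; apply/eqP/val_inj.
Qed.

Lemma eq_diagm s t : (forall j, (j <= d)%N -> s j = t j) -> diagm s = diagm t.
Proof. by move=> e; apply/matrixP => i j; rewrite !mxE e // -ltnS. Qed.

Lemma col0_unitmx (B : M) : (forall v : 'cV[K]_d.+1, B *m v = 0 -> v = 0) -> B \in unitmx.
Proof.
move=> inj; rewrite unitmxE unitfE -det_tr; apply/det0P => -[v v0 e].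
case/negP: v0; rewrite -trmx_eq0; apply/eqP/inj/(can_inj (@trmxK _ _ _)).
by rewrite trmx_mul trmxK e trmx0.
Qed.

End Band.

(** * Evaluating formal expressions and checking the relations on eight matrices *)

Section Evaluate.
Variables (K : fieldType) (G : Type) (n : nat) (X : G -> 'M[K]_n).

Fixpoint expr_eval (t : expr K G) : 'M[K]_n :=
  match t with
  | EGen g => X g
  | EZero => 0
  | EOne => 1%:M
  | EAdd s t => expr_eval s + expr_eval t
  | EOpp t => - expr_eval t
  | EMul s t => expr_eval s *m expr_eval t
  | EScale k t => k *: expr_eval t
  end.

End Evaluate.

Definition tet_pair (i j : 'Z_4) (ij : tet_adj i j) : tet_gen :=
  exist (fun p : 'Z_4 * 'Z_4 => is_true (tet_adj p.1 p.2)) (i, j) ij.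

Lemma tet_inv_cases (i j : 'Z_4) : j - i = 2%:R ->
  (nat_of_ord i, nat_of_ord j) \in [:: (0, 2); (1, 3); (2, 0); (3, 1)]%N.
Proof.
by move/eqP; case: i => [[|[|[|[|?]]]] ?] //; case: j => [[|[|[|[|?]]]] ?].
Qed.

Lemma tet_weyl_cases (h i j : 'Z_4) : (i - h, j - i) \in [:: (1, 1); (1, 2%:R); (2%:R, 1)] ->
  (nat_of_ord h, nat_of_ord i, nat_of_ord j) \in
    [:: (0, 1, 2); (1, 2, 3); (2, 3, 0); (3, 0, 1);
        (0, 1, 3); (1, 2, 0); (2, 3, 1); (3, 0, 2);
        (0, 2, 3); (1, 3, 0); (2, 0, 1); (3, 1, 2)]%N.
Proof.
by case: h => [[|[|[|[|?]]]] ?] //; case: i => [[|[|[|[|?]]]] ?] //; case: j => [[|[|[|[|?]]]] ?].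
Qed.

Lemma tet_serre_cases (h i j k : 'Z_4) : i - h = 1 -> j - i = 1 -> k - j = 1 ->
  (nat_of_ord h, nat_of_ord i, nat_of_ord j, nat_of_ord k) \in
    [:: (0, 1, 2, 3); (1, 2, 3, 0); (2, 3, 0, 1); (3, 0, 1, 2)]%N.
Proof.
move/eqP; case: h => [[|[|[|[|?]]]] ?] //; case: i => [[|[|[|[|?]]]] ?] // _;
  move/eqP; case: j => [[|[|[|[|?]]]] ?] // _; move/eqP; case: k => [[|[|[|[|?]]]] ?] //.
Qed.

Section TetModel.
Variables (K : fieldType) (n : nat) (q k : K).
Variables (x01 x12 x23 x30 x02 x20 x13 x31 : 'M[K]_n).
Hypotheses (q0 : q != 0) (q2 : q ^+ 2 != 1).
Hypotheses (i02 : x02 *m x20 = 1%:M) (i20 : x20 *m x02 = 1%:M)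
  (i13 : x13 *m x31 = 1%:M) (i31 : x31 *m x13 = 1%:M).
Hypotheses (w012 : qweyl q x01 x12) (w123 : qweyl q x12 x23)
  (w230 : qweyl q x23 x30) (w301 : qweyl q x30 x01)
  (w013 : qweyl q x01 x13) (w120 : qweyl q x12 x20)
  (w231 : qweyl q x23 x31) (w302 : qweyl q x30 x02)
  (w023 : qweyl q x02 x23) (w130 : qweyl q x13 x30)
  (w201 : qweyl q x20 x01) (w312 : qweyl q x31 x12).
Hypotheses (e12 : x12 = x13 + k *: (x01 *m x13 - 1%:M))
  (e23 : x23 = x13 + k^-1 *: (x30 *m x13 - 1%:M))
  (e01 : x01 = x31 + k^-1 *: (x12 *m x31 - 1%:M))
  (e30 : x30 = x31 + k *: (x23 *m x31 - 1%:M)).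

(** Indexed by natural numbers so that the finite case analyses compute. The default 0 is never
    reached on a pair satisfying [tet_adj]. *)
Definition tet_images (i j : nat) : 'M[K]_n :=
  match i, j return 'M[K]_n with
  | 0%N, 1%N => x01 | 1%N, 2%N => x12 | 2%N, 3%N => x23 | 3%N, 0%N => x30
  | 0%N, 2%N => x02 | 2%N, 0%N => x20 | 1%N, 3%N => x13 | 3%N, 1%N => x31
  | _, _ => 0
  end.

Definition tet_map (g : tet_gen) : 'M[K]_n := tet_images (sval g).1 (sval g).2.

Lemma tet_map_rel s t : qtet_rel q s t -> expr_eval tet_map s = expr_eval tet_map t.
Proof.
case=> {s t} [i j ij ji /tet_inv_cases|h i j hi ij /tet_weyl_cases|h i j l hi jl e1 e2 e3].
- by rewrite /tet_map /= !inE => /or4P [] /eqP [-> ->].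
- move=> c; rewrite /= /tet_map /=; apply/(qweylP q0) => //.
  by move: c; rewrite !inE; do ![case/predU1P; first by move=> [-> -> ->]]; case/eqP => -> -> ->.
have := tet_serre_cases e1 e2 e3; rewrite /= /tet_map /= !inE => /or4P [] /eqP [-> -> -> ->] /=.
- exact: (qserre_left q0 q2 w301 w013 e23).
- exact: (qserre_right q0 q2 w312 w123 e30).
- exact: (qserre_left q0 q2 w123 w231 e01).
- exact: (qserre_right q0 q2 w130 w301 e12).
Qed.

End TetModel.

(** * The evaluation matrices with parameter c and the construction of x_20 *)

Section Model.
Variables (K : fieldType) (d : nat) (q a b as_ bs c : K).
Hypotheses (q0 : q != 0) (c0 : c != 0).

Definition lam (i : nat) : K := q ^+ (2 * i) / q ^+ d.

Hypothesis ab0 : forall i, (1 <= i <= d)%N -> a + b * c * (lam i / q) != 0.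
Hypothesis ab2 : forall i, (1 <= i <= d)%N -> 1 + c * (lam i / q) != 0.

(* (1 - q^(-2i)) (1 - q^(2d-2i+2)) *)
Definition lfact (i : nat) : K := (1 - (q ^+ d * lam i)^-1) * (1 - q ^+ d * q ^+ 2 / lam i).

Let phi i := lfact i * (a + b * c * (lam i / q)) * (bs + as_ / c * (lam i / q)).

Local Notation M := 'M[K]_d.+1.

Lemma lam_neq0 i : lam i != 0.
Proof. by rewrite mulf_neq0 ?invr_eq0 ?expf_neq0. Qed.

Lemma lamS i : lam i.+1 = q ^+ 2 * lam i.
Proof. by rewrite /lam mulnS exprD mulrA. Qed.

Let w : M := diagm d lam.
Let wi : M := diagm d (fun i => (lam i)^-1).
(** The entries of [r] are forced by the subdiagonal of a x_01 + b x_12 being 1. Those of [l] are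
    then chosen so that [l *m r] and [r *m l] are the diagonal matrices of [lfact j.+1] and
    [lfact j], which is what [lr] requires. *)
Let r : M := subm d (fun j => (a + b * c * q * lam j)^-1).
Let l : M := supm d (fun j => lfact j * (a + b * c * (lam j / q))).

Let wwi : w *m wi = 1%:M.
Proof. by rewrite diagmM -diagm1; apply: eq_diagm => j _; rewrite mulfV ?lam_neq0. Qed.
Let wiw : wi *m w = 1%:M.
Proof. by rewrite diagmM -diagm1; apply: eq_diagm => j _; rewrite mulVf ?lam_neq0. Qed.

Let wr : w *m r = q ^+ 2 *: (r *m w).
Proof.
apply/matrixP => i j; rewrite mul_diagm [RHS]mxE mul_mx_diagm !mxE.
by case: eqP => [->|]; rewrite ?(mulr0, mul0r) // lamS; ring.
Qed.

Let wl : w *m l = q ^- 2 *: (l *m w).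
Proof.
apply/matrixP => i j; rewrite mul_diagm [RHS]mxE mul_mx_diagm !mxE.
by case: eqP => [->|]; rewrite ?(mulr0, mul0r) // lamS; field.
Qed.

Let qd0 : q ^+ d != 0. Proof. exact: expf_neq0. Qed.

Let abS j : (j < d)%N -> a + b * c * q * lam j != 0.
Proof.
move=> jd; have := @ab0 j.+1; rewrite jd => /(_ isT).
by rewrite lamS; congr (_ != 0); field.
Qed.

Let lr : l *m r = q ^- 2 *: (r *m l) + (1 - q ^- 2) *: (1%:M - wi *m wi).
Proof.
have -> : l *m r = diagm d (fun j => lfact j.+1).
  rewrite supm_subm; apply: eq_diagm => j; rewrite leq_eqVlt => /predU1P [->|jd].
    rewrite ltnn /lfact lamS /lam mul2n -addnn exprD; set Q := q ^+ d.
    by field; rewrite q0 qd0.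
  rewrite jd lamS; have := abS jd; set A := a + _ => A0; set L := lfact _.
  have -> : a + b * c * (q ^+ 2 * lam j / q) = A by rewrite /A; field.
  by rewrite mulfK.
have -> : r *m l = diagm d lfact.
  rewrite subm_supm; apply: eq_diagm => -[_|j jd].
    by rewrite /lfact /lam expr0 mul1r mulfV // invr1 subrr mul0r.
  rewrite lamS; have := abS jd; set A := a + _ => A0; set L := lfact _.
  have -> : a + b * c * (q ^+ 2 * lam j / q) = A by rewrite /A; field.
  by rewrite mulrC mulfK.
rewrite diagmM -diagm1; apply/matrixP => i j; rewrite !mxE; case: eqP => [_|]; last by move=> _; ring.
rewrite /lfact lamS; have := lam_neq0 j; set L := lam j => L0; set Q := q ^+ d.
by field; rewrite q0 qd0 L0.
Qed.

Let kap := q * c.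
Let kap0 : kap != 0. Proof. by rewrite mulf_neq0. Qed.

Definition mod01 := wi + r.
Definition mod12 := w + kap *: (r *m w).
Definition mod23 := w + kap^-1 *: (l *m w).
Definition mod30 := wi + l.

Let y := mod01.
Let x := mod30.
Let yi := invmx y.
Let rho := w - yi.

Lemma mod01_trig (i j : 'I_d.+1) : (i < j)%N -> y i j = 0.
Proof.
move=> ij; rewrite !mxE (_ : (i == j) = false); last by apply/eqP => e; move: ij; rewrite e ltnn.
by rewrite (_ : (i == j.+1 :> nat) = false) ?addr0 //; apply/eqP => e; move: ij; rewrite e ltnNge leqnSn.
Qed.

Lemma mod01_diag (i : 'I_d.+1) : y i i = (lam i)^-1.
Proof. by rewrite !mxE eqxx [X in if X then _ else _](_ : _ = false) ?addr0 //; apply/eqP; elim: (nat_of_ord i) => // n IH []. Qed.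

Lemma mod01_unit : y \in unitmx.
Proof.
rewrite unitmxE unitfE det_trig; last by apply/is_trig_mxP => i j; apply: mod01_trig.
by apply/prodf_neq0 => i _; rewrite mod01_diag invr_eq0 lam_neq0.
Qed.

Lemma mod01_12 :
  a *: mod01 + b *: mod12 = \matrix_(i, j) (if i == j then a / lam j + b * lam j else if i == j.+1 :> nat then 1 else 0).
Proof.
apply/matrixP => i j; rewrite !(addmxij, scalemxij) mul_mx_diagm !mxE.
case: eqP => [->|ne].
  rewrite (_ : (j == j.+1 :> nat) = false); first by field; rewrite lam_neq0.
  by elim: (nat_of_ord j).
case: eqP => [e|]; last by move=> _; ring.
have jd : (j < d)%N by rewrite -ltnS -e.
by rewrite /kap; field; apply: abS.
Qed.

Lemma mod23_30 :
  as_ *: mod23 + bs *: mod30 = \matrix_(i, j) (if i == j then as_ * lam j + bs / lam j else if j == i.+1 :> nat then phi j else 0).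
Proof.
apply/matrixP => i j; rewrite !(addmxij, scalemxij) mul_mx_diagm !mxE.
case: eqP => [->|ne].
  rewrite (_ : (j == j.+1 :> nat) = false); first by field; rewrite lam_neq0.
  by elim: (nat_of_ord j).
case: eqP => [e|]; last by move=> _; ring.
by rewrite /kap /phi; field; rewrite q0.
Qed.

Let u0 : 'cV[K]_d.+1 := delta_mx 0 0.

(** The split basis of the pair x_30, x_01. The factors run over the eigenvalues of [y] for indices
    1 to k; the eigenvalue q^d of index 0 is left out, so that [sv d] belongs to it. *)
Fixpoint split_vec (k : nat) : 'cV[K]_d.+1 :=
  if k is k'.+1 then y *m split_vec k' - (lam k)^-1 *: split_vec k' else u0.
Arguments split_vec : simpl never.
Local Notation sv := split_vec.

Lemma split_vecS k : sv k.+1 = y *m sv k - (lam k.+1)^-1 *: sv k.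
Proof. by []. Qed.

Let wxy : qweyl q x y. Proof. exact: (eval_weyl30_01 q0 wwi wiw wr wl lr). Qed.

Lemma mulmx_u0 (B : M) i : (B *m u0) i 0 = B i 0.
Proof. by rewrite mxE (bigD1 0) //= mxE !eqxx mulr1 big1 ?addr0 // => k ne; rewrite mxE (negPf ne) mulr0. Qed.

(** Induction on k by the Weyl relation of x_30 and x_01. The second coefficient vanishes at k = d,
    where lam d = q^d, so [sv d] is an eigenvector of x_30 too. *)
Lemma mod30_split_vec k :
  x *m sv k = (lam k)^-1 *: sv k
     + ((1 - (q ^+ d * lam k)^-1) * (1 - q ^+ d / lam k)) *: (if k is k'.+1 then sv k' else 0).
Proof.
elim: k => [|k IH].
  rewrite scaler0 addr0; apply/matrixP => i j; rewrite ord1 mulmx_u0 !mxE.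
  by rewrite /= !addr0 eqxx andbT; case: eqP => _; rewrite ?mulr1 ?mulr0.
have e : x *m y = q ^- 2 *: (y *m x) + (1 - q ^- 2) *: 1%:M := wxy.
rewrite [in LHS]split_vecS mulmxBr -scalemxAr mulmxA e mulmxDl -!scalemxAl mul1mx -mulmxA IH.
have yk : y *m sv k = sv k.+1 + (lam k.+1)^-1 *: sv k by rewrite split_vecS subrK.
rewrite mulmxDr -!scalemxAr yk.
have -> : forall c, c *: (y *m (if k is k'.+1 then sv k' else 0)) =
   c *: (if k is k'.+1 then sv k + (lam k)^-1 *: sv k' else 0).
  by move=> c'; case: (k) => [|k'] /=; rewrite ?mulmx0 // subrK.
have lam0 := lam_neq0 k; rewrite lamS.
move: (sv k.+1) yk => v1 yk; case: k {yk IH} v1 lam0 => [|k] v1 lam0.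
  rewrite !scaler0 addr0.
  have -> : lam 0 = (q ^+ d)^-1 by rewrite /lam expr0 mul1r.
  move: (q ^+ d) qd0 => Q Q0.
  by rewrite /= ?scaler0 ?addr0; lincomb K; rewrite /=; field; rewrite ?Q0 ?q0 ?oner_neq0.
move: (q ^+ d) qd0 => Q Q0.
by rewrite /=; lincomb K; rewrite /=; field; rewrite ?Q0 ?q0 ?lam0.
Qed.

Let L0 := x - yi.

Let yyi : y *m yi = 1%:M. Proof. exact: mulmxV mod01_unit. Qed.
Let yiy : yi *m y = 1%:M. Proof. exact: mulVmx mod01_unit. Qed.

Let L0y : L0 *m y = q ^- 2 *: (y *m L0).
Proof.
have e : x *m y = q ^- 2 *: (y *m x) + (1 - q ^- 2) *: 1%:M := wxy.
rewrite mulmxBl mulmxBr e yyi yiy.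
by lincomb K; rewrite /=; field.
Qed.

Definition split_poly k : {poly K} := \prod_(j < k) ('X - ((lam j.+1)^-1)%:P).

Lemma split_vecE k : sv k = horner_mx y (split_poly k) *m u0.
Proof.
elim: k => [|k IH]; first by rewrite /split_poly big_ord0 rmorph1 mul1mx.
rewrite split_vecS IH /split_poly big_ord_recr /= mulrC rmorphM rmorphB /= horner_mx_X horner_mx_C.
by rewrite -mulmxE -mulmxA mulmxBl mul_scalar_mx.
Qed.

(** The matrix [y] is triangular, so its characteristic polynomial is [split_poly d] times the
    linear factor of its first diagonal entry q^d; Cayley-Hamilton is applied to [u0]. *)
Lemma mod01_split_last : y *m sv d = q ^+ d *: sv d.
Proof.
have := Cayley_Hamilton y; rewrite char_poly_trig; last first.
  by apply/is_trig_mxP => i j; apply: mod01_trig.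
rewrite big_ord_recl => /(congr1 (fun B => B *m u0)).
rewrite (eq_bigr (fun i : 'I_d => 'X - ((lam i.+1)^-1)%:P)) => [|i _]; last by rewrite mod01_diag.
rewrite rmorphM rmorphB /= horner_mx_X horner_mx_C mod01_diag mul0mx -mulmxE -mulmxA -split_vecE.
rewrite mulmxBl mul_scalar_mx => /eqP; rewrite subr_eq0 => /eqP ->.
by rewrite /lam expr0 mul1r invrK.
Qed.

Lemma L0_split_last : L0 *m sv d = 0.
Proof.
have e : yi *m sv d = (q ^+ d)^-1 *: sv d.
  by rewrite -[sv d in LHS](scalerK qd0) -mod01_split_last -scalemxAr mulmxA yiy mul1mx.
rewrite mulmxBl mod30_split_vec e.
have -> : lam d = q ^+ d by rewrite /lam mul2n -addnn exprD mulfK.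
by rewrite mulfV // subrr mulr0 scale0r addr0 subrr.
Qed.

Lemma mod01_delta (i : nat) (i1 : (i < d.+1)%N) (i2 : (i.+1 < d.+1)%N) :
  exists2 g, g != 0 & y *m delta_mx (Ordinal i1) 0 = (lam i)^-1 *: delta_mx (Ordinal i1) 0 + g *: delta_mx (Ordinal i2) 0 :> 'cV_d.+1.
Proof.
exists (a + b * c * q * lam i)^-1; first by rewrite invr_eq0 abS.
rewrite -colE; apply/matrixP => k m; rewrite ord1 !mxE eqxx !andbT -!val_eqE /=.
by do 2 case: eqP => _; rewrite /= ?mulr1 ?mulr0.
Qed.

(* [split_poly d] is the characteristic polynomial of [y] without the root [q ^+ d];
   inverting [1 + kap X] modulo [split_poly d] yields the matrix [N] of section [Corner]. *)
Lemma L0_split_poly : L0 *m horner_mx y (split_poly d) = 0.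
Proof.
set m := horner_mx y _.
have my : m *m y = y *m m.
  exact: comm_horner_mx (comm_mx_refl y).
(* The kernel of [L0 *m m] is stable under [y] by [L0y] and contains [u0], which generates the whole
   space under [y] because the subdiagonal of [y] has no zero. *)
suff h i (i1 : (i < d.+1)%N) : L0 *m m *m delta_mx (Ordinal i1) 0 = 0 :> 'cV_d.+1.
  apply/matrixP => i j; have := h j (ltn_ord j).
  have -> : Ordinal (ltn_ord j) = j by apply: val_inj.
  rewrite -colE => /matrixP/(_ i 0); rewrite [LHS]mxE => ->.
  by rewrite !mxE.
elim: i i1 => [|i IH] i1.
  have -> : Ordinal i1 = 0 by apply: val_inj.
  by rewrite -mulmxA -split_vecE L0_split_last.
have i2 : (i < d.+1)%N by apply: ltnW.
have [g g0 e] := mod01_delta i2 i1.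
have := congr1 (fun v => L0 *m m *m v) e.
rewrite mulmxDr -!scalemxAr IH scaler0 add0r mulmxA -[L0 *m m *m y]mulmxA my (mulmxA L0) L0y.
rewrite -!scalemxAl -!mulmxA (mulmxA L0) IH mulmx0 scaler0 => /esym/eqP.
rewrite scaler_eq0 (negPf g0) /= => /eqP.
by rewrite mulmxA.
Qed.

Lemma corner_poly : exists g : {poly K},
  L0 *m horner_mx y g *m (1%:M + kap *: y) = L0.
Proof.
pose z := - kap^-1; have z0 : (split_poly d).[z] != 0.
  rewrite horner_prod; apply/prodf_neq0 => j _; rewrite !hornerE.
  have := @ab2 (d - j)%N; rewrite subn_gt0 ltn_ord leq_subr => /(_ isT); apply: contra => /eqP e.
  have lE : lam (d - j) = q ^+ 2 / lam j.+1.
    have jd := ltnW (ltn_ord j); apply: (mulIf (lam_neq0 j.+1)); rewrite divfK ?lam_neq0 //.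
    rewrite /lam mulrACA -exprD -invfM -exprD -mulnDr addnS subnK // mulnS exprD mul2n -addnn.
    by rewrite mulfK // expf_neq0.
  (* The index reversal matches the d factors of [split_poly d] at [z] with the d nonvanishing
     conditions [ab2]. *)
  have -> : 1 + c * (lam (d - j) / q) = - kap * (z - (lam j.+1)^-1).
    by rewrite lE /z /kap; field; rewrite lam_neq0 q0 c0.
  by rewrite e mulr0.
(* Up to a scalar 1 + kap X is X - z, so the quotient [h] is its inverse modulo [split_poly d], up
   to the nonzero constant [(split_poly d).[z]]. *)
have /factor_theorem [h hE] : root (split_poly d - (split_poly d).[z]%:P) z.
  by rewrite /root !hornerE subrr.
exists (- (kap * (split_poly d).[z])^-1 *: h).
have e : L0 *m horner_mx y h *m (kap *: y + 1%:M) = (- (kap * (split_poly d).[z])) *: L0.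
  have -> : kap *: y + 1%:M = kap *: horner_mx y ('X - z%:P).
    rewrite rmorphB /= horner_mx_X horner_mx_C scalerBr scale_scalar_mx /z.
    by rewrite mulrN mulfV // raddfN opprK.
  rewrite -scalemxAr -mulmxA mulmxE -rmorphM -hE rmorphB /= horner_mx_C -mulmxE.
  by rewrite mulmxBr L0_split_poly sub0r mul_mx_scalar scalerN scalerA scaleNr.
rewrite linearZ /= -scalemxAr -scalemxAl addrC e scalerA mulrNN mulVf ?scale1r //.
by rewrite mulf_neq0.
Qed.

Let wyw : qweyl q y w. Proof. exact: (eval_weyl01_13 q0 wwi wiw wr). Qed.
Let wwx : qweyl q w x. Proof. exact: (eval_weyl13_30 q0 wwi wiw wl). Qed.

(** As x_30 is upper bidiagonal, comparing coordinates at the last index where [v] is nonzero gives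
    the eigenvalue. Nothing is assumed about the [lam i] being distinct. *)
Lemma mod30_eigen (v : 'cV_d.+1) mu : v != 0 -> x *m v = mu *: v ->
  exists2 k : 'I_d.+1, mu = (lam k)^-1 & forall j : 'I_d.+1, (k < j)%N -> v j 0 = 0.
Proof.
move=> /eqP v0 e.
have [k0 k0P] : exists k : 'I_d.+1, v k 0 != 0.
  apply/existsP; apply: contra_notT v0; rewrite negb_exists => /forallP v0.
  by apply/matrixP => i j; rewrite ord1 mxE; apply/eqP; have := v0 i; rewrite negbK.
case: (@arg_maxnP _ k0 (fun k => v k 0 != 0) (fun k : 'I_d.+1 => k : nat) k0P) => k kv kmax.
have vk (j : 'I_d.+1) : (k < j)%N -> v j 0 = 0.
  by move=> kj; apply/eqP; apply: contraTT kj => vj; rewrite -leqNgt; exact: kmax.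
exists k => //; move/matrixP/(_ k 0): e; rewrite !mxE (bigD1 k) //= big1 => [|j jk].
  rewrite addr0 !mxE eqxx (_ : (k == k.+1 :> nat) = false); last by elim: (nat_of_ord k).
  by rewrite addr0 => /(mulIf kv) ->.
rewrite !mxE eq_sym (negPf jk) add0r; case: eqP => [e|_]; last by rewrite mul0r.
by rewrite vk ?mulr0 // e.
Qed.

Lemma corner_exists : exists k20 ki : M,
 [/\ k20 *m ki = 1%:M, ki *m k20 = 1%:M, qweyl q k20 y, qweyl q mod12 k20 &
   qweyl q ki mod23 /\ qweyl q x ki].
Proof.
have [g gE] := corner_poly; set G := horner_mx y g in gE.
have Gy : G *m y = y *m G by exact: comm_horner_mx (comm_mx_refl y).
pose N := L0 *m G; pose k20 := yi + N.
have yN : y *m N = q ^+ 2 *: (N *m y).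
  rewrite /N -[L0 *m G *m y]mulmxA Gy !mulmxA L0y -scalemxAl scalerA mulfV ?expf_neq0 //.
  by rewrite scale1r.
have xE : x = yi + N *m (1%:M + kap *: y) by rewrite /N gE /L0 addrC subrK.
have wE : w = yi + rho by rewrite /rho addrC subrK.
have x12E : mod12 = w + kap *: (y *m w - 1%:M) by exact: (eval_x12E kap r wiw).
have x23E : mod23 = w + kap^-1 *: (x *m w - 1%:M) by exact: (eval_x23E kap0 l wiw).
have w20 : qweyl q k20 y := corner_weyl20_01 q0 yyi yiy yN.
suff kU : k20 \in unitmx.
  have kki := mulmxV kU; have kik := mulVmx kU.
  exists k20, (invmx k20); split=> //.
    by rewrite x12E; apply: (corner_weyl12_20 q0 yyi yiy wyw wwx yN wE xE).
  split; last exact: (corner_weyl30_02 q0 yyi yiy yN xE kki kik).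
  by rewrite x23E; apply: (corner_weyl02_23 q0 kap0 yyi yiy wyw wwx yN wE xE kki kik).
(* A kernel vector of [k20] is an eigenvector of x_30 for -kap/q^2. The conditions [ab2] exclude all
   indices except k = 0, so the vector is a multiple of [u0]. *)
apply: col0_unitmx => v kv; apply/eqP; apply: contraT => v0.
have xv : x *m v = (- (kap / q ^+ 2)) *: v.
  have := congr1 (fun B => B *m v) (corner_x30E q0 yyi yN xE).
  rewrite -mulmxA kv mulmx0 mulmxDl -scalemxAl mul1mx => /eqP.
  by rewrite addr_eq0 scaleNr => /eqP.
have [k kE vk] := mod30_eigen v0 xv.
have k0 : k = 0 :> nat.
  case: (posnP k) => // kpos; have := @ab2 k; rewrite kpos -ltnS ltn_ord => /(_ isT).
  case/negP; apply/eqP; have lk := lam_neq0 k.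
  have -> : 1 + c * (lam k / q) = lam k * ((lam k)^-1 - - (kap / q ^+ 2)).
    by rewrite /kap; field; rewrite q0 lk.
  by rewrite -kE subrr mulr0.
have vE : v = v 0 0 *: u0.
  apply/matrixP => i j; rewrite ord1 !mxE eqxx andbT.
  case: eqP => [->|/eqP i0]; first by rewrite mulr1.
  by rewrite mulr0 vk // k0 lt0n.
have ku0 : k20 *m u0 = 0.
  have v00 : v 0 0 != 0 by apply: contra v0 => /eqP e; rewrite vE e scale0r.
  by apply: (can_inj (scalerK v00)); rewrite scalemxAr -vE kv scaler0.
have supp : forall n (z : 'cV[K]_d.+1), (forall j : 'I_d.+1, (n <= j)%N -> z j 0 = 0) ->
    forall j : 'I_d.+1, (n < j)%N -> (y *m z) j 0 = 0.
  move=> n z zn j nj; rewrite mxE big1 // => m _; have [nm|mn] := leqP n m; first by rewrite zn ?mulr0.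
  rewrite !mxE (_ : (j == m) = false); last by apply/eqP => e; move: mn; rewrite -e ltnNge (ltnW nj).
  rewrite (_ : (j == m.+1 :> nat) = false) ?addr0 ?mul0r //.
  by apply/eqP => e; move: mn; rewrite ltnNge -ltnS -e nj.
have sv_supp : forall n, (n <= d)%N -> (forall j : 'I_d.+1, (n < j)%N -> (sv n) j 0 = 0) /\
    (forall j : 'I_d.+1, j = n :> nat -> (sv n) j 0 != 0).
  elim=> [_|n IH nd].
    split=> j; first by move=> j0; rewrite mxE eqxx andbT (_ : (j == 0) = false) //; apply/eqP => e; move: j0; rewrite e.
    by move=> j0; rewrite mxE eqxx andbT (_ : j = 0) ?oner_neq0 //; apply: val_inj.
  have [h1 h2] := IH (ltnW nd); split=> j nj; rewrite split_vecS !mxE.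
    by have := supp n.+1 _ h1 j nj; rewrite mxE => ->; rewrite h1 ?mulr0 ?subr0 // ltnW.
  rewrite (h1 j) ?nj // mulr0 subr0.
  pose i : 'I_d.+1 := Ordinal (ltnW nd : (n < d.+1)%N).
  rewrite (bigD1 i) //= big1 ?addr0 => [|m mi].
    rewrite mulf_neq0 ?h2 // !mxE nj eqxx (_ : (j == i) = false) ?add0r ?invr_eq0 ?abS //.
    by apply/eqP => e; move: nj; rewrite e /=; elim: (n) => // n' IH' [].
  have [nm|mn] := ltnP n m; first by rewrite h1 ?mulr0.
  rewrite !mxE (_ : (j == m) = false); last by apply/eqP => e; move: mn; rewrite -e nj ltnn.
  rewrite (_ : (j == m.+1 :> nat) = false) ?addr0 ?mul0r // nj eqSS eq_sym.
  exact/negbTE.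
have kw : k20 *m y = q ^- 2 *: (y *m k20) + (1 - q ^- 2) *: 1%:M := w20.
(* Starting from [k20 *m u0 = 0], the Weyl relation with [y] keeps [k20 *m sv n] inside the first n
   coordinates, one fewer than [sv n] occupies. *)
have ksv : forall n, (n <= d)%N -> forall j : 'I_d.+1, (n <= j)%N -> (k20 *m sv n) j 0 = 0.
  elim=> [_ j _|n IH nd j nj]; first by rewrite (ku0 : k20 *m sv 0 = 0) mxE.
  have ksn : k20 *m sv n.+1 = q ^- 2 *: (y *m (k20 *m sv n)) + (1 - q ^- 2) *: sv n - (lam n.+1)^-1 *: (k20 *m sv n).
    by rewrite split_vecS mulmxBr mulmxA kw mulmxDl -!scalemxAl mul1mx -mulmxA -scalemxAr.
  have h (A1 A2 A3 : 'cV[K]_d.+1) k1 k2 k3 : A1 j 0 = 0 -> A2 j 0 = 0 -> A3 j 0 = 0 ->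
      (k1 *: A1 + k2 *: A2 - k3 *: A3) j 0 = 0.
    by move=> e1 e2 e3; rewrite !mxE e1 e2 e3 !mulr0 oppr0 !addr0.
  rewrite ksn; apply: h; first exact: supp (IH (ltnW nd)) _ nj.
    exact: (sv_supp n (ltnW nd)).1.
  exact: IH (ltnW nd) _ (ltnW nj).
(* On the other hand [N] kills [sv d], so [k20] acts there as [yi] and preserves the nonzero last
   coordinate: a contradiction. *)
have kd : k20 *m sv d = (q ^+ d)^-1 *: sv d.
  have -> : k20 *m sv d = yi *m sv d + L0 *m G *m sv d by rewrite mulmxDl.
  have GP : G *m horner_mx y (split_poly d) = horner_mx y (split_poly d) *m G by exact: comm_horner_mx2.
  have -> : L0 *m G *m sv d = 0.
    by rewrite split_vecE mulmxA -(mulmxA L0) GP mulmxA L0_split_poly !mul0mx.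
  by rewrite addr0 -[sv d in LHS](scalerK qd0) -mod01_split_last -scalemxAr mulmxA yiy mul1mx.
have := ksv d (leqnn d) ord_max (leqnn d); rewrite kd mxE => /eqP; rewrite mulf_eq0 invr_eq0 (negPf qd0) /=.
by rewrite (negPf ((sv_supp d (leqnn d)).2 ord_max erefl)).
Qed.

Theorem tetrahedron_model : q ^+ 2 != 1 ->
  exists X : tet_gen -> M,
    [/\ forall s t, qtet_rel q s t -> expr_eval X s = expr_eval X t,
        a *: X (tet_pair tet01) + b *: X (tet_pair tet12) =
          \matrix_(i, j) (if i == j then a / lam j + b * lam j else if i == j.+1 :> nat then 1 else 0)
      & as_ *: X (tet_pair tet23) + bs *: X (tet_pair tet30) =
          \matrix_(i, j) (if i == j then as_ * lam j + bs / lam j else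
             if j == i.+1 :> nat then phi j else 0)].
Proof.
move=> q2; have [k20 [ki [kki kik w201 w120 [w023 w302]]]] := corner_exists.
exists (tet_map mod01 mod12 mod23 mod30 ki k20 w wi); split; last 2 first.
- exact: mod01_12.
- exact: mod23_30.
apply: (tet_map_rel q0 q2 kik kki wwi wiw (eval_weyl01_12 kap q0 wwi wiw wr)
  (eval_weyl12_23 q0 kap0 wiw wr wl lr) (eval_weyl23_30 q0 kap0 wwi wiw wl) wxy wyw w120
  (eval_weyl23_31 q0 kap0 wwi wiw wl) w302 w023 wwx w201 (eval_weyl31_12 kap q0 wwi wiw wr)
  (eval_x12E kap r wiw) (eval_x23E kap0 l wiw) (eval_x01E kap0 r wwi) (eval_x30E kap0 l wwi)).
Qed.

End Model.

(** A subspace inside [P] is enlarged by a vector of [P] outside it until there is none; the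
    codimension bounds the number of rounds. *)
Lemma vspace_of_closed (K : fieldType) (vT : vectType K) (P : vT -> Prop) :
  P 0 -> (forall u v, P u -> P v -> P (u + v)) -> (forall k u, P u -> P (k *: u)) ->
  exists U : {vspace vT}, forall v, v \in U <-> P v.
Proof.
move=> P0 PD PZ.
suff h n (U : {vspace vT}) : (forall v, v \in U -> P v) -> (\dim {:vT} - \dim U <= n)%N ->
    exists U : {vspace vT}, forall v, v \in U <-> P v.
  by apply: (h _ 0%VS) => [v|]; [rewrite memv0 => /eqP->|].
elim: n U => [|n IH] U UP dimU; have [h|/existsNP [v /not_implyP [Pv /negP vU]]] :=
    pselect (forall v, P v -> v \in U); try by exists U => v; split; [exact: UP|exact: h].
- move: dimU; rewrite leqn0 subn_eq0 => fU.
  have /eqP UE : U == fullv by rewrite eqEdim subvf.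
  by move: vU; rewrite UE memvf.
have dimS : (\dim U < \dim (U + <[v]>))%N.
  rewrite ltn_neqAle dimvS ?addvSl // andbT; apply: contra vU => /eqP e.
  have /eqP -> : U == (U + <[v]>)%VS by rewrite eqEdim addvSl -e leqnn.
  by apply: (subvP (addvSr U <[v]>)); exact: memv_line.
  apply: (IH (U + <[v]>)%VS) => [w /memv_addP [u uU [w' /vlineP [k ->] ->]]|].
  by apply: PD; [exact: UP|exact: PZ].
have := dimvS (subvf (U + <[v]>)%VS); move: dimU dimS; lia.
Qed.

(** * Orthogonality and double centralizers *)

Section HermitianForm.
Variables (C : numClosedFieldType) (vT : vectType C) (ip : vT -> vT -> C).
Hypotheses (ipD : forall u v w, ip (u + v) w = ip u w + ip v w)
  (ipZ : forall k u w, ip (k *: u) w = k * ip u w)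
  (ipC : forall u v, ip u v = (ip v u)^*)
  (ip0 : forall u, ip u u = 0 -> u = 0).

Lemma ip_sumr (I : Type) (r : seq I) (F : I -> vT) (k : I -> C) u :
  (forall i, ip u (F i) = 0) -> ip u (\sum_(i <- r) k i *: F i) = 0.
Proof.
move=> uF; rewrite ipC; have h : ip (\sum_(i <- r) k i *: F i) u = 0.
  elim/big_rec: _ => [|i w _ e]; first by rewrite -(scale0r (0 : vT)) ipZ mul0r.
  by rewrite ipD ipZ ipC uF conjC0 mulr0 e addr0.
by rewrite h conjC0.
Qed.

(** Pairing with a basis of [U] maps [U] to a coordinate space of the same dimension. Definiteness
    makes the map injective on [U], hence onto, and the required vector is a preimage of the
    pairings of [v]. *)
Lemma orth_proj (U : {vspace vT}) (v : vT) :
  exists2 a, a \in U & forall w, w \in U -> ip (v - a) w = 0.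
Proof.
pose b := vbasis U; pose h0 u : 'rV[C]_(\dim U) := \row_i ip u b`_i.
have h0l : linear h0.
  by move=> k u w; apply/matrixP => i j; rewrite !mxE ipD ipZ.
pose hM := GRing.isLinear.Build _ _ _ _ h0 h0l.
pose h1 : {linear vT -> 'rV[C]_(\dim U)} := HB.pack h0 hM.
pose h := linfun h1.
have hP u : h u = 0 -> forall w, w \in U -> ip u w = 0.
  move=> hu w wU; rewrite (coord_vbasis wU); apply: ip_sumr => i.
  by move: hu; rewrite lfunE => /matrixP/(_ 0 i); rewrite !mxE.
have Uh : (U :&: lker h)%VS = 0%VS.
  apply/eqP; rewrite -subv0; apply/subvP => u; rewrite memv_cap memv_ker memv0.
  by case/andP => uU /eqP hu; apply/eqP/ip0/hP.
have full : (h @: U)%VS = fullv.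
  apply/eqP; rewrite eqEdim subvf (limg_dim_eq Uh) dimvf /dim /=.
  by rewrite mul1n.
have /memv_imgP [a aU e] : h v \in (h @: U)%VS by rewrite full memvf.
by exists a => // w wU; apply: hP wU; rewrite linearB /= e subrr.
Qed.

End HermitianForm.

Section Adjoint.
Variable C : numClosedFieldType.

Definition adjm m n (B : 'M[C]_(m, n)) : 'M[C]_(n, m) := map_mx Num.conj B^T.

Definition dotc n (u v : 'cV[C]_n) : C := \sum_y u y 0 * (v y 0)^*.

Lemma adjmK m n (B : 'M[C]_(m, n)) : adjm (adjm B) = B.
Proof. by apply/matrixP => i j; rewrite !mxE conjCK. Qed.

Lemma adjmM m n p (A : 'M[C]_(m, n)) (B : 'M[C]_(n, p)) : adjm (A *m B) = adjm B *m adjm A.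
Proof. by rewrite /adjm trmx_mul map_mxM. Qed.

Lemma dotcE n (u v : 'cV[C]_n) : adjm v *m u = (dotc u v)%:M.
Proof.
apply/matrixP => i j; rewrite !ord1 !mxE eqxx mulr1n.
by apply: eq_bigr => y _; rewrite !mxE mulrC.
Qed.

Lemma dotc_adj m n (B : 'M[C]_(m, n)) u v : dotc (B *m u) v = dotc u (adjm B *m v).
Proof.
have /matrixP/(_ 0 0) : (dotc (B *m u) v)%:M = (dotc u (adjm B *m v))%:M :> 'M_1.
  by rewrite -!dotcE adjmM adjmK mulmxA.
by rewrite !mxE eqxx !mulr1n.
Qed.

Lemma dotcD n (u v w : 'cV[C]_n) : dotc (u + v) w = dotc u w + dotc v w.
Proof. by rewrite -big_split; apply: eq_bigr => y _; rewrite mxE mulrDl. Qed.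

Lemma dotcZ n k (u w : 'cV[C]_n) : dotc (k *: u) w = k * dotc u w.
Proof. by rewrite mulr_sumr; apply: eq_bigr => y _; rewrite mxE mulrA. Qed.

Lemma dotcC n (u v : 'cV[C]_n) : dotc u v = (dotc v u)^*.
Proof. by rewrite rmorph_sum; apply: eq_bigr => y _; rewrite rmorphM /= conjCK mulrC. Qed.

Lemma dotc0 n (u : 'cV[C]_n) : dotc u u = 0 -> u = 0.
Proof.
move=> /eqP; rewrite psumr_eq0 => [/allP h|y _]; last exact: mul_conjC_ge0.
apply/matrixP => i j; rewrite ord1 mxE; have := h i (mem_index_enum i).
by rewrite mul_conjC_eq0 => /eqP.
Qed.

Lemma dotc0l n (w : 'cV[C]_n) : dotc 0 w = 0.
Proof. by rewrite -(scale0r (0 : 'cV[C]_n)) dotcZ mul0r. Qed.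

Definition dotm m n (A B : 'M[C]_(m, n)) : C := \tr (A *m adjm B).

Lemma dotmE m n (A B : 'M[C]_(m, n)) : dotm A B = \sum_i \sum_j A i j * (B i j)^*.
Proof. by apply: eq_bigr => i _; rewrite mxE; apply: eq_bigr => j _; rewrite !mxE. Qed.

Lemma dotmD m n (A B D : 'M[C]_(m, n)) : dotm (A + B) D = dotm A D + dotm B D.
Proof. by rewrite /dotm mulmxDl mxtraceD. Qed.

Lemma dotmZ m n k (A B : 'M[C]_(m, n)) : dotm (k *: A) B = k * dotm A B.
Proof. by rewrite /dotm -scalemxAl mxtraceZ. Qed.

Lemma dotmC m n (A B : 'M[C]_(m, n)) : dotm A B = (dotm B A)^*.
Proof.
rewrite !dotmE rmorph_sum; apply: eq_bigr => i _; rewrite rmorph_sum; apply: eq_bigr => j _.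
by rewrite rmorphM /= conjCK mulrC.
Qed.

Lemma dotm0 m n (A : 'M[C]_(m, n)) : dotm A A = 0 -> A = 0.
Proof.
have pos i j : 0 <= A i j * (A i j)^* by exact: mul_conjC_ge0.
move/eqP; rewrite dotmE psumr_eq0 => [/allP h|i _]; last by apply: sumr_ge0.
apply/matrixP => i j; have := h i (mem_index_enum i); rewrite psumr_eq0 // => /allP/(_ j (mem_index_enum j)).
by rewrite mul_conjC_eq0 mxE => /eqP.
Qed.

Lemma dotm_adj m n p (S : 'M[C]_(p, m)) (A : 'M[C]_(m, n)) B : dotm (S *m A) B = dotm A (adjm S *m B).
Proof. by rewrite /dotm adjmM adjmK -mulmxA mxtrace_mulC mulmxA. Qed.

End Adjoint.

Lemma mx_col_ext (R : pzRingType) m n (A B : 'M[R]_(m, n)) :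
  (forall v : 'cV[R]_n, A *m v = B *m v) -> A = B.
Proof. by move=> h; apply/matrixP => i j; have /matrixP/(_ i 0) := h (delta_mx j 0); rewrite -!colE !mxE. Qed.

Section StarAlgebra.
Variables (C : numClosedFieldType) (n : nat) (T : 'M[C]_n -> Prop).
Hypotheses (T1 : T 1%:M) (TD : forall A B, T A -> T B -> T (A + B))
  (TZ : forall k A, T A -> T (k *: A)) (TM : forall A B, T A -> T B -> T (A *m B))
  (Tadj : forall A, T A -> T (adjm A)).

(* The orthogonal projection of the full matrix algebra onto [T] is left [T]-linear,
   so it is built from matrices commuting with [T]; hence it commutes with [B] and
   fixes [B 1]. *)
Theorem double_centralizer B :
  (forall S, (forall A, T A -> S *m A = A *m S) -> B *m S = S *m B) -> T B.
Proof.
move=> Bcc.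
have T0 : T 0 by rewrite -(scale0r 1%:M); apply: TZ.
have [U UP] := vspace_of_closed T0 TD TZ.
have proj X := orth_proj (@dotmD C n n) (@dotmZ C n n) (@dotmC C n n) (@dotm0 C n n) U X.
pose p X := s2val (cid2 (proj X)).
have pU X : p X \in U by rewrite /p; case: cid2.
have pO X Y : Y \in U -> dotm (X - p X) Y = 0 by rewrite /p; case: cid2 => /= ? _; apply.
have p_uniq X Y : Y \in U -> (forall Z, Z \in U -> dotm (X - Y) Z = 0) -> p X = Y.
  move=> YU h; apply/eqP; rewrite -subr_eq0; apply/eqP/dotm0.
  have pYU : p X - Y \in U by rewrite memvB.
  rewrite {1}(_ : p X - Y = (X - Y) + (-1) *: (X - p X)); last by rewrite scaleN1r opprB [RHS]addrC subrKA.
  by rewrite dotmD dotmZ h // pO // mulr0 addr0.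
have pD X Y : p (X + Y) = p X + p Y.
  apply: p_uniq => [|Z ZU]; first by rewrite memvD.
  by rewrite opprD addrACA dotmD !pO ?addr0.
have pZ k X : p (k *: X) = k *: p X.
  apply: p_uniq => [|Z ZU]; first by rewrite memvZ.
  by rewrite -scalerBr dotmZ pO ?mulr0.
have pM S X : T S -> p (S *m X) = S *m p X.
  move=> TS; apply: p_uniq => [|Z ZU]; first by apply/UP/TM => //; apply/UP.
  by rewrite -mulmxBr dotm_adj pO //; apply/UP/TM; [exact: Tadj|exact/UP].
have p1 : p 1%:M = 1%:M.
  by apply: p_uniq => [|Z ZU]; [exact/UP|rewrite subrr /dotm mul0mx mxtrace0].
have psum (I : finType) (F : I -> 'M[C]_n) : p (\sum_i F i) = \sum_i p (F i).
  elim/big_rec2: _ => [|i Y X _ e]; last by rewrite pD e.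
  by rewrite -(scale0r (0 : 'M_n)) pZ !scale0r.
have pB X : p (B *m X) = B *m p X.
  have XE : X = \sum_k (col k X *m delta_mx 0 k).
    apply/matrixP => i j; rewrite summxE (bigD1 j) //= big1 ?addr0 => [|k kj].
      by rewrite mxE big_ord1 !mxE !eqxx mulr1.
    by rewrite mxE big_ord1 !mxE [j == k]eq_sym (negPf kj) andbF mulr0.
  rewrite XE mulmx_sumr !psum mulmx_sumr; apply: eq_bigr => k _.
  move: (col k X) => v; apply/matrixP => a j.
  (* For fixed k and j, sending [w] to column j of [p (w *m delta_mx 0 k)] is linear in [w] and
     commutes with [T], since [p] is left [T]-linear. Hence [B] commutes with its matrix. *)
  pose S : 'M[C]_n := \matrix_(i, l) p (delta_mx l k) i j.
  have SE (w : 'cV_n) : S *m w = col j (p (w *m delta_mx 0 k)).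
    have -> : w *m delta_mx 0 k = \sum_l w l 0 *: delta_mx l k.
      apply/matrixP => i m; rewrite summxE mxE big_ord1 (bigD1 i) //= big1 ?addr0 => [|l li].
        by rewrite !mxE !eqxx.
      by rewrite !mxE [i == l]eq_sym (negPf li) mulr0.
    rewrite psum; apply/matrixP => i m; rewrite !mxE summxE; apply: eq_bigr => l _.
    by rewrite pZ !mxE ord1 mulrC.
  have ST A : T A -> S *m A = A *m S.
    move=> TA; apply: mx_col_ext => u.
    by rewrite -!mulmxA !SE -mulmxA pM // !colE mulmxA.
  suff /matrixP/(_ a 0) : col j (p (B *m (v *m delta_mx 0 k))) = col j (B *m p (v *m delta_mx 0 k)).
    by have colE' (Z : 'M[C]_n) : col j Z a 0 = Z a j; [rewrite mxE | rewrite !colE'].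
  have := congr1 (fun X => X *m v) (Bcc _ ST).
  by rewrite -!mulmxA !SE !colE !mulmxA => ->.
by rewrite -(mulmx1 B); apply/UP; rewrite -[in B *m _]p1 -pB pU.
Qed.

End StarAlgebra.

(** * Orthogonal decomposition into irreducible subspaces and Schur's lemma *)

Section Semisimple.
Variables (C : numClosedFieldType) (n : nat) (T : 'M[C]_n -> Prop).
Local Notation V := 'cV[C]_n.
Implicit Types U W : {vspace V}.

Definition stable_space U : Prop := forall B, T B -> forall w, w \in U -> B *m w \in U.

Definition irreducible_space W : Prop :=
  [/\ stable_space W, W != 0%VS & forall U, stable_space U -> (U <= W)%VS -> U = 0%VS \/ U = W].

Definition orthv U W : Prop := forall u w, u \in U -> w \in W -> dotc u w = 0.

Hypothesis Tadj : forall A, T A -> T (adjm A).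

Lemma orthv_sym U W : orthv U W -> orthv W U.
Proof. by move=> h w u wW uU; rewrite dotcC h ?conjC0. Qed.

Lemma exists_irreducible U : stable_space U -> U != 0%VS -> exists2 W, irreducible_space W & (W <= U)%VS.
Proof.
have [N] := ubnP (\dim U); elim: N U => // m IH U Um Ust U0.
have [h|/existsNP [W /not_implyP [Wst /not_implyP [WU /not_orP [W0 WnU]]]]] :=
  pselect (forall W, stable_space W -> (W <= U)%VS -> W = 0%VS \/ W = U).
  by exists U.
have [||W' W'i W'W] := IH W _ Wst; [|exact/eqP|by exists W' => //; apply: subv_trans WU].
apply: leq_trans (_ : \dim W < \dim U)%N _; last by rewrite -ltnS.
rewrite ltn_neqAle dimvS // andbT; apply: contra_notN WnU => /eqP e.
by apply/eqP; rewrite eqEdim WU e leqnn.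
Qed.

(** Closure of [T] under adjoints makes the orthogonal complement of a stable subspace stable. *)
Lemma orth_complement U W : stable_space U -> stable_space W -> (W <= U)%VS ->
  exists U', [/\ stable_space U', (U' <= U)%VS, orthv U' W & (U = W + U')%VS].
Proof.
move=> Ust Wst WU.
have [U' U'P] := @vspace_of_closed C V (fun v => v \in U /\ forall w, w \in W -> dotc v w = 0)
  (conj (mem0v _) (fun w _ => dotc0l w))
  (fun u v '(conj uU uW) '(conj vU vW) => conj (memvD uU vU) (fun w wW => etrans (dotcD u v w) (etrans (congr2 +%R (uW w wW) (vW w wW)) (addr0 0))))
  (fun k u '(conj uU uW) => conj (memvZ k uU) (fun w wW => etrans (dotcZ k u w) (etrans (congr1 ( *%R k) (uW w wW)) (mulr0 k)))).
have U'U : (U' <= U)%VS by apply/subvP => v /U'P [].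
exists U'; split=> //.
- move=> B TB v /U'P [vU vW]; apply/U'P; split; first exact: Ust.
  by move=> w wW; rewrite dotc_adj vW //; apply: Wst => //; apply: Tadj.
- by move=> v w /U'P [_ vW]; apply: vW.
apply/eqP; rewrite eqEsubv subv_add WU U'U !andbT; apply/subvP => v vU.
have [a aW va] := orth_proj (@dotcD C n) (@dotcZ C n) (@dotcC C n) (@dotc0 C n) W v.
rewrite -(subrK a v) addrC; apply: memv_add => //; apply/U'P; split=> //.
by rewrite memvB // (subvP WU).
Qed.

Lemma orth_decomposition U : stable_space U ->
  exists m (W : 'I_m -> {vspace V}),
    [/\ forall i, irreducible_space (W i), forall i j, i != j -> orthv (W i) (W j)
      & (U = \sum_i W i)%VS].
Proof.
have [N] := ubnP (\dim U); elim: N U => // m IH U Um Ust.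
have [->|U0] := eqVneq U 0%VS.
  by exists 0%N, (fun=> 0%VS); split; [case|case|rewrite big_ord0].
have [W Wi WU] := exists_irreducible Ust U0.
have [Wst W0 _] := Wi.
have [U' [U'st U'U U'W UE]] := orth_complement Ust Wst WU.
have capWU' : (W :&: U' = 0)%VS.
  apply/eqP; rewrite -subv0; apply/subvP => v; rewrite memv_cap memv0 => /andP [vW vU'].
  by apply/eqP/dotc0/U'W.
have [|k [W' [W'i W'o U'E]]] := IH U' _ U'st.
  apply: leq_trans (_ : \dim U' < \dim U)%N _; last by rewrite -ltnS.
  by rewrite UE dimv_disjoint_sum // -[X in (X < _)%N]add0n ltn_add2r lt0n dimv_eq0.
have W'U' i : (W' i <= U')%VS by rewrite U'E (sumv_sup i).
exists k.+1, (fun i => oapp W' W (unlift ord0 i)); split.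
- by move=> i; case: unliftP => [i'|] _ /=; [exact: W'i|exact: Wi].
- move=> i j; case: unliftP => [i'|] ->; case: unliftP => [j'|] -> //=; rewrite ?eqxx //.
  + by rewrite (inj_eq lift_inj); apply: W'o.
  + by move=> _ u w uW wW; apply: U'W => //; apply: (subvP (W'U' i')).
  by move=> _; apply: orthv_sym => u w uW wW; apply: U'W => //; apply: (subvP (W'U' j')).
rewrite UE U'E big_ord_recl unlift_none /=; congr (_ + _)%VS.
by apply: eq_bigr => i _; rewrite liftK.
Qed.

(** Schur's lemma: the kernel of [F] on [W] and the image of [W] are stable, so irreducibility
    leaves no proper choice for either. *)
Lemma intertwiner_image W W' (F : 'M[C]_n) :
  irreducible_space W -> irreducible_space W' ->
  (forall A, T A -> F *m A = A *m F) -> (forall w, w \in W -> F *m w \in W') ->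
  (exists2 w, w \in W & F *m w != 0) ->
  (forall w, w \in W -> F *m w = 0 -> w = 0) /\ (forall w', w' \in W' -> exists2 w, w \in W & F *m w = w').
Proof.
move=> [Wst W0 Wi] [W'st W'0 W'i] FT FW [w0 w0W Fw0].
pose f : 'End(V) := linfun (mulmx F).
have fE v : f v = F *m v by rewrite lfunE.
have kst : stable_space (W :&: lker f)%VS.
  move=> B TB w; rewrite !memv_cap !memv_ker !fE => /andP [wW /eqP Fw].
  by rewrite Wst //= mulmxA FT // -mulmxA Fw mulmx0.
have ist : stable_space (f @: W)%VS.
  move=> B TB _ /memv_imgP [w wW ->]; rewrite fE mulmxA -FT // -mulmxA -fE.
  by apply: memv_img; apply: Wst.
split=> [w wW Fw|w' w'W'].
  case: (Wi _ kst (capvSl _ _)) => e.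
    by apply/eqP; rewrite -memv0 -e memv_cap wW memv_ker fE Fw eqxx.
  by move: w0W Fw0; rewrite -{1}e memv_cap memv_ker fE => /andP [_ ->].
have iW' : (f @: W <= W')%VS by apply/subvP => _ /memv_imgP [w wW ->]; rewrite fE; apply: FW.
case: (W'i _ ist iW') => e.
  by case/negP: Fw0; rewrite -fE -memv0 -e memv_img.
by move: w'W'; rewrite -e => /memv_imgP [w wW ->]; exists w; rewrite ?fE.
Qed.

End Semisimple.

Lemma gram_unit (C : numClosedFieldType) n k (B : 'M[C]_(n, k)) :
  (forall v : 'cV[C]_k, B *m v = 0 -> v = 0) -> adjm B *m B \in unitmx.
Proof.
move=> Binj; rewrite unitmxE unitfE -det_tr; apply/det0P => -[v v0 e]; case/negP: v0.
rewrite -trmx_eq0; apply/eqP/Binj; apply: dotc0.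
have {}e : adjm B *m (B *m v^T) = 0.
  by rewrite mulmxA -[LHS]trmxK trmx_mul trmxK e trmx0.
by rewrite dotc_adj e dotcC dotc0l conjC0.
Qed.

Section Frame.
Variables (C : numClosedFieldType) (n m : nat) (d : 'I_m -> nat).
Variable B : forall k : 'I_m, 'M[C]_(n, (d k).+1).

(** The bases [B k] are orthogonal to each other but not orthonormal within, so the coordinate maps
    are the adjoints corrected by inverse Gram matrices. *)
Theorem orth_frame :
  (forall k (v : 'cV[C]_(d k).+1), B k *m v = 0 -> v = 0) ->
  (forall j k, j != k -> adjm (B j) *m B k = 0) ->
  (forall v : 'cV[C]_n, exists c : forall k, 'cV[C]_(d k).+1, v = \sum_k B k *m c k) ->
  exists P : forall k : 'I_m, 'M[C]_((d k).+1, n),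
    [/\ forall k, P k *m B k = 1%:M, forall j k, j != k -> P j *m B k = 0 & \sum_k B k *m P k = 1%:M].
Proof.
move=> Binj Bo Bspan.
have gu k := gram_unit (Binj k).
pose P k := invmx (adjm (B k) *m B k) *m adjm (B k).
have PB k : P k *m B k = 1%:M by rewrite -mulmxA mulVmx.
have PB0 j k : j != k -> P j *m B k = 0 by move=> jk; rewrite /P -[LHS]mulmxA (Bo _ _ jk) mulmx0.
exists P; split=> //; apply: mx_col_ext => v; have [c ->] := Bspan v.
rewrite mul1mx mulmx_suml; apply: eq_bigr => k _.
rewrite mulmx_sumr (bigD1 k) //= big1 ?addr0 => [|j jk].
  by rewrite -mulmxA (mulmxA (P k)) PB mul1mx.
by rewrite -mulmxA (mulmxA (P k)) PB0 ?mul0mx ?mulmx0 // eq_sym.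
Qed.

End Frame.

(** * Leonard systems *)

Section Leonard.
Variables (C : fieldType) (n d : nat).
Local Notation V := 'cV[C]_n.
Variables (W : {vspace V}) (A As : 'M[C]_n).

(* [e] and [f] are the primitive idempotents of [A] and [As] on [W], and [w i] spans the
   image of [f i]; the ordering of [e] fixes the split decomposition. *)
Record leonard_system (e f : nat -> 'M[C]_n) (mu nu : nat -> C) (w : nat -> V) : Prop := {
  ls_A : forall v, v \in W -> A *m v \in W;
  ls_As : forall v, v \in W -> As *m v \in W;
  ls_e : forall i v, (i <= d)%N -> v \in W -> e i *m v \in W;
  ls_f : forall i v, (i <= d)%N -> v \in W -> f i *m v \in W;
  ls_eA : forall i v, (i <= d)%N -> v \in W -> e i *m (A *m v) = mu i *: (e i *m v);
  ls_fAs : forall i v, (i <= d)%N -> v \in W -> f i *m (As *m v) = nu i *: (f i *m v);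
  ls_ee : forall i j, (i <= d)%N -> (j <= d)%N -> e i *m e j = if i == j then e i else 0;
  ls_ff : forall i j, (i <= d)%N -> (j <= d)%N -> f i *m f j = if i == j then f i else 0;
  ls_esum : forall v, v \in W -> v = \sum_(i < d.+1) e i *m v;
  ls_fsum : forall v, v \in W -> v = \sum_(i < d.+1) f i *m v;
  ls_eAse : forall i j v, v \in W -> (i <= d)%N -> (j <= d)%N -> (i.+1 < j)%N || (j.+1 < i)%N ->
     e i *m (As *m (e j *m v)) = 0;
  ls_fAf : forall i j v, v \in W -> (i <= d)%N -> (j <= d)%N -> (i.+1 < j)%N || (j.+1 < i)%N ->
     f i *m (A *m (f j *m v)) = 0;
  ls_mu : forall i j, (i <= d)%N -> (j <= d)%N -> mu i = mu j -> i = j;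
  ls_nu : forall i j, (i <= d)%N -> (j <= d)%N -> nu i = nu j -> i = j;
  ls_w0 : w 0 \in W;
  ls_fw0 : f 0 *m w 0 = w 0;
  ls_w : forall i, (i <= d)%N -> w i != 0;
  ls_wS : forall i, (i < d)%N -> f i.+1 *m (A *m w i) = w i.+1;
  ls_thin : forall i v, (i <= d)%N -> v \in W -> exists k, f i *m v = k *: w i;
  ls_ew : forall i, (i <= d)%N -> e i *m w 0 != 0;
  ls_irr : forall U : {vspace V}, (U <= W)%VS -> (forall v, v \in U -> A *m v \in U) ->
     (forall v, v \in U -> As *m v \in U) -> U = 0%VS \/ U = W }.

Variables (e f : nat -> 'M[C]_n) (mu nu : nat -> C) (w : nat -> V).
Hypothesis LS : leonard_system e f mu nu w.

(** The i-th vector spans the intersection of f_0 W + ... + f_i W with e_i W + ... + e_d W. *)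
Fixpoint split_basis (i : nat) : V :=
  if i is k.+1 then A *m split_basis k - mu k *: split_basis k else w 0.
Local Notation u := split_basis.

Lemma split_basisS i : A *m u i = mu i *: u i + u i.+1.
Proof. by rewrite /= addrC subrK. Qed.

Lemma split_basis_mem i : u i \in W.
Proof.
elim: i => [|i IH] /=; first exact: ls_w0 LS.
by rewrite memvB ?memvZ // (ls_A LS).
Qed.

Lemma split_basis_e k i : (k <= d)%N -> e k *m u i = (\prod_(m < i) (mu k - mu m)) *: (e k *m w 0).
Proof.
move=> kd; elim: i => [|i IH]; first by rewrite big_ord0 scale1r.
rewrite [u _]/= mulmxBr (ls_eA LS) ?split_basis_mem // -scalemxAr -scalerBl IH scalerA big_ord_recr /=.
by rewrite mulrC.
Qed.

Lemma split_basis_e0 k i : (k <= d)%N -> (k < i)%N -> e k *m u i = 0.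
Proof.
move=> kd ki; rewrite split_basis_e // (bigD1 (Ordinal ki)) //= subrr mul0r scale0r //.
Qed.

Lemma split_basis_ediag k : (k <= d)%N -> e k *m u k != 0.
Proof.
move=> kd; rewrite split_basis_e // scaler_eq0 negb_or (ls_ew LS) // andbT.
apply/prodf_neq0 => m _; rewrite subr_eq0; apply/eqP => /(ls_mu LS kd) h.
by have := ltn_ord m; rewrite -h ?ltnn // ltnW // (leq_trans (ltn_ord m)).
Qed.

Lemma split_basis_last : u d.+1 = 0.
Proof.
rewrite (ls_esum LS (split_basis_mem _)) big1 // => k _.
by rewrite split_basis_e0 // -ltnS.
Qed.

Lemma split_basis_gt j : (d < j)%N -> u j = 0.
Proof.
elim: j => // j IH; rewrite ltnS leq_eqVlt => /predU1P [<-|dj]; first exact: split_basis_last.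
by rewrite /= IH // mulmx0 scaler0 subr0.
Qed.

Lemma split_basis_f0 j i : (j <= d)%N -> (i < j)%N -> f j *m u i = 0.
Proof.
elim: i j => [|i IH] j jd ij.
  by rewrite /= -(ls_fw0 LS) mulmxA (ls_ff LS) // gtn_eqF // mul0mx.
rewrite [u _]/= mulmxBr -scalemxAr IH ?scaler0 ?subr0 //; last exact: ltnW.
have -> : u i = \sum_(k < d.+1) f k *m u i by rewrite -(ls_fsum LS) ?split_basis_mem.
rewrite !mulmx_sumr big1 // => k _; have [ik|ki] := ltnP i k.
  by rewrite IH ?mulmx0 // -ltnS.
by rewrite (ls_fAf LS) ?split_basis_mem -1?ltnS //; apply/orP; right; apply: leq_ltn_trans ij.
Qed.

Lemma split_basis_fdiag i : (i <= d)%N -> f i *m u i = w i.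
Proof.
elim: i => [|i IH] id; first by rewrite (ls_fw0 LS).
have id' := ltnW id.
rewrite [u _]/= mulmxBr -scalemxAr split_basis_f0 // scaler0 subr0.
have -> : u i = \sum_(k < d.+1) f k *m u i by rewrite -(ls_fsum LS) ?split_basis_mem.
have i1 : (i < d.+1)%N by [].
rewrite !mulmx_sumr (bigD1 (Ordinal i1)) //= IH // (ls_wS LS) // big1 ?addr0 // => k ki.
have [ik|] := ltnP i k; first by rewrite split_basis_f0 ?mulmx0 // -ltnS.
rewrite leq_eqVlt => /predU1P [ke|ik]; first by case/eqP: ki; apply: val_inj.
by rewrite (ls_fAf LS) ?split_basis_mem -1?ltnS //; apply/orP; right.
Qed.

(** Peels off the highest f-component: by thinness it is a multiple of [w m], which is the
    f-component of [u m]. *)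
Lemma split_expand m v : (m <= d.+1)%N -> v \in W -> (forall j, (j <= d)%N -> (m <= j)%N -> f j *m v = 0) ->
  exists c : nat -> C, v = \sum_(i < m) c i *: u i.
Proof.
elim: m v => [|m IH] v md vW vf.
  exists (fun=> 0); rewrite big_ord0 (ls_fsum LS vW) big1 // => i _.
  by rewrite vf // -ltnS.
have [k kE] := ls_thin LS md vW.
have yW : v - k *: u m \in W by rewrite memvB ?memvZ ?split_basis_mem.
have [|c cE] := IH _ (ltnW md) yW.
  move=> j jd; rewrite leq_eqVlt => /predU1P [<-|mj].
    by rewrite mulmxBr -scalemxAr kE split_basis_fdiag // subrr.
  by rewrite mulmxBr vf // -scalemxAr split_basis_f0 // scaler0 subr0.
exists (fun i => if i == m then k else c i).
rewrite big_ord_recr /= eqxx; apply/eqP; rewrite -subr_eq; apply/eqP; rewrite cE.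
by apply: eq_bigr => i _; rewrite ltn_eqF.
Qed.

Lemma split_coef0 m p (c : nat -> C) : (p <= m)%N -> (m <= d.+1)%N ->
  (forall k, (k < p)%N -> e k *m (\sum_(i < m) c i *: u i) = 0) -> forall k, (k < p)%N -> c k = 0.
Proof.
move=> pm md h k; elim/ltn_ind: k => k IH kp.
have kd : (k <= d)%N by rewrite -ltnS (leq_trans _ md) // (leq_trans kp).
have km : (k < m)%N by apply: leq_trans pm.
have := h k kp; rewrite mulmx_sumr (bigD1 (Ordinal km)) //= big1 => [|i ik].
  rewrite addr0 -scalemxAr => /eqP; rewrite scaler_eq0 (negPf (split_basis_ediag kd)) orbF.
  by move/eqP.
have [ki|] := ltnP k i; first by rewrite -scalemxAr split_basis_e0 // scaler0.
rewrite leq_eqVlt => /predU1P [ke|ki]; first by case/eqP: ik; apply: val_inj.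
by rewrite IH ?scale0r ?mulmx0 // (ltn_trans ki).
Qed.

(** The first m components for [f] and the last d + 1 - m for [e] have only 0 in common. The
    orthogonality in [split_orth] rests on this. *)
Lemma split_trivial m v : (m <= d.+1)%N -> v \in W ->
  (forall j, (j <= d)%N -> (m <= j)%N -> f j *m v = 0) ->
  (forall k, (k <= d)%N -> (k < m)%N -> e k *m v = 0) -> v = 0.
Proof.
move=> md vW vf ve; have [c cE] := split_expand md vW vf.
rewrite cE big1 // => i _; rewrite (@split_coef0 m m c) ?scale0r // => k km.
by rewrite -cE ve // -ltnS (leq_trans km).
Qed.

Lemma split_basis_span v : v \in W -> exists c : nat -> C, v = \sum_(i < d.+1) c i *: u i.
Proof. by move=> vW; apply: split_expand => // j jd; rewrite ltnNge jd. Qed.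

Lemma split_basis_free (c : nat -> C) : \sum_(i < d.+1) c i *: u i = 0 -> forall i, (i <= d)%N -> c i = 0.
Proof.
by move=> h i id; apply: (@split_coef0 d.+1 d.+1 c) => // k _; rewrite h mulmx0.
Qed.

(** The vector [y] has f-components only below i and e-components only from i - 1 on, which leaves a
    multiple of [u i.-1]. The case i = 0 is singled out because [0.-1] is 0. *)
Lemma split_basis_As i : (i <= d)%N -> exists phi, As *m u i = nu i *: u i + phi *: u i.-1 /\ (i = 0%N -> phi = 0).
Proof.
move=> id; pose y := As *m u i - nu i *: u i.
have uW := split_basis_mem i.
have yW : y \in W by rewrite memvB ?memvZ // (ls_As LS).
have yf j : (j <= d)%N -> (i <= j)%N -> f j *m y = 0.
  move=> jd; rewrite mulmxBr (ls_fAs LS) // -scalemxAr -scalerBl leq_eqVlt.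
  by case/predU1P => [<-|ij]; rewrite ?subrr ?scale0r // split_basis_f0 ?scaler0.
have [c cE] := split_expand (leqW id) yW yf.
have c0 k : (k < i.-1)%N -> c k = 0.
  move=> ki; apply: (@split_coef0 i i.-1 c) ki; rewrite ?leq_pred ?leqW // => l li.
  have ld : (l <= d)%N by apply: leq_trans id; apply: leq_trans (leq_pred i); apply: ltnW.
  have lt : (l.+1 < i)%N by move: li; case: (i).
  rewrite -cE /y mulmxBr -scalemxAr split_basis_e0 ?scaler0 ?subr0 //; last exact: ltnW.
  have -> : u i = \sum_(k < d.+1) e k *m u i by rewrite -(ls_esum LS).
  rewrite !mulmx_sumr big1 // => m _; have [mi|im] := ltnP m i.
    by rewrite split_basis_e0 ?mulmx0 // -ltnS.
  by rewrite (ls_eAse LS) // -1?ltnS //; apply/orP; left; exact: leq_trans lt im.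
have yE : As *m u i = nu i *: u i + y by rewrite /y addrC subrK.
exists (if i is k.+1 then c k else 0); split; last by move=> ->.
rewrite yE cE; congr (_ + _); case: i {id y uW yW yf cE yE} c0 => [|i] c0.
  by rewrite big_ord0 scale0r.
by rewrite big_ord_recr /= big1 ?add0r // => k _; rewrite c0 ?scale0r.
Qed.

End Leonard.

(** * Split sequences and their boundary values for the two orders *)

Section SecondSplit.
Variables (C : fieldType) (n d : nat).
Local Notation V := 'cV[C]_n.
Variables (W : {vspace V}) (A As : 'M[C]_n).

(** The relation is included at d + 1, where [u] and [phi] vanish, so that the recurrence can be
    stated uniformly up to its last instance. *)
Definition second_split (nu : nat -> C) (u : nat -> V) (phi : nat -> C) : Prop :=
  [/\ phi 0 = 0, forall i, (d < i)%N -> phi i = 0,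
      forall i, (i <= d.+1)%N -> As *m u i = nu i *: u i + phi i *: u i.-1
    & forall i, (1 <= i <= d)%N -> phi i != 0].

(** If [phi i] were 0 with i >= 1, the vectors killed by all [e k] with k < i would be stable under
    [A] and [As]. They include [u d] but not [w 0], against irreducibility. *)
Lemma second_split_exists e f mu nu w : leonard_system d W A As e f mu nu w ->
  exists phi, second_split nu (split_basis A mu w) phi.
Proof.
move=> LS; set u := split_basis A mu w.
have ugt j : (d < j)%N -> u j = 0 := @split_basis_gt _ _ _ _ _ _ _ _ _ _ _ LS j.
have /choice [g gP] : forall i, exists p, (i <= d)%N -> As *m u i = nu i *: u i + p *: u i.-1 /\ (i = 0%N -> p = 0).
  move=> i; have [id|id] := leqP i d; last by exists 0.
  by have [p pP] := split_basis_As LS id; exists p.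
exists (fun i => if (i <= d)%N then g i else 0); split.
- by rewrite leq0n; have [_ ->] := gP 0 (leq0n d).
- by move=> i di; rewrite leqNgt di.
- move=> i; rewrite leq_eqVlt => /predU1P [->|id].
    by rewrite ltnn scale0r ugt // mulmx0 scaler0 addr0.
  by rewrite -ltnS id; have [] := gP i id.
move=> i /andP [i0 id]; rewrite id; apply/eqP => gi0.
pose P v := v \in W /\ forall k, (k < i)%N -> e k *m v = 0.
have P0 : P 0 by split=> [|k _]; rewrite ?mem0v ?mulmx0.
have PD x y : P x -> P y -> P (x + y).
  by move=> [xW xe] [yW ye]; split=> [|k ki]; rewrite ?memvD // mulmxDr xe ?ye ?addr0.
have PZ k x : P x -> P (k *: x).
  by move=> [xW xe]; split=> [|m mi]; rewrite ?memvZ // -scalemxAr xe ?scaler0.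
have Pu j : (i <= j)%N -> P (u j).
  move=> ij; split=> [|k ki]; first exact: split_basis_mem LS j.
  by rewrite (split_basis_e0 LS) ?(leq_trans ki) // ltnW // (leq_trans ki).
have [U UP] := vspace_of_closed P0 PD PZ.
have UW : (U <= W)%VS by apply/subvP => v /UP [].
have UA v : v \in U -> A *m v \in U.
  move=> /UP [vW ve]; apply/UP; split=> [|k ki]; first exact: ls_A LS _ vW.
  by rewrite (ls_eA LS) ?ve ?scaler0 // ltnW // (leq_trans ki).
have UAs v : v \in U -> As *m v \in U.
  move=> /UP [vW ve]; have [c cE] := split_basis_span LS vW.
  have c0 : forall k, (k < i)%N -> c k = 0.
    by apply: (split_coef0 LS (m := d.+1)) => // [|k ki]; rewrite ?leqW // -cE ve.
  rewrite cE mulmx_sumr; apply/UP; elim/big_rec: _ => // j x _ Px; apply: (PD) => //.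
  rewrite -scalemxAr; have [ji|ij] := ltnP j i; first by rewrite c0 ?scale0r.
  have [-> _] := gP j (ltn_ord j); apply/PZ/PD; first exact/PZ/Pu.
  move: ij; rewrite leq_eqVlt => /predU1P [<-|ij]; first by rewrite gi0 scale0r.
  by apply/PZ/Pu; case: (nat_of_ord j) ij.
case: (ls_irr LS UW UA UAs) => UE.
  have : u d \in U by apply/UP/Pu.
  rewrite UE memv0 => /eqP e0; have := ls_w LS (leqnn d).
  by rewrite -(split_basis_fdiag LS (leqnn d)) -/u e0 mulmx0 eqxx.
have : w 0 \in U by rewrite UE (ls_w0 LS).
by move=> /UP [_ /(_ 0%N i0)]; apply/eqP; apply: (ls_ew LS).
Qed.

Definition rev_family (T : Type) (g : nat -> T) (i : nat) := g (d - i)%N.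

Lemma leonard_rev e f mu mu' nu w : leonard_system d W A As e f mu nu w ->
  (forall i, (i <= d)%N -> mu' i = mu (d - i)%N) ->
  leonard_system d W A As (rev_family e) f mu' nu w.
Proof.
move=> LS mu'E.
have dS i : (d - i <= d)%N by apply: leq_subr.
have inj i j : (i <= d)%N -> (j <= d)%N -> (d - i = d - j)%N -> i = j by lia.
case: LS => h1 h2 ha hb h3 h4 h5 h6 h7 h8 h9 h10 h11 h12 h13 h14 h15 h16 h17 h18 h19.
split=> //; rewrite /rev_family.
- by move=> i v id vW; apply: ha.
- by move=> i v id vW; rewrite mu'E // h3.
- move=> i j id jd; rewrite h5 //; congr (if _ then _ else _).
  by apply/eqP/eqP => [/inj|->] //; apply.
- move=> v vW; rewrite {1}(h7 v vW) (reindex_inj rev_ord_inj).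
  by apply: eq_bigr => i _; rewrite /= subSS.
- move=> i j v vW id jd ij; apply: h9 => //; lia.
- by move=> i j id jd; rewrite !mu'E // => /h11 e'; apply: inj => //; apply: e'.
- by move=> i id; apply: h18.
Qed.

Section Boundary.
Variables (e f : nat -> 'M[C]_n) (mu mu' nu : nat -> C) (w : nat -> V).
Hypothesis mu'E : forall i, (i <= d)%N -> mu' i = mu (d - i)%N.
Hypothesis LS : leonard_system d W A As e f mu nu w.
Variables (phi phi' : nat -> C).
Let u := split_basis A mu w.
Let u' := split_basis A mu' w.
Hypothesis uP : second_split nu u phi.
Hypothesis u'P : second_split nu u' phi'.
Hypothesis d0 : (0 < d)%N.
Let LS' := leonard_rev LS mu'E.

(** The vectors [u 1] and [u' 1] differ by a multiple of [w 0]; [As] is evaluated on both. *)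
Lemma split_first : phi 1 - phi' 1 = (mu 0 - mu d) * (nu 1 - nu 0).
Proof.
have [_ _ uAs _] := uP; have [_ _ u'As _] := u'P.
have e1 := uAs 1%N (leqW d0); have e2 := u'As 1%N (leqW d0).
have eu : u' 1%N = u 1%N + (mu 0 - mu d) *: w 0.
  by rewrite /u /u' /= mu'E // subn0; lincomb C; rewrite /=; ring.
have e0 : As *m w 0 = nu 0 *: w 0.
  by have := uAs 0%N (leq0n _); have [-> _ _ _] := uP; rewrite scale0r addr0.
move: e2; rewrite {1}eu mulmxDr e1 -scalemxAr e0 eu [u 1.-1]/u [u' 1.-1]/u' /= => h.
have w0 := ls_w LS (leq0n d).
have : (phi 1 - phi' 1 - (mu 0 - mu d) * (nu 1 - nu 0)) *: w 0 = 0.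
  apply/eqP; rewrite -(subrr (nu 1 *: u 1 + phi 1 *: w 0 + (mu 0 - mu d) *: (nu 0 *: w 0))) {2}h.
  by apply/eqP; rewrite /u /=; lincomb C; rewrite /=; ring.
by move/eqP; rewrite scaler_eq0 (negPf w0) orbF subr_eq0 => /eqP.
Qed.

(** The scalar [s] is determined by [A], [f] and [w] alone, so its expression through [m d] and
    [p d] may be compared for the two orders of [e]. *)
Lemma split_last_f (p : nat -> C) m : second_split nu (split_basis A m w) p ->
  forall g, leonard_system d W A As g f m nu w ->
  exists s, m d = s + p d / (nu d.-1 - nu d) /\ f d *m (A *m w d) = s *: w d.
Proof.
move=> [_ _ xAs _] g LSg; set x := split_basis A m w in xAs.
have dE : d.-1.+1 = d by rewrite prednK.
have d1 : (d.-1 <= d)%N by apply: leq_pred.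
have nu0 : nu d.-1 - nu d != 0.
  by rewrite subr_eq0; apply/eqP => /(ls_nu LS d1 (leqnn d)); lia.
have wE i : (i <= d)%N -> w i = f i *m x i by move=> id; rewrite (split_basis_fdiag LSg).
have xW i : x i \in W by exact: split_basis_mem LSg i.
have [s sE] := ls_thin LSg (leqnn d) (ls_A LS (ls_f LS (leqnn d) (xW d))).
exists s; rewrite -wE // in sE; split=> //.
have fx : f d.-1 *m x d = (p d / (nu d.-1 - nu d)) *: w d.-1.
  have := congr1 (mulmx (f d.-1)) (xAs d (leqnSn d)).
  rewrite (ls_fAs LS) // mulmxDr -!scalemxAr -wE // => h.
  apply: (scalerI nu0); rewrite scalerA mulrC divfK // scalerBl h.
  by rewrite addrC addKr.
have xlast : x d.+1 = 0 := split_basis_last LSg.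
have : f d *m (A *m x d) = m d *: w d.
  have -> : A *m x d = m d *: x d by have := split_basisS A m w d; rewrite -/x xlast addr0.
  by rewrite -scalemxAr -wE.
rewrite (ls_fsum LS (xW d)) !mulmx_sumr big_ord_recr /= -wE // sE.
have d2 : (d.-1 < d)%N by rewrite dE.
rewrite (bigD1 (Ordinal d2)) //= big1 ?addr0 => [|k kd].
  rewrite fx -!scalemxAr; have := ls_wS LS d2; rewrite dE => -> h.
  have wd := ls_w LS (leqnn d); apply/eqP; rewrite -subr_eq0.
  have : (m d - (s + p d / (nu d.-1 - nu d))) *: w d = 0.
    by apply: (subr_transfer (esym h)); lincomb C; rewrite /=; ring.
  by move/eqP; rewrite scaler_eq0 (negPf wd) orbF.
rewrite (ls_fAf LS) ?xW //; first by rewrite ltnW.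
apply/orP; right; move: kd (ltn_ord k); rewrite -val_eqE /=; lia.
Qed.

Lemma split_last : phi d - phi' d = (mu d - mu 0) * (nu d.-1 - nu d).
Proof.
have d1 : (d.-1 <= d)%N by apply: leq_pred.
have nu0 : nu d.-1 - nu d != 0.
  by rewrite subr_eq0; apply/eqP => /(ls_nu LS d1 (leqnn d)); lia.
have [s [e1 sE]] := split_last_f uP LS.
have [s' [e2 s'E]] := split_last_f u'P LS'.
have ss : s = s'.
  apply/eqP; rewrite -subr_eq0; have : (s - s') *: w d = 0 by rewrite scalerBl -sE -s'E subrr.
  by move/eqP; rewrite scaler_eq0 (negPf (ls_w LS (leqnn d))) orbF.
move: e2; rewrite mu'E // subnn => ->; rewrite e1 -ss.
by field.
Qed.

(** Two evaluations of the scalar by which e_0 As acts on e_0 w_0. From [w 0] and [u 1] it is nu_0 +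
    phi_1 / (mu_0 - mu_1); from [u' d], a multiple of e_0 w_0, it is nu_d + phi'_d / (mu_0 -
    mu_1). *)
Lemma split_cross : phi 1 - phi' d = (mu 0 - mu 1) * (nu d - nu 0).
Proof.
have [_ _ uAs _] := uP; have [_ _ u'As _] := u'P.
have wW := ls_w0 LS; pose z := e 0 *m w 0.
have z0 : z != 0 by apply: (ls_ew LS).
have mu01 : mu 0 - mu 1 != 0.
  by rewrite subr_eq0; apply/eqP => /(ls_mu LS (leq0n _) d0).
have uW i : u i \in W by exact: split_basis_mem LS i.
have u'W i : u' i \in W by exact: split_basis_mem LS' i.
have zW : z \in W by rewrite /z (ls_e LS).
have e00 v : v \in W -> e 0 *m (e 0 *m v) = e 0 *m v by move=> vW; rewrite mulmxA (ls_ee LS).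
have h1 : e 0 *m (As *m z) = (nu 0 + phi 1 / (mu 0 - mu 1)) *: z.
  have a0 : e 0 *m (As *m w 0) = nu 0 *: z.
    have := uAs 0%N (leq0n _); have [-> _ _ _] := uP; rewrite scale0r addr0 => ->.
    by rewrite -scalemxAr.
  have a1 : e 0 *m (As *m u 1) = phi 1 *: z.
    rewrite (uAs 1%N (leqW d0)) mulmxDr -!scalemxAr.
    by rewrite [e 0 *m u 1](split_basis_e0 LS) // scaler0 add0r.
  have exp v : v \in W -> e 0 *m (As *m v) = e 0 *m (As *m (e 0 *m v)) + e 0 *m (As *m (e 1%N *m v)).
    move=> vW; rewrite {1}(ls_esum LS vW) !mulmx_sumr.
    rewrite big_ord_recl; congr (_ + _).
    have d1 : (0 < d)%N by [].
    rewrite (bigD1 (Ordinal d1)) //= big1 ?addr0 // => k kd.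
    rewrite (ls_eAse LS) // .
    by apply/orP; left; rewrite /bump /= add1n ltnS lt0n; apply: contra kd => /eqP k0; apply/eqP/val_inj.
  have e0u1 : e 0 *m u 1 = 0 by apply: (split_basis_e0 LS).
  have e1u1 : e 1%N *m u 1 = (mu 1%N - mu 0) *: (e 1%N *m w 0).
    by rewrite (split_basis_e LS) // big_ord1.
  have b0 := exp _ wW; have b1 := exp _ (uW 1%N).
  rewrite e0u1 !mulmx0 add0r e1u1 -!scalemxAr a1 in b1; rewrite a0 -/z in b0.
  move: b0 b1; set X := e 0 *m (As *m z); set Y := e 0 *m (As *m (e 1%N *m w 0)) => b0 b1.
  have YE : Y = (- phi 1 / (mu 0 - mu 1)) *: z.
    apply: (scalerI mu01); rewrite scalerA mulrC divfK //.
    by apply: (subr_transfer b1); lincomb C; rewrite /=; ring.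
  apply: (subr_transfer (esym b0)); rewrite YE.
  by lincomb C; rewrite /=; field.
have eu' : e 0 *m u' d = u' d.
  rewrite {2}(ls_esum LS (u'W d)) big_ord_recl big1 ?addr0 // => k _.
  have := split_basis_e0 LS' (k := (d - lift ord0 k)%N) (i := d).
  rewrite /rev_family /= subKn; last exact: ltn_ord.
  by apply; rewrite ?leq_subr // ltn_subrL d0 andbT.
have [g g0 u'z] : exists2 g, g != 0 & u' d = g *: z.
  have := split_basis_e LS' d (leqnn d); rewrite /rev_family subnn -/u' eu' => h.
  eexists; last exact: h.
  have := split_basis_ediag LS' (leqnn d); rewrite /rev_family subnn -/u' eu' h.
  by rewrite scaler_eq0 negb_or => /andP [].
have dE : d.-1.+1 = d by rewrite prednK.
have eu'1 : e 0 *m u' d.-1 = (mu 0 - mu 1)^-1 *: u' d.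
  have := congr1 (mulmx (e 0)) (split_basisS A mu' w d.-1).
  rewrite -/u' dE mulmxDr (ls_eA LS) ?u'W // eu' -scalemxAr.
  have -> : mu' d.-1 = mu 1 by rewrite mu'E ?leq_pred //; congr mu; lia.
  move=> h; apply: (scalerI mu01); rewrite scalerA mulfV // scale1r scalerBl h.
  by rewrite addrC addKr.
have h2 : e 0 *m (As *m u' d) = (nu d + phi' d / (mu 0 - mu 1)) *: u' d.
  rewrite (u'As d (leqnSn d)) mulmxDr -!scalemxAr eu' eu'1.
  by lincomb C; rewrite /=; ring.
move: h2; rewrite u'z -!scalemxAr h1 !scalerA => h2.
have : ((nu d + phi' d / (mu 0 - mu 1)) * g - g * (nu 0 + phi 1 / (mu 0 - mu 1))) *: z = 0.
  by rewrite scalerBl -h2 subrr.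
move/eqP; rewrite scaler_eq0 (negPf z0) orbF subr_eq0 mulrC => /eqP/(mulfI g0) h3.
apply/eqP; rewrite -subr_eq0; apply/eqP.
have -> : phi 1 - phi' d - (mu 0 - mu 1) * (nu d - nu 0) =
   (mu 0 - mu 1) * ((nu 0 + phi 1 / (mu 0 - mu 1)) - (nu d + phi' d / (mu 0 - mu 1))) by field.
by rewrite h3 subrr mulr0.
Qed.

End Boundary.
End SecondSplit.

(** Here [u0], ..., [u4] stand for [u i.-1], ..., [u i.+3] and [p] for the coordinate functional of
    [u i.+2]. The disjunctions allow i = 0, where no vector precedes [u i] and [f1] is 0. *)
Lemma td_coefficient (C : fieldType) n (A As : 'M[C]_n) (u0 u1 u2 u3 u4 : 'cV[C]_n) (p : 'rV[C]_n)
    (m0 m1 m2 m3 v1 v2 v3 v4 f1 f2 f3 f4 k r : C) :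
  (f1 = 0 \/ A *m u0 = m0 *: u0 + u1) -> A *m u1 = m1 *: u1 + u2 -> A *m u2 = m2 *: u2 + u3 ->
  A *m u3 = m3 *: u3 + u4 ->
  As *m u1 = v1 *: u1 + f1 *: u0 -> As *m u2 = v2 *: u2 + f2 *: u1 ->
  As *m u3 = v3 *: u3 + f3 *: u2 -> As *m u4 = v4 *: u4 + f4 *: u3 ->
  (f1 = 0 \/ p *m u0 = 0) -> p *m u1 = 0 -> p *m u2 = 0 -> p *m u3 = 1%:M -> p *m u4 = 0 ->
  A *m (A *m (A *m (As *m u1))) - (k + 1) *: (A *m (A *m (As *m (A *m u1))))
  + (k + 1) *: (A *m (As *m (A *m (A *m u1)))) - As *m (A *m (A *m (A *m u1)))
  - r *: (A *m (As *m u1) - As *m (A *m u1)) = 0 ->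
  v1 * (m1 + m2 + m3) + f1 - (k + 1) * (m1 * v1 + v2 * (m2 + m3) + f2)
  + (k + 1) * ((m1 + m2) * v2 + m3 * v3 + f3) - (m1 + m2 + m3) * v3 - f4 = 0.
Proof.
move=> e0 e1 e2 e3 g1 g2 g3 g4 p0 p1 p2 p3 p4.
rewrite !(e1, e2, e3, g1, g2, g3, g4, mulmxDr, =^~ scalemxAr, scalerDr, scalerA).
have one : forall s : C, s *: 1%:M = 0 :> 'M[C]_1 -> s = 0.
  by move=> s /matrixP/(_ 0 0); rewrite !mxE eqxx mulr1.
have [f0|[h0 q0]] : f1 = 0 \/ (A *m u0 = m0 *: u0 + u1 /\ p *m u0 = 0).
  by case: e0 p0 => [f0|e0'] [f0'|p0']; [left|left|left|right].
- rewrite f0 ?(scale0r, mulr0, mul0r, addr0) => /(congr1 (mulmx p)).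
  rewrite mulmx0 ?(mulmxDr, mulmxN, =^~ scalemxAr, p1, p2, p3, p4) => e; apply: one.
  by rewrite -[RHS]e; lincomb C; rewrite /=; ring.
rewrite ?(h0, e1, e2, e3, mulmxDr, =^~ scalemxAr, scalerDr, scalerA) => /(congr1 (mulmx p)).
rewrite mulmx0 ?(mulmxDr, mulmxN, =^~ scalemxAr, q0, p1, p2, p3, p4) => e; apply: one.
by rewrite -[RHS]e; lincomb C; rewrite /=; ring.
Qed.

(** * Solving the recurrence for the split sequence *)

Section Racah.
Variables (C : numClosedFieldType) (n d : nat).
Local Notation V := 'cV[C]_n.
Variables (W : {vspace V}) (A As : 'M[C]_n) (q : C).
Hypothesis q0 : q != 0.
Hypothesis qi : forall i, (1 <= i <= d)%N -> q ^+ (2 * i) != 1.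

Local Notation lam := (lam d q).

Definition qeig (a b : C) (i : nat) : C := a / lam i + b * lam i.

Section TD.
Variables (a b as_ bs : C) (e f : nat -> 'M[C]_n) (w : nat -> V) (phi : nat -> C).
Hypothesis LS : leonard_system d W A As e f (qeig a b) (qeig bs as_) w.
Let mu := qeig a b.
Let nu := qeig bs as_.
Let u := split_basis A mu w.
Hypothesis uP : second_split d As nu u phi.

Let bet := q ^+ 2 + q ^- 2.
Let rh := a * b * (4 - bet ^+ 2).

Lemma mu_td i : mu i ^+ 2 - bet * mu i * mu i.+1 + mu i.+1 ^+ 2 = rh.
Proof.
rewrite /mu /qeig lamS /bet /rh /bet; have := lam_neq0 d q0 i; move: (lam i) => L L0.
by field; rewrite q0 L0.
Qed.

Lemma ls_Ae j v : (j <= d)%N -> v \in W -> A *m (e j *m v) = mu j *: (e j *m v).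
Proof.
move=> jd vW; have ejW := ls_e LS jd vW.
rewrite (ls_esum LS (ls_A LS ejW)) [in RHS](ls_esum LS ejW) scaler_sumr; apply: eq_bigr => k _.
rewrite (ls_eA LS) -1?ltnS // !mulmxA (ls_ee LS) // -1?ltnS //.
by case: eqP => [->|]; rewrite ?mul0mx ?scaler0.
Qed.

(* The tridiagonal relation
   [A, A^2 As - bet A As A + As A^2 - rh As] = 0 of Terwilliger. *)
Definition td_word (v : V) : V := A *m (A *m (A *m (As *m v))) - (bet + 1) *: (A *m (A *m (As *m (A *m v))))
  + (bet + 1) *: (A *m (As *m (A *m (A *m v)))) - As *m (A *m (A *m (A *m v)))
  - rh *: (A *m (As *m v) - As *m (A *m v)).

(** Between e_i and e_j the word is e_i As e_j times (mu_i - mu_j) (mu_i^2 - bet mu_i mu_j + mu_j^2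
    - rh). One of the scalar factors vanishes if i and j differ by at most 1, and e_i As e_j
    vanishes otherwise. *)
Lemma td_word0 v : v \in W -> td_word v = 0.
Proof.
move=> vW.
have tdsum (I : Type) (r : seq I) (F : I -> V) : td_word (\sum_(i <- r) F i) = \sum_(i <- r) td_word (F i).
  have tdD x y : td_word (x + y) = td_word x + td_word y.
    by rewrite /td_word !mulmxDr; lincomb C; rewrite /=; ring.
  by elim/big_rec2: _ => [|i y x _ <-]; [rewrite /td_word !mulmx0 !(subr0, scaler0, addr0)|rewrite tdD].
rewrite (ls_esum LS vW) tdsum big1 // => j _.
have jd : (j <= d)%N by rewrite -ltnS.
have ejW := ls_e LS jd vW.
have tW : td_word (e j *m v) \in W.
  have LA := ls_A LS; have LB := ls_As LS.
  by rewrite /td_word !(memvB, memvD, memvZ) // ?LA ?LB // ?LA ?LB // ?LA ?LB // ?LA ?LB.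
rewrite (ls_esum LS tW) big1 // => i _.
have id : (i <= d)%N by rewrite -ltnS.
have AW := ls_A LS; have BW := ls_As LS; have eA v0 (v0W : v0 \in W) := ls_eA LS id v0W.
rewrite /td_word !(ls_Ae jd vW) -?scalemxAr !(ls_Ae jd vW) -?scalemxAr !(ls_Ae jd vW) -?scalemxAr.
rewrite ?(mulmxBr, mulmxDr) -?scalemxAr ?(mulmxBr, mulmxDr) -?scalemxAr.
rewrite !eA ?AW ?BW ?AW //.
have : (mu i - mu j) *: ((mu i ^+ 2 - bet * mu i * mu j + mu j ^+ 2 - rh) *: (e i *m (As *m (e j *m v)))) = 0.
  have [ij|[ij|[ij|ij]]] : i = j :> nat \/ i = j.+1 :> nat \/ j = i.+1 :> nat \/ (i.+1 < j)%N || (j.+1 < i)%N by lia.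
  - by rewrite ij subrr scale0r.
  - suff -> : mu i ^+ 2 - bet * mu i * mu j + mu j ^+ 2 - rh = 0 by rewrite scale0r scaler0.
    by rewrite ij -(mu_td j); ring.
  - suff -> : mu i ^+ 2 - bet * mu i * mu j + mu j ^+ 2 - rh = 0 by rewrite scale0r scaler0.
    by rewrite ij -(mu_td i); ring.
  - by rewrite (ls_eAse LS) // !scaler0.
move: (e i *m (As *m (e j *m v))) => z <-; rewrite -/mu; move: (mu i) (mu j) => x y.
by lincomb C; rewrite /=; ring.
Qed.

(** The independent columns [u 0], ..., [u d] have a left inverse through their Gram matrix; its row
    m is the functional. *)
Lemma split_coordinate m : (m <= d)%N ->
  exists p : 'rV[C]_n, forall j, (j <= d.+1)%N -> p *m u j = (m == j)%:R%:M.
Proof.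
move=> md; pose B : 'M[C]_(n, d.+1) := \matrix_(x, j) u j x 0.
have BE (v : 'cV_d.+1) : B *m v = \sum_(i < d.+1) v i 0 *: u i.
  by apply/matrixP => x y; rewrite ord1 summxE mxE; apply: eq_bigr => i _; rewrite !mxE mulrC.
have /gram_unit gu : forall v : 'cV_d.+1, B *m v = 0 -> v = 0.
  move=> v; rewrite BE => v0; apply/matrixP => i y; rewrite ord1 mxE.
  have := @split_basis_free _ _ _ _ _ _ _ _ _ _ _ LS (fun k => v (inord k) 0) _ i.
  rewrite inord_val; apply; last by rewrite -ltnS.
  by rewrite -[RHS]v0; apply: eq_bigr => k _; rewrite inord_val.
exists (row (inord m) (invmx (adjm B *m B) *m adjm B)) => j; rewrite leq_eqVlt => /predU1P [->|jd].
  by rewrite [u _](split_basis_last LS) mulmx0 ltn_eqF // mulr0n raddf0.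
have -> : u j = B *m delta_mx (Ordinal jd) 0.
  by rewrite -colE; apply/matrixP => x y; rewrite ord1 !mxE.
rewrite -row_mul mulmxA -[_ *m adjm B *m B]mulmxA mulVmx // mul1mx.
apply/matrixP => x y; rewrite !ord1 !mxE eqxx andbT mulr1n -val_eqE /= inordK //.
Qed.

(* Coefficient of [u i.+2] in the tridiagonal relation applied to [u i]. *)
Lemma phi_td i : (i.+2 <= d)%N ->
  let ph k := phi k - lfact d q k * (a * bs + b * as_ * (lam k / q) ^+ 2) in
  ph i.+3 - (bet + 1) * ph i.+2 + (bet + 1) * ph i.+1 - ph i = 0.
Proof.
move=> id ph; have i2 : (i.+2 <= d)%N by [].
have [p pu] := split_coordinate i2.
have [phi0 _ uAs _] := uP.
have Au j : A *m u j = mu j *: u j + u j.+1 := split_basisS A mu w j.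
have tdu := td_word0 (split_basis_mem LS i).
have pj j : (j <= d.+1)%N -> (i.+2 == j) = false -> p *m u j = 0.
  by move=> /pu -> ->; rewrite mulr0n raddf0.
have h0 : phi i = 0 \/ A *m u i.-1 = mu i.-1 *: u i.-1 + u i.
  by case: (i) => [|k]; [left|right; apply: Au].
have h1 : phi i = 0 \/ p *m u i.-1 = 0.
  by case: (i) id pj => [|k] id' pj'; [left|right; apply: pj'; lia].
have g1 := uAs i (leqW (leq_trans (leqW (leqnSn i)) id)).
have g2 := uAs i.+1 (leqW (ltnW id)).
have g3 := uAs i.+2 (leqW id).
have g4 := uAs i.+3 id.
have p1 : p *m u i = 0 by apply: pj; lia.
have p2 : p *m u i.+1 = 0 by apply: pj; lia.
have p3 : p *m u i.+2 = 1%:M by rewrite pu ?eqxx // leqW.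
have p4 : p *m u i.+3 = 0 by apply: pj; lia.
have S := td_coefficient h0 (Au i) (Au i.+1) (Au i.+2) g1 g2 g3 g4 h1 p1 p2 p3 p4 tdu.
apply/eqP; rewrite -oppr_eq0 -[X in _ == X]S; apply/eqP.
rewrite /ph /mu /nu /qeig /lfact /bet !lamS.
have := lam_neq0 d q0 i; move: (lam i) => L L0; move: (q ^+ d) (expf_neq0 d q0) => Q Q0.
by field; rewrite q0 L0 Q0.
Qed.

End TD.

(** The sequence [h] is the combination of the characteristic solutions 1, q^(2i), q^(-2i) that
    vanishes at 0 and 1; [g] is proportional to it, and [h d] is nonzero. *)
Lemma third_order_zero (g : nat -> C) : (1 < d)%N ->
  (forall i, (i.+2 <= d)%N ->
     g i.+3 - (q ^+ 2 + q ^- 2 + 1) * g i.+2 + (q ^+ 2 + q ^- 2 + 1) * g i.+1 - g i = 0) ->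
  g 0 = 0 -> g 1 = 0 -> g d = 0 -> forall i, (i <= d)%N -> g i = 0.
Proof.
move=> d1 grec g0 g1 gd.
pose h i := (q ^+ (2 * i) - 1) * (q ^+ (2 * i) - q ^+ 2) / q ^+ (2 * i).
have h_neq0 i : (1 < i <= d)%N -> h i != 0.
  case: i => [|[|i]] // id.
  have a1 : q ^+ (2 * i.+2) - 1 != 0 by rewrite subr_eq0 qi.
  have a2 : q ^+ (2 * i.+2) - q ^+ 2 != 0.
    rewrite mulnS exprD -[X in _ - X]mulr1 -mulrBr mulf_neq0 ?expf_neq0 // subr_eq0 qi //.
    exact: ltnW.
  by rewrite /h !mulf_neq0 ?invr_eq0 ?expf_neq0.
have claim i : (i <= d)%N -> [/\ g i * h 2 = g 2 * h i, (i.+1 <= d.+1)%N -> g i.+1 * h 2 = g 2 * h i.+1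
    & (i.+2 <= d.+1)%N -> g i.+2 * h 2 = g 2 * h i.+2].
  elim: i => [_|i IH id].
    have h0 : h 0 = 0 by rewrite /h muln0 expr0 subrr !mul0r.
    have h1 : h 1 = 0 by rewrite /h subrr mulr0 mul0r.
    by rewrite g0 g1 h0 h1 !mul0r !mulr0.
  have [e0 e1 e2] := IH (ltnW id); split=> [||i2]; [exact: e1 (leqW id)|exact: e2|].
  have e3 := grec i i2.
  have -> : g i.+3 = (q ^+ 2 + q ^- 2 + 1) * g i.+2 - (q ^+ 2 + q ^- 2 + 1) * g i.+1 + g i.
    by apply: (subr_transfer e3); ring.
  rewrite mulrDl mulrBl -!mulrA e0 e1 ?e2 //; last by apply: ltnW.
  rewrite /h !mulnS !exprD.
  by field; rewrite !expf_neq0 ?q0.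
have h20 : h 2 != 0 by apply: h_neq0.
have g20 : g 2 = 0.
  have [e _ _] := claim d (leqnn d); move: e; rewrite gd mul0r => /esym/eqP.
  by rewrite mulf_eq0 (negPf (h_neq0 d _)) ?d1 ?leqnn // orbF => /eqP.
move=> i id; have [e _ _] := claim i id; move/eqP: e.
by rewrite g20 mul0r mulf_eq0 (negPf h20) orbF => /eqP.
Qed.

Lemma lfact_neq0 i : (1 <= i <= d)%N -> lfact d q i != 0.
Proof.
case: i => // i /andP [_ id]; rewrite /lfact /lam.
have Q0 := expf_neq0 d q0.
have -> : q ^+ d * (q ^+ (2 * i.+1) / q ^+ d) = q ^+ (2 * i.+1) by rewrite mulrC divfK.
have -> : q ^+ d * q ^+ 2 / (q ^+ (2 * i.+1) / q ^+ d) = q ^+ (2 * (d - i)).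
  rewrite invf_div mulrA; apply: (canLR (mulfK (expf_neq0 _ q0))).
  by rewrite -!exprD; congr (_ ^+ _); lia.
rewrite mulf_neq0 // subr_eq0 eq_sym ?qi //; last by lia.
by rewrite invr_eq1 qi.
Qed.

Section Formula.
Variables (a b as_ bs : C) (e f : nat -> 'M[C]_n) (w : nat -> V) (phi phi' : nat -> C).
Let mu := qeig a b.
Let mu' := qeig b a.
Let nu := qeig bs as_.
Hypothesis LS : leonard_system d W A As e f mu nu w.
Let u := split_basis A mu w.
Let u' := split_basis A mu' w.
Hypothesis uP : second_split d As nu u phi.
Hypothesis u'P : second_split d As nu u' phi'.

Lemma lam_rev i : (i <= d)%N -> lam (d - i) = (lam i)^-1.
Proof.
move=> id; rewrite /lam invf_div; apply: (canLR (mulfK (expf_neq0 _ q0))).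
rewrite mulrAC -exprD; apply: (canRL (mulfK (expf_neq0 _ q0))); rewrite -exprD.
by congr (_ ^+ _); lia.
Qed.

Lemma mu_rev i : (i <= d)%N -> mu' i = mu (d - i)%N.
Proof. by move=> id; rewrite /mu' /mu /qeig lam_rev // invrK addrC. Qed.

(** The value of the free constant for which [phi_formula] holds at i = 1. *)
Definition racah_Y := phi 1 / lfact d q 1 / (lam 1 / q) - (a * bs + b * as_ * (lam 1 / q) ^+ 2) / (lam 1 / q).

(** The defect [g] solves the homogeneous recurrence, since [lfact d q k * lam k] is a combination
    of 1, q^(2k) and q^(-2k), and it vanishes at 0, 1 and d. *)
Lemma phi_formula i : (1 <= i <= d)%N ->
  phi i = lfact d q i * (a * bs + b * as_ * (lam i / q) ^+ 2 + (lam i / q) * racah_Y).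
Proof.
move=> /andP [i1 id].
have l1 : lfact d q 1 != 0 by apply: lfact_neq0; rewrite (leq_trans i1 id).
have e1 : lam 1 / q != 0 by rewrite mulf_neq0 ?invr_eq0 ?lam_neq0.
pose g k := phi k - lfact d q k * (a * bs + b * as_ * (lam k / q) ^+ 2) - lfact d q k * (lam k / q) * racah_Y.
have lf0 : lfact d q 0 = 0 by rewrite /lfact /lam expr0 mul1r mulfV ?expf_neq0 // invr1 subrr mul0r.
have g0 : g 0 = 0 by have [p0 _ _ _] := uP; rewrite /g lf0 p0 !mul0r !subr0.
have g1 : g 1%N = 0.
  rewrite /g /racah_Y; move: (lfact d q 1) (lam 1 / q) l1 e1 => z y z0 y0.
  by field; rewrite z0 y0.
suff gi : g i = 0 by apply: (subr_transfer gi); rewrite /g; ring.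
move: i1; rewrite leq_eqVlt => /predU1P [<- //|i2].
have d1 : (1 < d)%N by apply: leq_trans id.
apply: (third_order_zero d1) => //.
  move=> k kd; have /= e3 := phi_td LS uP kd; apply: (subr_transfer e3).
  rewrite /g /lfact !lamS; have := lam_neq0 d q0 k; move: (lam k) => L L0.
  move: (q ^+ d) (expf_neq0 d q0) racah_Y => Q Q0 Y.
  by field; rewrite q0 L0 Q0.
have d0 : (0 < d)%N by apply: ltnW.
have r2 := split_last mu_rev LS uP u'P d0; have r3 := split_cross mu_rev LS uP u'P d0.
(* Both boundary relations contain [phi' d]; eliminating it expresses [phi d] through [phi 1]. *)
have pE : phi d = phi 1 - (mu 0 - mu 1) * (nu d - nu 0) + (mu d - mu 0) * (nu d.-1 - nu d).
  by rewrite -r2 -r3; ring.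
suff : g d = g 1%N by move=> ->.
have lamd1 : lam d = q ^+ 2 * lam d.-1 by rewrite -lamS prednK.
have lamd : lam d = q ^+ d by rewrite /lam mul2n -addnn exprD mulfK ?expf_neq0.
have lam0 : lam 0 = (q ^+ d)^-1 by rewrite /lam expr0 mul1r.
have lamp : lam d.-1 = q ^+ d / q ^+ 2 by rewrite -lamd lamd1 mulrC mulKf ?expf_neq0.
rewrite /g pE /mu /nu /qeig /lfact lamp lamS lam0 lamd; move: racah_Y => Y.
move: (q ^+ d) (expf_neq0 d q0) => Q Q0.
by field; rewrite ?q0 ?Q0 ?oner_neq0.
Qed.

End Formula.

(* [c] is a root of b bs c^2 - Y c + a as_; the two split sequences share the constant
   [Y], so the nonvanishing of [phi'] gives that of [1 + c (lam i / q)]. *)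
Theorem leonard_evaluation (a b as_ bs : C) (e f : nat -> 'M[C]_n) (w : nat -> V) (phi phi' : nat -> C) :
  a != 0 -> b != 0 -> as_ != 0 -> bs != 0 ->
  leonard_system d W A As e f (qeig a b) (qeig bs as_) w ->
  second_split d As (qeig bs as_) (split_basis A (qeig a b) w) phi ->
  second_split d As (qeig bs as_) (split_basis A (qeig b a) w) phi' ->
  exists2 c, c != 0 & forall i, (1 <= i <= d)%N ->
    [/\ phi i = lfact d q i * (a + b * c * (lam i / q)) * (bs + as_ / c * (lam i / q)),
        a + b * c * (lam i / q) != 0 & 1 + c * (lam i / q) != 0].
Proof.
move=> a0 b0 as0 bs0 LS uP u'P.
(* For d = 0 there is nothing to factor and any nonzero [c] will do. *)
have [d0|d0] := posnP d; first by exists 1; [exact: oner_neq0|move=> i; rewrite d0; case: i].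
have revE i : (i <= d)%N -> qeig b a i = qeig a b (d - i)%N by exact: mu_rev.
have LS' := leonard_rev LS revE.
have phiE := phi_formula LS uP u'P.
have uP'' : second_split d As (qeig bs as_) (split_basis A (qeig a b) w) phi by [].
have phi'E := phi_formula LS' u'P uP''.
set Y := racah_Y a b as_ bs phi in phiE.
(* The sequence for the reversed order has a and b exchanged; [split_first] relates the values at 1,
   which fix the two constants. *)
have YE : racah_Y b a as_ bs phi' = Y.
  have r1 := split_first revE LS uP u'P d0.
  have p1E : phi' 1%N = phi 1%N - (qeig a b 0 - qeig a b d) * (qeig bs as_ 1 - qeig bs as_ 0).
    by rewrite -r1; ring.
  have l1 : lfact d q 1 != 0 by apply: lfact_neq0.
  have lamd : lam d = q ^+ d by rewrite /lam mul2n -addnn exprD mulfK ?expf_neq0.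
  have lam0 : lam 0 = (q ^+ d)^-1 by rewrite /lam expr0 mul1r.
  rewrite /Y /racah_Y p1E /qeig lamd.
  suff e1 : (a / lam 0 + b * lam 0 - (a / q ^+ d + b * q ^+ d)) * (bs / lam 1 + as_ * lam 1 - (bs / lam 0 + as_ * lam 0))
    = lfact d q 1 * ((a - b) * bs + (b - a) * as_ * (lam 1 / q) ^+ 2).
    rewrite e1; have := lam_neq0 d q0 1; move: (lfact d q 1) l1 (lam 1) => z z0 L L0.
    by field; rewrite q0 z0 L0.
  rewrite /lfact lamS lam0; move: (q ^+ d) (expf_neq0 d q0) => Q Q0.
  by field; rewrite q0 Q0.
rewrite YE in phi'E.
pose c := (Y + sqrtC (Y ^+ 2 - 4 * (b * bs) * (a * as_))) / (2 * (b * bs)).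
have cE : b * bs * c ^+ 2 - Y * c + a * as_ = 0.
  have sE := sqrtCK (Y ^+ 2 - 4 * (b * bs) * (a * as_)).
  rewrite /c; move: (sqrtC _) sE => s sE.
  have -> : a * as_ = (Y ^+ 2 - s ^+ 2) / (4 * (b * bs)) by rewrite sE; field; rewrite b0 bs0.
  by field; rewrite b0 bs0.
have c0 : c != 0.
  apply/eqP => c0; move: cE; rewrite c0 expr0n mulr0 mulr0 subr0 add0r => /eqP.
  by rewrite mulf_eq0 (negPf a0) (negPf as0).
have YcE : Y = b * bs * c + a * as_ / c.
  apply: (mulIf c0); apply: (subr_transfer (esym cE)).
  by field.
exists c => // i id.
have pE : phi i = lfact d q i * (a + b * c * (lam i / q)) * (bs + as_ / c * (lam i / q)).
  by rewrite phiE // YcE; field; rewrite q0 c0.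
have p'E : phi' i = lfact d q i * (1 + c * (lam i / q)) * (b * bs + a * as_ / c * (lam i / q)).
  by rewrite phi'E // YcE; field; rewrite q0 c0.
have [_ _ _ /(_ i id)] := uP; rewrite pE !mulf_eq0 !negb_or -andbA => /and3P [_ h1 _].
have [_ _ _ /(_ i id)] := u'P; rewrite p'E !mulf_eq0 !negb_or -andbA => /and3P [_ h2 _].
by split.
Qed.

End Racah.

(** * Thin irreducible modules *)

Section Chain.
Variables (C : fieldType) (n D : nat).
Local Notation V := 'cV[C]_n.
Variable (W : {vspace V}).

(** Lagrange interpolation: applying A - th_k for all k other than i leaves a nonzero multiple of
    the component [E i *m v]. *)
Lemma spectral_stable (A : 'M[C]_n) (E : nat -> 'M[C]_n) (th : nat -> C) (U : {vspace V}) :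
  \sum_(i < D.+1) E i = 1%:M ->
  (forall i, (i <= D)%N -> A *m E i = th i *: E i) ->
  (forall i j, (i <= D)%N -> (j <= D)%N -> th i = th j -> i = j) ->
  (forall v, v \in U -> A *m v \in U) ->
  forall i v, (i <= D)%N -> v \in U -> E i *m v \in U.
Proof.
move=> E1 AE thI UA i v id vU.
pose op (s : seq C) := foldr (fun c x => A *m x - c *: x) v s.
have opU s : op s \in U by elim: s => //= c s IH; rewrite memvB ?memvZ ?UA.
have opE s : op s = \sum_(k < D.+1) (\prod_(c <- s) (th k - c)) *: (E k *m v).
  elim: s => [|c s IH] /=.
    rewrite -[v in LHS]mul1mx -E1 mulmx_suml; apply: eq_bigr => k _.
    by rewrite big_nil scale1r.
  rewrite IH mulmx_sumr scaler_sumr -sumrB; apply: eq_bigr => k _.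
  rewrite -scalemxAr mulmxA AE -1?ltnS // -scalemxAl !scalerA big_cons -scalerBl.
  by congr (_ *: _); ring.
have id' : (i < D.+1)%N by [].
pose s := [seq th (k : nat) | k : 'I_D.+1 <- rem (Ordinal id') (enum 'I_D.+1)].
have sP (k : 'I_D.+1) : (th k \in s) = (k != Ordinal id').
  rewrite mem_map; first by rewrite mem_rem_uniq ?enum_uniq // inE mem_enum andbT.
  by move=> x y /thI h; apply/val_inj/h; rewrite -ltnS.
have c0 : \prod_(c <- s) (th i - c) != 0.
  rewrite prodf_seq_neq0; apply/allP => c /mapP [k]; rewrite mem_rem_uniq ?enum_uniq // inE => /andP [ki _] ->.
  rewrite /= subr_eq0; apply: contra ki => /eqP/thI h; apply/eqP/val_inj; rewrite /= h //.
  by rewrite -ltnS.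
have := opU s; rewrite opE (bigD1 (Ordinal id')) //= [X in _ + X]big1 ?addr0 => [h|k ki].
  by have := memvZ (\prod_(c <- s) (th i - c))^-1 h; rewrite scalerK.
have : th k \in s by rewrite sP.
by case/path.splitPr => s1 s2; rewrite big_cat big_cons /= subrr mul0r mulr0 scale0r.
Qed.

Variables (B : 'M[C]_n) (F : nat -> 'M[C]_n).
Hypothesis FF : forall i j, (i <= D)%N -> (j <= D)%N -> F i *m F j = if i == j then F i else 0.
Hypothesis F1 : \sum_(i < D.+1) F i = 1%:M.
Hypothesis FBF : forall i j, (i <= D)%N -> (j <= D)%N -> (i.+1 < j)%N || (j.+1 < i)%N -> F i *m B *m F j = 0.
Hypothesis W0 : W != 0%VS.
Hypothesis WF : forall i v, (i <= D)%N -> v \in W -> F i *m v \in W.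
Hypothesis WB : forall v, v \in W -> B *m v \in W.
Hypothesis Wirr : forall U : {vspace V}, (U <= W)%VS -> (forall i v, (i <= D)%N -> v \in U -> F i *m v \in U) ->
  (forall v, v \in U -> B *m v \in U) -> U = 0%VS \/ U = W.
Hypothesis Wthin : forall i u v, (i <= D)%N -> u \in W -> v \in W -> F i *m u != 0 ->
  exists k, F i *m v = k *: (F i *m u).

(** The last clause says that [w 0] generates [W] under [B]; through it thinness passes to the other
    family of idempotents. *)
Definition is_chain (r d : nat) (w : nat -> V) : Prop :=
  [/\ (r + d <= D)%N /\ \dim W = d.+1,
      forall i, (i <= d)%N -> [/\ w i \in W, F (r + i) *m w i = w i & w i != 0],
      forall i, (i < d)%N -> F (r + i.+1) *m (B *m w i) = w i.+1,
      forall j v, (j <= D)%N -> v \in W -> F j *m v != 0 -> (r <= j <= r + d)%N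
    & forall U : {vspace V}, w 0 \in U -> (forall v, v \in U -> B *m v \in U) -> (W <= U)%VS].

(** The chain starts in the lowest nonzero component of [W] and follows the top component of
    [B *m w i]. By thinness and minimality of r the other components are multiples of earlier chain
    vectors, so the chain spans a stable subspace, which is [W]. *)
Lemma chain_exists : exists r d w, is_chain r d w.
Proof.
have F1v (v : V) : v = \sum_(j < D.+1) F j *m v by rewrite -mulmx_suml F1 mul1mx.
have exr : exists r, (r <= D)%N && `[< exists2 v, v \in W & F r *m v != 0 >].
  apply: contrapT => /forallNP h; case/negP: W0; rewrite -subv0; apply/subvP => v vW.
  rewrite (F1v v) big1 ?mem0v // => j _; apply/eqP; apply/negPn/negP => jv.
  by apply: (h j); rewrite -ltnS ltn_ord; apply/asboolP; exists v.
have [r /andP [rD /asboolP [v0 v0W rv0]] rmin] := ex_minnP exr.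
have {}rmin j v : (j <= D)%N -> v \in W -> F j *m v != 0 -> (r <= j)%N.
  by move=> jD vW jv; apply: rmin; rewrite jD; apply/asboolP; exists v.
(* The hypotheses on [F] stop at D; the value 0 beyond it forces the chain to end. *)
pose G j := if (j <= D)%N then F j else 0.
pose w := fix w i := if i is k.+1 then G (r + k.+1)%N *m (B *m w k) else F r *m v0.
have wS i : w i.+1 = G (r + i.+1)%N *m (B *m w i) by [].
have wW i : w i \in W.
  elim: i => [|i IH]; first exact: WF.
  by rewrite wS /G; case: ifP => h; [rewrite WF ?WB|rewrite mul0mx mem0v].
have wF i : (r + i <= D)%N -> F (r + i) *m w i = w i.
  case: i => [|i] iD; first by rewrite addn0 mulmxA FF // eqxx.
  by rewrite wS /G iD mulmxA FF // eqxx.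
have exd : exists i, w i.+1 == 0.
  by exists D; rewrite wS /G leqNgt ifN ?mul0mx // negbK leq_addl.
have [d /eqP wd dmin] := ex_minnP exd.
have w_neq0 i : (i <= d)%N -> w i != 0.
  by case: i => // i id; apply/negP => /dmin; rewrite leqNgt id.
have rdD : (r + d <= D)%N.
  case: (d) (w_neq0 d (leqnn d)) => [|k]; first by rewrite addn0.
  by rewrite wS /G; case: ifP => // _; rewrite mul0mx eqxx.
have riD i : (i <= d)%N -> (r + i <= D)%N by move=> id; apply: leq_trans rdD; rewrite leq_add2l.
have thin i v : (i <= d)%N -> v \in W -> exists k, F (r + i)%N *m v = k *: w i.
  move=> id vW; have [|k kE] := @Wthin (r + i)%N (w i) v (riD i id) (wW i) vW.
    by rewrite wF ?riD ?w_neq0.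
  by exists k; rewrite kE wF ?riD.
have FBw (j : nat) i : (j <= D)%N -> (i <= d)%N -> j != (r + i.+1)%N ->
    exists x k, (k <= i)%N /\ F j *m (B *m w i) = x *: w k.
  move=> jD id j1; have BwW := WB (wW i).
  have [->|j2] := eqVneq j (r + i)%N; first by have [x ->] := thin i _ id BwW; exists x, i.
  have [ji|j3] := eqVneq j.+1 (r + i)%N.
    case: i id ji {j1 j2} BwW => [|k] kd ji BwW.
      exists 0, 0%N; split=> //; rewrite scale0r; apply/eqP/negPn/negP => /(rmin _ _ jD BwW).
      by lia.
    have -> : j = (r + k)%N by lia.
    by have [x ->] := thin k _ (ltnW kd) BwW; exists x, k.
  exists 0, i; split=> //; rewrite scale0r -(wF i) ?riD // !mulmxA FBF ?mul0mx ?riD //.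
  by move: j1 j2 j3; lia.
have cyc (U : {vspace V}) : w 0 \in U -> (forall v, v \in U -> B *m v \in U) -> forall i, (i <= d)%N -> w i \in U.
  move=> w0U UB; elim/ltn_ind => -[//|i] IH id.
  rewrite wS /G; case: ifP => iD; last by rewrite mul0mx mem0v.
  have i1 : (r + i.+1 < D.+1)%N by [].
  have : B *m w i \in U by apply/UB/IH => //; apply: ltnW.
  rewrite {1}(F1v (B *m w i)) (bigD1 (Ordinal i1)) //= => h.
  rewrite -[X in X \in U](addrK (\sum_(j < D.+1 | j != Ordinal i1) F j *m (B *m w i))) memvB //.
  apply: memv_suml => j ji; have jD : (j <= D)%N by rewrite -ltnS.
  have [x [k [ki ->]]] := FBw j i jD (ltnW id) ji.
  by rewrite memvZ // IH // (leq_trans ki) // ltnW.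
pose P v := exists c : nat -> C, v = \sum_(i < d.+1) c i *: w i.
have P0 : P 0 by exists (fun=> 0); rewrite big1 // => i _; rewrite scale0r.
have PD x y : P x -> P y -> P (x + y).
  move=> [c ->] [c' ->]; exists (fun i => c i + c' i); rewrite -big_split.
  by apply: eq_bigr => i _; rewrite scalerDl.
have PZ k x : P x -> P (k *: x).
  move=> [c ->]; exists (fun i => k * c i); rewrite scaler_sumr.
  by apply: eq_bigr => i _; rewrite scalerA.
have Pw i : (i <= d.+1)%N -> P (w i).
  rewrite leq_eqVlt => /predU1P [->|id]; first by rewrite wd.
  exists (fun k => (k == i)%:R); rewrite (bigD1 (Ordinal id)) //= eqxx scale1r big1 ?addr0 // => k ki.
  by rewrite -[k == i :> nat]/(k == Ordinal id) (negPf ki) scale0r.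
have Psum (I : Type) (s : seq I) (f : I -> V) : (forall i, P (f i)) -> P (\sum_(i <- s) f i).
  by move=> Pf; elim/big_rec: _ => // i x _; apply: (PD).
have [U UP] := vspace_of_closed P0 PD PZ.
have FU i v : (i <= D)%N -> v \in U -> F i *m v \in U.
  move=> iD /UP [c ->]; apply/UP; rewrite mulmx_sumr; apply: (Psum) => k.
  have kd : (k <= d)%N by rewrite -ltnS.
  rewrite -scalemxAr -(wF k) ?riD // mulmxA FF ?riD //; apply: (PZ).
  by case: eqP => [->|_]; rewrite ?mul0mx // wF ?riD //; apply: (Pw); apply: leqW.
have BU v : v \in U -> B *m v \in U.
  move=> /UP [c ->]; apply/UP; rewrite mulmx_sumr; apply: (Psum) => k.
  have kd : (k <= d)%N by rewrite -ltnS.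
  rewrite -scalemxAr (F1v (B *m w k)); apply/PZ/Psum => j.
  have jD : (j <= D)%N by rewrite -ltnS.
  have [e|ne] := eqVneq (j : nat) (r + k.+1)%N.
    rewrite e (_ : F _ *m _ = w k.+1); first exact: (Pw).
    by rewrite wS /G -e jD.
  have [x [l [lk ->]]] := FBw j k jD kd ne; apply/PZ/Pw.
  by apply: leqW; apply: leq_trans kd.
have UW : (U <= W)%VS by apply/subvP => v /UP [c ->]; apply: memv_suml => k _; rewrite memvZ.
have UE : U = W.
  case: (Wirr UW FU BU) => // U0; have : w 0 \in U by apply/UP/Pw.
  by rewrite U0 memv0 (negPf (w_neq0 0%N (leq0n _))).
have Fw j i : (j <= D)%N -> (i <= d)%N -> j != (r + i)%N -> F j *m w i = 0.
  by move=> jD id ne; rewrite -(wF i) ?riD // mulmxA FF ?riD // (negPf ne) mul0mx.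
pose b := [tuple w i | i < d.+1].
have bE (i : 'I_d.+1) : b`_i = w i by rewrite -tnth_nth tnth_mktuple.
have bb : basis_of W b.
  rewrite basisEfree size_tuple; apply/and3P; split.
  - apply/freeP => c c0 i; have id : (i <= d)%N by rewrite -ltnS.
    have := congr1 (mulmx (F (r + i)%N)) c0; rewrite mulmx0 mulmx_sumr (bigD1 i) //= big1 => [|k ki].
      by rewrite addr0 bE -scalemxAr wF ?riD // => /eqP; rewrite scaler_eq0 (negPf (w_neq0 _ id)) orbF => /eqP.
    by rewrite bE -scalemxAr Fw ?scaler0 ?riD // -1?ltnS // eqn_add2l eq_sym.
  - by apply/span_subvP => x /mapP [i _ ->].
  have Ub : (U <= <<b>>)%VS.
    apply/subvP => v /UP [c ->]; apply: memv_suml => i _; rewrite memvZ // memv_span //.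
    by rewrite -bE mem_nth // size_tuple.
  by have := leq_trans (dimvS Ub) (dim_span b); rewrite size_tuple UE.
exists r, d, w; split.
- by split=> //; exact: size_basis bb.
- by move=> i id; rewrite wF ?riD ?w_neq0 ?wW.
- by move=> i id; rewrite wS /G riD.
- move=> j v jD; rewrite -UE => /UP [c ->]; apply: contraR => jr; apply/eqP; rewrite mulmx_sumr big1 // => i _.
  rewrite -scalemxAr Fw ?scaler0 //; first by rewrite -ltnS.
  by move: jr (ltn_ord i); lia.
move=> U' w0U' U'B; rewrite -UE; apply/subvP => v /UP [c ->]; apply: memv_suml => i _.
by rewrite memvZ // cyc // -ltnS.
Qed.

End Chain.

Section ThinModule.
Variables (C : fieldType) (n D : nat).
Local Notation V := 'cV[C]_n.

Definition spectral (A : 'M[C]_n) (E : nat -> 'M[C]_n) (th : nat -> C) : Prop :=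
  [/\ forall i j, (i <= D)%N -> (j <= D)%N -> E i *m E j = if i == j then E i else 0,
      \sum_(i < D.+1) E i = 1%:M,
      A = \sum_(i < D.+1) th i *: E i
    & forall i j, (i <= D)%N -> (j <= D)%N -> th i = th j -> i = j].

Lemma spectral_mulr A E th i : spectral A E th -> (i <= D)%N -> A *m E i = th i *: E i.
Proof.
move=> [EE _ -> _] id; have id' : (i < D.+1)%N by [].
rewrite mulmx_suml (bigD1 (Ordinal id')) //= big1 ?addr0 => [|j ji].
  by rewrite -scalemxAl EE // eqxx.
by rewrite -scalemxAl EE // -1?ltnS // ifN ?scaler0 //; apply: contra ji => /eqP e; apply/eqP/val_inj.
Qed.

Lemma spectral_mull A E th i : spectral A E th -> (i <= D)%N -> E i *m A = th i *: E i.
Proof.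
move=> [EE _ -> _] id; have id' : (i < D.+1)%N by [].
rewrite mulmx_sumr (bigD1 (Ordinal id')) //= big1 ?addr0 => [|j ji].
  by rewrite -scalemxAr EE // eqxx.
by rewrite -scalemxAr EE // -1?ltnS // ifN ?scaler0 //; apply: contra ji => /eqP e; apply/eqP/val_inj.
Qed.

Definition tridiagonal_for (E : nat -> 'M[C]_n) (B : 'M[C]_n) : Prop :=
  forall i j, (i <= D)%N -> (j <= D)%N -> (i.+1 < j)%N || (j.+1 < i)%N -> E i *m B *m E j = 0.

Variables (A As : 'M[C]_n) (E Es : nat -> 'M[C]_n) (th ths : nat -> C).
Hypotheses (AE : spectral A E th) (AsEs : spectral As Es ths).
Hypotheses (EAsE : tridiagonal_for E As) (EsAEs : tridiagonal_for Es A).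

Lemma sum_support (F : nat -> 'M[C]_n) (v : V) r d :
  \sum_(j < D.+1) F j = 1%:M -> (r + d <= D)%N ->
  (forall j, (j <= D)%N -> F j *m v != 0 -> (r <= j <= r + d)%N) ->
  v = \sum_(i < d.+1) F (r + i) *m v.
Proof.
move=> F1 rd supp; rewrite -[v in LHS]mul1mx -F1 mulmx_suml.
rewrite -!(big_mkord xpredT (fun i => F i *m v)) -(big_mkord xpredT (fun i => F (r + i) *m v)).
have z j : (j <= D)%N -> ~~ (r <= j <= r + d)%N -> F j *m v = 0.
  by move=> jD; apply: contraNeq; apply: supp.
have rD : (r <= D.+1)%N by lia.
have rdD : (r + d.+1 <= D.+1)%N by lia.
rewrite (big_cat_nat (n := r)) //= (big_cat_nat (n := (r + d.+1)%N) (m := r)) ?leq_addr //=.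
rewrite big_nat_cond big1 => [|j /andP [/andP [_ jr] _]]; last by apply: z; lia.
rewrite [X in _ + (_ + X)]big_nat_cond [X in _ + (_ + X)]big1 => [|j /andP [/andP [rj jD] _]]; last by apply: z; lia.
rewrite add0r addr0 -{1}[r]add0n [(r + _)%N]addnC big_addn addnK.
by apply: eq_bigr => j _; rewrite addnC.
Qed.

(** Thinness is given for [Es] only. As [w 0] generates [W] under [A] and [E i *m A] is a multiple
    of [E i], each E_i W is spanned by E_i w_0. So a chain exists for [E] and [As] as well, and
    counting dimensions gives it the same length. *)
Theorem thin_irreducible_leonard (W : {vspace V}) :
  W != 0%VS ->
  (forall i v, (i <= D)%N -> v \in W -> E i *m v \in W) ->
  (forall i v, (i <= D)%N -> v \in W -> Es i *m v \in W) ->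
  (forall U : {vspace V}, (U <= W)%VS ->
    (forall i v, (i <= D)%N -> v \in U -> E i *m v \in U) ->
    (forall i v, (i <= D)%N -> v \in U -> Es i *m v \in U) -> U = 0%VS \/ U = W) ->
  (forall i u v, (i <= D)%N -> u \in W -> v \in W -> Es i *m u != 0 ->
    exists k, Es i *m v = k *: (Es i *m u)) ->
  exists r t d w,
    [/\ (r + d <= D)%N, (t + d <= D)%N,
       (forall j v, (j <= D)%N -> v \in W -> Es j *m v != 0 -> (r <= j <= r + d)%N),
       (forall j v, (j <= D)%N -> v \in W -> E j *m v != 0 -> (t <= j <= t + d)%N)
     & leonard_system d W A As (fun k => E (t + d - k)%N) (fun i => Es (r + i)%N)
        (fun k => th (t + d - k)%N) (fun i => ths (r + i)%N) w].
Proof.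
move=> W0 WE WEs Wirr Wthin.
have [EE E1 AD thI] := AE; have [EsEs Es1 AsD thsI] := AsEs.
have WA v : v \in W -> A *m v \in W.
  by move=> vW; rewrite AD mulmx_suml; apply: memv_suml => i _; rewrite -scalemxAl memvZ // WE // -ltnS.
have WAs v : v \in W -> As *m v \in W.
  by move=> vW; rewrite AsD mulmx_suml; apply: memv_suml => i _; rewrite -scalemxAl memvZ // WEs // -ltnS.
have EU (U : {vspace V}) : (forall v, v \in U -> A *m v \in U) -> forall i v, (i <= D)%N -> v \in U -> E i *m v \in U.
  by move=> UA; apply: (spectral_stable E1 _ thI UA) => i id; exact: spectral_mulr AE id.
have EsU (U : {vspace V}) : (forall v, v \in U -> As *m v \in U) -> forall i v, (i <= D)%N -> v \in U -> Es i *m v \in U.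
  by move=> UA; apply: (spectral_stable Es1 _ thsI UA) => i id; exact: spectral_mulr AsEs id.
have [r [d [w [[rd dimW] wP wS suppEs cyc]]]] : exists r d w, is_chain D W A Es r d w.
  by apply: chain_exists => // U UW h1 h2; apply: Wirr => //; apply: EU.
have w0W : w 0 \in W by have [] := wP 0%N (leq0n d).
have thinE i v : (i <= D)%N -> v \in W -> exists k, E i *m v = k *: (E i *m w 0).
  move=> iD vW.
  have P0 : exists k, E i *m 0 = k *: (E i *m w 0) by exists 0; rewrite mulmx0 scale0r.
  have PD x y : (exists k, E i *m x = k *: (E i *m w 0)) -> (exists k, E i *m y = k *: (E i *m w 0)) ->
     exists k, E i *m (x + y) = k *: (E i *m w 0).
    by move=> [k kE] [l lE]; exists (k + l); rewrite mulmxDr kE lE scalerDl.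
  have PZ c x : (exists k, E i *m x = k *: (E i *m w 0)) -> exists k, E i *m (c *: x) = k *: (E i *m w 0).
    by move=> [k kE]; exists (c * k); rewrite -scalemxAr kE scalerA.
  have [U UP] := vspace_of_closed P0 PD PZ.
  apply/UP/(subvP (cyc U _ _)) => //.
    by apply/UP; exists 1; rewrite scale1r.
  move=> x /UP [k kE]; apply/UP; exists (th i * k).
  by rewrite mulmxA (spectral_mull AE) // -scalemxAl kE scalerA.
have [t [d' [z [[td dimW'] zP _ suppE _]]]] : exists t d z, is_chain D W As E t d z.
  apply: chain_exists => //.
    by move=> U UW h1 h2; apply: Wirr => //; apply: EsU.
  move=> i x y iD xW yW; have [k ->] := thinE i x iD xW; have [l ->] := thinE i y iD yW.
  move=> h; have k0 : k != 0 by apply: contraNneq h => ->; rewrite scale0r.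
  by exists (l / k); rewrite scalerA divfK.
have d'E : d' = d by move: dimW'; rewrite dimW => -[].
rewrite d'E in td zP suppE.
have E_w0 k : (k <= d)%N -> E (t + k)%N *m w 0 != 0.
  move=> kd; have [zW zE z0] := zP k kd; have tk : (t + k <= D)%N by lia.
  have [c] := thinE _ _ tk zW; rewrite zE => zc.
  by apply: contraNneq z0 => e; rewrite zc e scaler0.
have rD i : (i <= d)%N -> (r + i <= D)%N by lia.
have tD i : (t + d - i <= D)%N by lia.
exists r, t, d, w; split=> //; split=> //.
- by move=> i v _ vW; apply: WE.
- by move=> i v id vW; apply: WEs => //; apply: rD.
- by move=> i v id vW; rewrite mulmxA (spectral_mull AE) // -scalemxAl.
- by move=> i v id vW; rewrite mulmxA (spectral_mull AsEs) ?rD // -scalemxAl.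
- move=> i j id jd; rewrite EE //; congr (if _ then _ else _).
  by apply/eqP/eqP => [|->]; lia.
- by move=> i j id jd; rewrite EsEs ?rD // eqn_add2l.
- move=> v vW; rewrite {1}(sum_support E1 td (fun j jD => suppE j v jD vW)).
  rewrite (reindex_inj rev_ord_inj); apply: eq_bigr => i _; rewrite /= subSS.
  by congr (E _ *m _); have := ltn_ord i; lia.
- by move=> v vW; apply: sum_support Es1 rd (fun j jD => suppEs j v jD vW).
- move=> i j v vW id jd ij; rewrite !mulmxA EAsE ?mul0mx //; move: ij; lia.
- move=> i j v vW id jd ij; rewrite !mulmxA EsAEs ?mul0mx ?rD //; move: ij; lia.
- by move=> i j id jd /thI h; have := h (tD i) (tD j); lia.
- by move=> i j id jd /thsI h; have := h (rD i id) (rD j jd); lia.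
- by have [_] := wP 0%N (leq0n d).
- by move=> i id; have [] := wP i id.
- move=> i v id vW; have [wW wE wn0] := wP i id.
  by have := Wthin (r + i)%N (w i) v (rD i id) wW vW; rewrite wE; apply.
- by move=> i id; rewrite (_ : t + d - i = t + (d - i))%N ?E_w0 ?leq_subr //; lia.
- by move=> U UW UA UAs; apply: Wirr => //; [exact: EU|exact: EsU].
Qed.

End ThinModule.

(** * Distance-regular graphs *)

Section Distance.
Variables (X : finType) (e : rel X).
Hypothesis esym : symmetric e.
Hypothesis econn : forall y z, connect e y z.

Lemma walkP k y z : reflect (exists p, [/\ size p = k, path e y p & last y p = z]) (walk e k y z).
Proof.
apply: (iffP existsP) => [[p /andP [ep /eqP pz]]|[p [sp ep pz]]].
  by exists p; rewrite size_tuple.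
by move/eqP: sp => sp; exists (Tuple sp); rewrite /= ep pz eqxx.
Qed.

Lemma gdist_le k y z : walk e k y z -> (gdist e y z <= k)%N.
Proof.
move=> w; have [kX|Xk] := ltnP k #|X|.
  rewrite leqNgt; apply/negP => lt; have := before_find 0%N lt.
  by rewrite nth_iota // add0n w.
by apply: leq_trans Xk; rewrite -[X in (_ <= X)%N](size_iota 0); apply: find_size.
Qed.

(** A path without repeated vertices has fewer than #|X| edges, so the search defining [gdist]
    succeeds. *)
Lemma walk_gdist y z : walk e (gdist e y z) y z.
Proof.
have h : has (fun k => walk e k y z) (iota 0 #|X|).
  have /connectP [p ep ->] := econn y z.
  case/shortenP: ep => p' ep' up' _; apply/hasP; exists (size p').
    by rewrite mem_iota add0n /= -ltnS -[(size p').+1]/(size (y :: p')) -(card_uniqP up') ltnS max_card.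
  by apply/walkP; exists p'.
have := nth_find 0%N h; rewrite nth_iota ?add0n //.
by rewrite -[X in (_ < X)%N](size_iota 0) -has_find.
Qed.

Lemma gdist_triangle y w z : (gdist e y z <= gdist e y w + gdist e w z)%N.
Proof.
apply: gdist_le; apply/walkP.
have /walkP [p [sp ep pw]] := walk_gdist y w; have /walkP [r [sr er rz]] := walk_gdist w z.
by exists (p ++ r); rewrite size_cat sp sr cat_path ep pw er last_cat pw rz.
Qed.

Lemma gdist_sym y z : gdist e y z = gdist e z y.
Proof.
suff h y' z' : (gdist e y' z' <= gdist e z' y')%N by apply/eqP; rewrite eqn_leq !h.
apply: gdist_le; have /walkP [p [sp ep pz]] := walk_gdist z' y'.
apply/walkP; exists (rev (belast z' p)); rewrite size_rev size_belast sp -pz rev_path; split=> //.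
  by rewrite (eq_path (e' := e)) // => a b; rewrite esym.
by case: p {sp ep pz} => //= a p; rewrite rev_cons last_rcons.
Qed.

Lemma gdist_eq0 y z : (gdist e y z == 0) = (y == z).
Proof.
apply/eqP/eqP => [h|->]; last first.
  by apply/eqP; rewrite -leqn0; apply: gdist_le; apply/walkP; exists [::].
have /walkP [p [sp _]] := walk_gdist y z.
by rewrite h in sp; case: p sp.
Qed.

Lemma gdist_next y z k : gdist e y z = k.+1 -> exists2 w, gdist e y w = 1%N & gdist e w z = k.
Proof.
move=> yz; have /walkP [p] := walk_gdist y z; rewrite yz; case: p => [|w p] [] //= [sp] /andP [yw ep] pz.
have h1 : (gdist e y w <= 1)%N by apply: gdist_le; apply/walkP; exists [:: w]; rewrite /= yw.
have h2 : (gdist e w z <= k)%N by apply: gdist_le; apply/walkP; exists p.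
by have := gdist_triangle y w z; rewrite yz => h3; exists w; lia.
Qed.

Lemma gdist_diameter y z : (gdist e y z <= diameter e)%N.
Proof.
apply: leq_trans (leq_bigmax_cond (F := fun y => \max_(z : X) gdist e y z) y isT).
exact: (leq_bigmax_cond (F := fun z => gdist e y z) z isT).
Qed.

End Distance.

(** * The Bose-Mesner algebra *)

Section BoseMesner.
Variables (C : numClosedFieldType) (X : finType) (e : rel X) (D : nat).
Hypothesis DR : distance_regular e.
Hypothesis diamD : diameter e = D.
Local Notation mxX := 'M[C]_#|X|.
Local Notation Ad := (distmx C e).
Local Notation BM := (bose_mesner C e D).

Let e_sym : symmetric e. Proof. by case: DR. Qed.
Let econn : forall y z, connect e y z. Proof. by case: DR. Qed.
Local Notation dist := (gdist e).

Lemma dist_le y z : (dist y z <= D)%N.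
Proof. by rewrite -diamD gdist_diameter. Qed.

Lemma distmx_mem k : (k <= D)%N -> Ad k \in BM.
Proof.
move=> kD; have kD' : (k < D.+1)%N by [].
by apply: memv_span; apply/mapP; exists (Ordinal kD'); rewrite ?mem_enum.
Qed.

Lemma bose_mesner_ind (P : mxX -> Prop) :
  P 0 -> (forall A B, P A -> P B -> P (A + B)) -> (forall k A, P A -> P (k *: A)) ->
  (forall k, (k <= D)%N -> P (Ad k)) -> forall B, B \in BM -> P B.
Proof.
move=> P0 PD PZ PA B BB; have [U UP] := vspace_of_closed P0 PD PZ.
apply/UP; apply: (subvP _ _ BB); apply/span_subvP => _ /mapP [k _ ->].
by apply/UP/PA; rewrite -ltnS.
Qed.

Lemma distmx_tr k : (Ad k)^T = Ad k.
Proof. by apply/matrixP => y z; rewrite !mxE gdist_sym. Qed.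

Lemma bose_mesner_tr B : B \in BM -> B^T = B.
Proof.
move: B; apply: bose_mesner_ind => [|A B hA hB|k A hA|k _]; first exact: trmx0.
- by rewrite raddfD /= hA hB.
- by rewrite linearZ /= hA.
- exact: distmx_tr.
Qed.

Lemma bose_mesner_adj B : B \in BM -> adjm B \in BM.
Proof.
move: B; apply: bose_mesner_ind => [|A B hA hB|k A hA|k kD].
- by rewrite (_ : adjm 0 = 0) ?mem0v //; apply/matrixP => i j; rewrite !mxE conjC0.
- by rewrite (_ : adjm (A + B) = adjm A + adjm B) ?memvD //; apply/matrixP => i j; rewrite !mxE rmorphD.
- by rewrite (_ : adjm (k *: A) = k^* *: adjm A) ?memvZ //; apply/matrixP => i j; rewrite !mxE rmorphM.
rewrite (_ : adjm (Ad k) = Ad k) ?distmx_mem // /adjm distmx_tr.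
by apply/matrixP => i j; rewrite !mxE conjC_nat.
Qed.

Lemma bose_mesner_entry B : B \in BM ->
  exists c : nat -> C, forall y z, B y z = c (dist (enum_val y) (enum_val z)).
Proof.
move: B; apply: bose_mesner_ind => [|A B [c hA] [c' hB]|k A [c hA]|k kD].
- by exists (fun=> 0) => y z; rewrite mxE.
- by exists (fun i => c i + c' i) => y z; rewrite mxE hA hB.
- by exists (fun i => k * c i) => y z; rewrite mxE hA.
- by exists (fun i => (i == k)%:R) => y z; rewrite mxE.
Qed.

(** The coefficients are intersection numbers. The last clause lets [Ad k.+1] be recovered from
    [Ad k] and [Ad k.-1] also past the diameter. *)
Lemma distmx_recur k : exists (c a b : C),
  adjmx C e *m Ad k = c *: Ad k.+1 + a *: Ad k + b *: (if k is k'.+1 then Ad k' else 0)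
  /\ (c = 0 -> Ad k.+1 = 0).
Proof.
pose cnt y z := #|[set w | (dist y w == 1%N) && (dist w z == k)]|.
have cntE y z y' z' : dist y z = dist y' z' -> cnt y z = cnt y' z'.
  by case: DR => _ _ _ h /h; apply.
pose g h : C := if [pick p : X * X | dist p.1 p.2 == h] is Some p then (cnt p.1 p.2)%:R else 0.
have gE y z : g (dist y z) = (cnt y z)%:R.
  rewrite /g; case: pickP => [[y' z'] /= /eqP h|/(_ (y, z))]; first by rewrite (cntE _ _ _ _ h).
  by rewrite /= eqxx.
have prodE i j : (adjmx C e *m Ad k) i j = (cnt (enum_val i) (enum_val j))%:R.
  rewrite mxE /cnt -sum1_card natr_sum (reindex (@enum_val X xpredT)) /=; last first.
    by apply: onW_bij; apply: enum_val_bij.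
  rewrite [RHS]big_mkcond /=; apply: eq_bigr => l _; rewrite !mxE inE.
  by case: eqP; case: eqP => _ _; rewrite ?(mulr0, mul0r, mulr1).
exists (g k.+1), (g k), (if k is k'.+1 then g k' else 0); split; last first.
  move=> gk; apply/matrixP => i j; rewrite !mxE; case: eqP => // ij; move: gk; rewrite -ij gE.
  move/eqP; rewrite pnatr_eq0 /cnt cards_eq0 => /eqP/setP h.
  have [w w1 w2] := gdist_next econn ij.
  by have := h w; rewrite !inE w1 w2 !eqxx.
apply/matrixP => i j; rewrite prodE !mxE -gE; set h := dist _ _.
have gz : (h < k.-1)%N || (k.+1 < h)%N -> g h = 0.
  move=> hk; rewrite gE; apply/eqP; rewrite pnatr_eq0 cards_eq0; apply/eqP/setP => w.
  rewrite !inE; apply/negP => /andP [/eqP w1 /eqP w2].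
  have := gdist_triangle econn (enum_val i) w (enum_val j).
  have := gdist_triangle econn w (enum_val i) (enum_val j).
  rewrite (gdist_sym e_sym econn w (enum_val i)) w1 w2 -/h; move: hk; lia.
case: k @cnt cntE @g gE prodE gz => [|k] cnt cntE g gE prodE gz.
  rewrite mxE mulr0 addr0; have [h0|h0] := eqVneq h 0%N; first by rewrite h0 mulr0 add0r mulr1.
  have [h1|h1] := eqVneq h 1%N; first by rewrite h1 mulr1 mulr0 addr0.
  by rewrite !mulr0 addr0 gz //; lia.
rewrite mxE -/h; have [h0|h0] := eqVneq h k.
  by rewrite h0 !ltn_eqF // !mulr0 !add0r mulr1.
have [h1|h1] := eqVneq h k.+1; first by rewrite h1 ltn_eqF // mulr0 add0r mulr1 mulr0 addr0.
have [h2|h2] := eqVneq h k.+2; first by rewrite h2 mulr1 !mulr0 !addr0.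
by rewrite !mulr0 !addr0 gz //; lia.
Qed.

Section Idempotents.
Variable E : 'I_D.+1 -> mxX.
Hypothesis PI : primitive_idempotents e E.

Lemma idem_mem i : E i \in BM.
Proof. by case: PI => /basis_mem h _ _; apply: h; apply: map_f; rewrite mem_enum. Qed.

Lemma idem_neq0 i : E i != 0.
Proof.
case: PI => /basis_free/free_not0 h _ _; apply: contraTneq isT => E0.
by have := h 0; rewrite -E0 map_f ?mem_enum // E0 eqxx => /(_ isT).
Qed.

Lemma idem_mul i j : E i *m E j = if i == j then E i else 0.
Proof. by case: PI. Qed.

Lemma idem_sum : \sum_i E i = 1%:M. Proof. by case: PI. Qed.

Lemma bose_mesner_scalar B i : B \in BM -> exists c, E i *m B = c *: E i.
Proof.
case: PI => bE _ _; rewrite -(span_basis bE) => BB.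
have P0 : exists c, E i *m 0 = c *: E i by exists 0; rewrite mulmx0 scale0r.
have PD x y : (exists c, E i *m x = c *: E i) -> (exists c, E i *m y = c *: E i) -> exists c, E i *m (x + y) = c *: E i.
  by move=> [c hc] [c' hc']; exists (c + c'); rewrite mulmxDr hc hc' scalerDl.
have PZ k x : (exists c, E i *m x = c *: E i) -> exists c, E i *m (k *: x) = c *: E i.
  by move=> [c hc]; exists (k * c); rewrite -scalemxAr hc scalerA.
have [U UP] := vspace_of_closed P0 PD PZ; apply/UP; apply: (subvP _ _ BB).
apply/span_subvP => _ /mapP [k _ ->]; apply/UP; rewrite idem_mul; case: eqP => _.
  by exists 1; rewrite scale1r.
by exists 0; rewrite scale0r.
Qed.

Lemma bose_mesner_idem_ind (P : mxX -> Prop) :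
  P 0 -> (forall A B, P A -> P B -> P (A + B)) -> (forall k A, P A -> P (k *: A)) ->
  (forall k, P (E k)) -> forall B, B \in BM -> P B.
Proof.
move=> P0 PD PZ PA B; case: PI => bE _ _; rewrite -(span_basis bE) => BB.
have [U UP] := vspace_of_closed P0 PD PZ.
by apply/UP; apply: (subvP _ _ BB); apply/span_subvP => _ /mapP [k _ ->]; apply/UP.
Qed.

(** The algebra is closed under adjoints, so E_i times its adjoint is a multiple of E_i, nonzero by
    positivity. Taking adjoints makes the adjoint of E_i a multiple of E_i, and idempotency forces
    the factor 1. *)
Lemma idem_adj i : adjm (E i) = E i.
Proof.
have [c cE] := bose_mesner_scalar i (bose_mesner_adj (idem_mem i)).
have c0 : c != 0.
  apply: contraNneq (idem_neq0 i) => c0; apply/eqP/dotm0.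
  by rewrite /dotm cE c0 scale0r mxtrace0.
have EE : E i = c^-1 *: (E i *m adjm (E i)) by rewrite cE scalerK.
have adjE : adjm (E i) = (c^-1)^* *: (c *: E i).
  rewrite {1}EE -cE; have -> : forall k (A : mxX), adjm (k *: A) = k^* *: adjm A.
    by move=> k A; apply/matrixP => y z; rewrite !mxE rmorphM.
  by rewrite adjmM adjmK.
set s := (c^-1)^* * c; rewrite scalerA -/s in adjE.
have s0 : s != 0 by rewrite mulf_neq0 // conjC_eq0 invr_eq0.
have : adjm (E i *m E i) = s *: (s *: E i).
  by rewrite adjmM adjE -scalemxAr -scalemxAl idem_mul eqxx.
rewrite idem_mul eqxx adjE => /(scalerI s0) => h.
have : (1 - s) *: E i = 0 by rewrite scalerBl scale1r -h subrr.
move/eqP; rewrite scaler_eq0 (negPf (idem_neq0 i)) orbF subr_eq0 => /eqP <-.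
by rewrite scale1r.
Qed.

Lemma idem_tr i : (E i)^T = E i. Proof. exact: bose_mesner_tr (idem_mem i). Qed.

Lemma idem_real i y z : (E i y z)^* = E i y z.
Proof. by have /matrixP/(_ y z) := idem_adj i; rewrite mxE idem_tr. Qed.

Section Eigenvalues.
Variable th : 'I_D.+1 -> C.
Hypothesis thE : eigenvalue_sequence e E th.

Lemma adjmx_idem i : adjmx C e *m E i = th i *: E i.
Proof.
rewrite thE mulmx_suml (bigD1 i) //= big1 ?addr0 => [|j ji].
  by rewrite -scalemxAl idem_mul eqxx.
by rewrite -scalemxAl idem_mul (negPf ji) scaler0.
Qed.

(** The recurrence makes every distance matrix a polynomial in [A]. With equal eigenvalues each
    element of the algebra would act by one scalar on E_i and E_j, which E_i itself does not. *)
Lemma eigenvalue_inj : injective th.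
Proof.
move=> i j thij; apply/eqP; apply: contraT => ij.
pose P (B : mxX) := exists s, B *m E i = s *: E i /\ B *m E j = s *: E j.
have P0 : P 0 by exists 0; rewrite !mul0mx !scale0r.
have PD A B : P A -> P B -> P (A + B).
  by move=> [s [h1 h2]] [s' [h3 h4]]; exists (s + s'); rewrite !mulmxDl h1 h2 h3 h4 !scalerDl.
have PZ k A : P A -> P (k *: A).
  by move=> [s [h1 h2]]; exists (k * s); rewrite -!scalemxAl h1 h2 !scalerA.
have PM A : P A -> P (adjmx C e *m A).
  move=> [s [h1 h2]]; exists (s * th i).
  by rewrite -!mulmxA h1 h2 -!scalemxAr !adjmx_idem thij !scalerA.
have PA k : P (Ad k) /\ P (Ad k.+1).
  elim: k => [|k [IH1 IH2]].
    split; last by exists (th i); rewrite [Ad 1]/(adjmx C e) !adjmx_idem thij.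
    have -> : Ad 0 = 1%:M.
      by apply/matrixP => y z; rewrite !mxE gdist_eq0 // (inj_eq enum_val_inj).
    by exists 1; rewrite !mul1mx !scale1r.
  split=> //; have [c [a [b [h cz]]]] := distmx_recur k.+1.
  have [c0|c0] := eqVneq c 0; first by rewrite cz.
  have -> : Ad k.+2 = c^-1 *: (adjmx C e *m Ad k.+1 + (-1) *: (a *: Ad k.+1 + b *: Ad k)).
    by rewrite h scaleN1r -[X in X - _]addrA addrK scalerK.
  by apply/PZ/PD; [apply: PM|apply/PZ/PD; apply: PZ].
have [s [h1 h2]] : P (E i) by apply: bose_mesner_ind (idem_mem i) => // k _; have [] := PA k.
move: h2; rewrite idem_mul (negPf ij) => /esym/eqP; rewrite scaler_eq0 (negPf (idem_neq0 j)) orbF.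
by move=> /eqP s0; move: h1 (idem_neq0 i); rewrite s0 idem_mul eqxx scale0r => ->; rewrite eqxx.
Qed.

End Eigenvalues.
End Idempotents.
End BoseMesner.

(** * Dual idempotents and the consequences of the Krein conditions *)

Section DualSide.
Variables (C : numClosedFieldType) (X : finType) (e : rel X) (D : nat) (x : X).
Hypothesis DR : distance_regular e.
Hypothesis diamD : diameter e = D.
Local Notation mxX := 'M[C]_#|X|.
Local Notation dist := (gdist e).
Local Notation Es := (dual_idempotent C e x).

Let e_sym : symmetric e. Proof. by case: DR. Qed.
Let econn : forall y z, connect e y z. Proof. by case: DR. Qed.

Lemma dual_idempotentE i (B : mxX) y z : (Es i *m B) y z = (dist x (enum_val y) == i)%:R * B y z.
Proof. by rewrite mul_diag_mx !mxE. Qed.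

Lemma dual_idempotentEr i (B : mxX) y z : (B *m Es i) y z = B y z * (dist x (enum_val z) == i)%:R.
Proof. by rewrite mul_mx_diag !mxE. Qed.

Lemma dual_idempotent_mul i j : Es i *m Es j = if i == j then Es i else 0.
Proof.
apply/matrixP => y z; rewrite dual_idempotentE !mxE; have [->|ij] := eqVneq i j.
  by rewrite !mxE; case: (y == z); case: eqP => _; rewrite ?(mulr1, mulr0, mul0r).
rewrite mxE; have [->|ne] := eqVneq y z; last by rewrite mulr0n mulr0.
by have [->|] := eqVneq (dist x (enum_val z)) i; rewrite ?mul0r // mul1r (negPf ij).
Qed.

Lemma dual_idempotent_sum : \sum_(i < D.+1) Es i = 1%:M.
Proof.
apply/matrixP => y z; rewrite summxE.
have dD : (dist x (enum_val y) < D.+1)%N by rewrite ltnS dist_le.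
rewrite (bigD1 (Ordinal dD)) //= big1 ?addr0 => [|i ni].
  by rewrite !mxE; have [->|] := eqVneq y z; rewrite ?eqxx.
rewrite !mxE; have [ne|] := eqVneq y z; last by rewrite mulr0n.
by rewrite mulr1n (_ : (_ == _) = false) //; apply: contraNF ni => /eqP h; apply/eqP/val_inj.
Qed.

Lemma dual_idempotent_adj i : adjm (Es i) = Es i.
Proof.
apply/matrixP => y z; rewrite !mxE; have [->|ne] := eqVneq z y; first by rewrite ?eqxx !mulr1n conjC_nat.
by rewrite ?[y == z]eq_sym ?(negPf ne) !mulr0n conjC0.
Qed.

Lemma dual_tridiagonal i j : (i.+1 < j)%N || (j.+1 < i)%N -> Es i *m adjmx C e *m Es j = 0.
Proof.
move=> ij; apply/matrixP => y z; rewrite dual_idempotentEr dual_idempotentE !mxE.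
have [h1|] := eqVneq (dist x (enum_val y)) i; last by rewrite !mul0r.
have [h2|] := eqVneq (dist x (enum_val z)) j; last by rewrite mulr0.
have [h3|] := eqVneq (dist (enum_val y) (enum_val z)) 1%N; last by rewrite mulr0 mul0r.
have := gdist_triangle econn x (enum_val y) (enum_val z).
have := gdist_triangle econn x (enum_val z) (enum_val y).
rewrite (gdist_sym e_sym econn (enum_val z) (enum_val y)) h1 h2 h3; move: ij; lia.
Qed.

(** A geodesic of length D contains a pair at distance k, and by regularity the number of vertices
    at distance k is the same from every vertex. *)
Lemma dist_attained k : (k <= D)%N -> exists y, dist x y = k.
Proof.
move=> kD; have [z [y yz]] : exists z y, dist y z = D.
  have X0 : (0 < #|X|)%N by apply/card_gt0P; exists x.
  have [y yE] := @bigop.eq_bigmax X (fun y : X => \max_(z : X) dist y z) X0.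
  have [z zE] := @bigop.eq_bigmax X (fun z : X => dist y z) X0.
  by exists z, y; rewrite -zE -yE -diamD.
have [w wk] : exists w, dist w z = k.
  have h m : (m + k = D)%N -> exists w, dist w z = (m + k)%N by move=> ->; exists y.
  suff : forall m, (m + k <= D)%N -> exists w, dist w z = (D - m)%N.
    by move=> /(_ (D - k)%N); rewrite subnK // subKn //; apply.
  elim=> [_|m IH mk]; first by exists y; rewrite subn0.
  have [|w wz] := IH; first by apply: leq_trans mk; rewrite leq_add2r.
  have [|w' _ w'z] := @gdist_next _ _ econn w z (D - m.+1).
    by rewrite wz; move: mk; lia.
  by exists w'.
have [_ _ _ DRc] := DR.
have /= := DRc k k z z x x; rewrite (eqP (_ : dist z z == 0%N)) ?gdist_eq0 //.
rewrite (eqP (_ : dist x x == 0%N)) ?gdist_eq0 // => /(_ erefl) cE.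
have : (0 < #|[set w | (dist x w == k) && (dist w x == k)]|)%N.
  rewrite -cE; apply/card_gt0P; exists w.
  by rewrite inE (gdist_sym e_sym econn z) wk eqxx.
by case/card_gt0P => w'; rewrite inE => /andP [/eqP w'k _]; exists w'.
Qed.

Variable E : 'I_D.+1 -> mxX.
Hypothesis QP : Q_polynomial e E.

Let PI : primitive_idempotents e E. Proof. by case: QP. Qed.

Lemma hadamard_entry p : krein_parameters E p -> forall i j y z,
  E i y z * E j y z = #|X|%:R^-1 * \sum_h p h i j * E h y z.
Proof.
move=> K i j y z; have /matrixP/(_ y z) := K i j; rewrite !mxE => ->.
by rewrite summxE; congr (_ * _); apply: eq_bigr => h _; rewrite mxE.
Qed.

Lemma idem_diag_neq0 j y : E j y y != 0.
Proof.
have [c cE] := bose_mesner_entry (idem_mem PI j).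
have yy z : E j z z = E j y y.
  have d0 v : dist v v = 0%N by apply/eqP; rewrite gdist_eq0.
  by rewrite !cE !d0.
apply: contraTneq (idem_neq0 PI j) => y0; apply/negPn/eqP/(@dotm0 C).
rewrite /dotm (idem_adj DR PI) (idem_mul PI) eqxx /mxtrace big1 // => z _.
by rewrite yy.
Qed.

(** The Krein conditions make the entrywise product with E_0 act on each E_j by a scalar, and the
    diagonal shows the scalar is the same for all j. Testing on distance matrices gives equal
    entries. *)
Lemma idem0_const : exists c, forall y z, E ord0 y z = c.
Proof.
case: QP => _ [p K pQ].
have h j y z : E ord0 y z * E j y z = #|X|%:R^-1 * p j ord0 j * E j y z.
  rewrite (hadamard_entry K) (bigD1 j) //= big1 ?addr0 ?mulrA // => i ij.
  rewrite (proj1 (pQ i ord0 j)) ?mul0r //.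
  by move: ij; rewrite -val_eqE /=; lia.
pose z0 := enum_rank x; exists (E ord0 z0 z0) => y z.
have cj j : #|X|%:R^-1 * p j ord0 j = E ord0 z0 z0.
  by apply: (mulIf (idem_diag_neq0 j z0)); rewrite -h.
have : E ord0 y z * distmx C e (dist (enum_val y) (enum_val z)) y z
   = E ord0 z0 z0 * distmx C e (dist (enum_val y) (enum_val z)) y z.
  move: (distmx C e _) (distmx_mem C e (dist_le diamD (enum_val y) (enum_val z))) => B.
  move: B; apply: (bose_mesner_idem_ind PI) => [|A B hA hB|k A hA|k].
  - by rewrite !mxE !mulr0.
  - by rewrite !mxE !mulrDr hA hB.
  - by rewrite !mxE !(mulrCA _ k) hA.
  - by rewrite h cj.
by rewrite !mxE eqxx !mulr1.
Qed.

Variable ths : 'I_D.+1 -> C.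
Hypothesis thsE : dual_eigenvalue_sequence e x E ths.
Hypothesis D1 : (1 <= D)%N.

Lemma idem1_entry (i : 'I_D.+1) y : dist x (enum_val y) = i -> #|X|%:R * E (inord 1) (enum_rank x) y = ths i.
Proof.
move=> xy; have /matrixP/(_ y y) := thsE; rewrite !mxE eqxx mulr1n => ->.
rewrite summxE (bigD1 i) //= !mxE xy !eqxx mulr1n mulr1 big1 ?addr0 // => k ki.
by rewrite !mxE xy eqxx mulr1n (_ : (i == k :> nat) = false) ?mulr0 //; rewrite eq_sym; exact/negbTE.
Qed.

Let X0 : #|X|%:R != 0 :> C.
Proof. by rewrite pnatr_eq0 -lt0n; apply/card_gt0P; exists x. Qed.

(** Equal dual eigenvalues mean that E_1 has equal entries at (x, y) and (x, z). The Krein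
    recurrence, whose leading coefficient is nonzero, spreads this to all E_k, yet [distmx C e i]
    separates the two entries. *)
Lemma dual_eigenvalue_inj : injective ths.
Proof.
move=> i j thij; apply/eqP; apply: contraT => ij.
have iD : (i <= D)%N by rewrite -ltnS.
have jD : (j <= D)%N by rewrite -ltnS.
have [y yi] := dist_attained iD; have [z zj] := dist_attained jD.
pose a := enum_rank x; pose y' := enum_rank y; pose z' := enum_rank z.
have e1 : E (inord 1) a y' = E (inord 1) a z'.
  apply: (mulfI X0); rewrite (@idem1_entry i) ?enum_rankK // (@idem1_entry j) ?enum_rankK //.
case: QP => _ [p K pQ].
have EP k : forall kD : (k < D.+1)%N, E (Ordinal kD) a y' = E (Ordinal kD) a z'.
  elim/ltn_ind: k => -[|[|k]] IH kD.
  - by have [c cE] := idem0_const; rewrite (_ : Ordinal kD = ord0) ?cE //; apply: val_inj.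
  - by rewrite (_ : Ordinal kD = inord 1) //; apply: val_inj; rewrite /= inordK.
  have kD1 : (k.+1 < D.+1)%N by apply: ltnW.
  pose o := Ordinal kD; pose o1 := Ordinal kD1.
  have i1 : (inord 1 : 'I_D.+1) = 1%N :> nat by rewrite inordK.
  have po : p o (inord 1) o1 != 0 by apply: (proj2 (pQ _ _ _)); rewrite i1 /=; lia.
  have hE b : p o (inord 1) o1 * E o a b = #|X|%:R * (E (inord 1) a b * E o1 a b) - \sum_(h | h != o) p h (inord 1) o1 * E h a b.
    by rewrite (hadamard_entry K) mulrA mulfV // mul1r (bigD1 o) //= addrK.
  apply: (mulfI po); rewrite !hE e1 IH //; congr (_ - _).
  apply: eq_bigr => h ho; have [hk|kh] := ltnP h k.+2.
    have := IH h hk (ltn_ord h); rewrite (_ : Ordinal _ = h) => [->//|]; exact: val_inj.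
  rewrite !(proj1 (pQ h (inord 1) o1)) ?mul0r //.
  by move: ho kh; rewrite i1 -val_eqE /=; lia.
have BP B : B \in bose_mesner C e D -> B a y' = B a z'.
  move: B; apply: (bose_mesner_idem_ind PI) => [|A B hA hB|k A hA|k].
  - by rewrite !mxE.
  - by rewrite !mxE hA hB.
  - by rewrite !mxE hA.
  - by have := EP k (ltn_ord k); rewrite (_ : Ordinal _ = k) //; apply: val_inj.
have := BP _ (distmx_mem C e iD); rewrite !mxE !enum_rankK yi zj eqxx eq_sym.
by rewrite val_eqE (negPf ij) => /eqP; rewrite oner_eq0.
Qed.

Lemma dual_adjmx_adj : adjm (dual_adjmx x E) = dual_adjmx x E.
Proof.
apply/matrixP => y z; rewrite !mxE; have [->|ne] := eqVneq z y.
  by rewrite ?eqxx !mulr1n rmorphM /= conjC_nat (idem_real DR PI).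
by rewrite ?[y == z]eq_sym ?(negPf ne) !mulr0n conjC0.
Qed.

(* The squared Frobenius norm of [E_i A* E_j] is [|X|] times the Krein parameter
   [q^1_ij] times a diagonal entry of [E_1]. *)
Lemma tridiagonal_dual (i j : 'I_D.+1) : (i.+1 < j)%N || (j.+1 < i)%N -> E i *m dual_adjmx x E *m E j = 0.
Proof.
move=> ij; apply: dotm0; rewrite /dotm !adjmM !(idem_adj DR PI) dual_adjmx_adj.
case: QP => _ [p K pQ]; pose a := enum_rank x.
pose L := dual_adjmx x E; pose g y : C := #|X|%:R * E (inord 1) a y.
have gE (B : mxX) y z : (L *m B) y z = g y * B y z by rewrite mul_diag_mx !mxE.
have -> : \tr (E i *m L *m E j *m (E j *m (L *m E i))) = \tr ((L *m E j) *m (L *m E i)).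
  have h k : L *m E k *m E k = L *m E k by rewrite -mulmxA (idem_mul PI) eqxx.
  rewrite -(mulmxA (E i) L) -(mulmxA (E i)) mxtrace_mulC mulmxA -(mulmxA _ _ (E i)) h.
  by rewrite h.
have -> : \tr ((L *m E j) *m (L *m E i)) = \sum_y \sum_z g y * (g z * (E i z y * E j z y)).
  apply: eq_bigr => y _; rewrite mxE; apply: eq_bigr => z _; rewrite !gE.
  by rewrite -[in LHS](idem_tr DR PI j) mxE; ring.
apply: big1 => y _; rewrite -mulr_sumr.
have -> : \sum_z g z * (E i z y * E j z y)
  = #|X|%:R^-1 * \sum_h p h i j * \sum_z g z * E h z y.
  rewrite mulr_sumr; under [RHS]eq_bigr => h _ do rewrite 2!mulr_sumr.
  rewrite exchange_big; apply: eq_bigr => z _; rewrite (hadamard_entry K) !mulr_sumr.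
  by apply: eq_bigr => h _; ring.
rewrite big1 ?mulr0 // => h _; have [->|h1] := eqVneq h (inord 1).
  by rewrite (proj1 (pQ _ _ _)) ?mul0r // inordK //; move: ij; lia.
rewrite (_ : \sum_z _ = #|X|%:R * (E (inord 1) *m E h) a y).
  by rewrite (idem_mul PI) eq_sym (negPf h1) mxE !mulr0.
by rewrite mxE mulr_sumr; apply: eq_bigr => z _; rewrite mulrA.
Qed.

End DualSide.

(** * The type of a module *)

Lemma leonard_ext (C : fieldType) n d (W : {vspace 'cV[C]_n}) A As e f mu mu' nu nu' w :
  leonard_system d W A As e f mu nu w ->
  (forall i, (i <= d)%N -> mu i = mu' i) -> (forall i, (i <= d)%N -> nu i = nu' i) ->
  leonard_system d W A As e f mu' nu' w.
Proof.
move=> [? ? ? ? eA fAs ? ? ? ? ? ? muI nuI ? ? ? ? ? ? ?] muE nuE; split=> //.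
- by move=> i v id; rewrite -muE //; apply: eA.
- by move=> i v id; rewrite -nuE //; apply: fAs.
- by move=> i j id jd; rewrite -!muE //; apply: muI.
- by move=> i j id jd; rewrite -!nuE //; apply: nuI.
Qed.

(** The vector [z] may lie outside [W]. Its projection to [W] is killed by the same idempotents, as
    these are self-adjoint and preserve [W], so it is 0 by [split_trivial]. *)
Lemma split_orth (C : numClosedFieldType) n d (W : {vspace 'cV[C]_n}) A As e f mu nu w :
  leonard_system d W A As e f mu nu w ->
  (forall i, adjm (e i) = e i) -> (forall i, adjm (f i) = f i) ->
  forall m z, (m <= d.+1)%N ->
  (forall j, (j <= d)%N -> (m <= j)%N -> f j *m z = 0) ->
  (forall k, (k <= d)%N -> (k < m)%N -> e k *m z = 0) ->
  forall v, v \in W -> dotc v z = 0.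
Proof.
move=> LS eadj fadj m z md fz ez v vW.
have [a aW za] := orth_proj (@dotcD C n) (@dotcZ C n) (@dotcC C n) (@dotc0 C n) W z.
have killed (F : 'M[C]_n) : adjm F = F -> (forall y, y \in W -> F *m y \in W) -> F *m z = 0 -> F *m a = 0.
  move=> Fadj FW Fz; apply: dotc0; rewrite dotc_adj Fadj.
  rewrite -[X in dotc X _](subKr z) dotcD -scaleN1r dotcZ za ?FW // mulr0 addr0.
  by rewrite -{1}Fadj -dotc_adj Fz dotc0l.
have a0 : a = 0.
  apply: (split_trivial LS (m := m)) => // [j jd mj|k kd km].
    by apply: killed => // [y|]; [exact: (ls_f LS)|exact: fz].
  by apply: killed => // [y|]; [exact: (ls_e LS)|exact: ez].
by have := za _ vW; rewrite a0 subr0 dotcC => h; rewrite -[LHS]conjCK h conjC0.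
Qed.

(* Endpoint, dual endpoint, diameter and split sequence of a thin irreducible module. *)
Record module_type (C : Type) := ModuleType
  { mt_r : nat; mt_t : nat; mt_d : nat; mt_phi : nat -> C }.

Section Modules.
Variables (C : numClosedFieldType) (n D : nat) (q u us v vs : C).
Local Notation V := 'cV[C]_n.
Implicit Types p : module_type C.

Definition mt_a p := u * q ^ ((2 * mt_t p + mt_d p)%:Z - D%:Z).
Definition mt_b p := v * q ^ (D%:Z - (2 * mt_t p + mt_d p)%:Z).
Definition mt_as p := us * q ^ ((2 * mt_r p + mt_d p)%:Z - D%:Z).
Definition mt_bs p := vs * q ^ (D%:Z - (2 * mt_r p + mt_d p)%:Z).

Definition mt_mu p := qeig (mt_d p) q (mt_a p) (mt_b p).
Definition mt_mu' p := qeig (mt_d p) q (mt_b p) (mt_a p).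
Definition mt_nu p := qeig (mt_d p) q (mt_bs p) (mt_as p).

Definition is_module_model p (X : tet_gen -> 'M[C]_((mt_d p).+1)) :=
  [/\ forall s t, qtet_rel q s t -> expr_eval X s = expr_eval X t,
      mt_a p *: X (tet_pair tet01) + mt_b p *: X (tet_pair tet12)
        = \matrix_(i, j) (if i == j then mt_mu p j else if i == j.+1 :> nat then 1 else 0)
    & mt_as p *: X (tet_pair tet23) + mt_bs p *: X (tet_pair tet30)
        = \matrix_(i, j) (if i == j then mt_nu p j else if j == i.+1 :> nat then mt_phi p j else 0)].

(* Chosen as a function of the type, so that isomorphic modules get the same matrices. *)
Definition module_model p : tet_gen -> 'M[C]_((mt_d p).+1) :=
  if pselect (exists X, @is_module_model p X) is left ex then projT1 (cid ex) else fun=> 0.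

Variables (A As : 'M[C]_n) (E Es : nat -> 'M[C]_n).

Record has_type (W : {vspace V}) (w : nat -> V) p : Prop := {
  ht_rd : (mt_r p + mt_d p <= D)%N;
  ht_td : (mt_t p + mt_d p <= D)%N;
  ht_ls : leonard_system (mt_d p) W A As (fun k => E (mt_t p + mt_d p - k)%N)
     (fun i => Es (mt_r p + i)%N) (mt_mu p) (mt_nu p) w;
  ht_phi : second_split (mt_d p) As (mt_nu p) (split_basis A (mt_mu p) w) (mt_phi p);
  ht_Es : forall j v, (j <= D)%N -> v \in W -> Es j *m v != 0 -> (mt_r p <= j <= mt_r p + mt_d p)%N;
  ht_E : forall j v, (j <= D)%N -> v \in W -> E j *m v != 0 -> (mt_t p <= j <= mt_t p + mt_d p)%N }.

Section HasType.
Variables (W : {vspace V}) (w : nat -> V) (p : module_type C).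
Hypothesis HT : has_type W w p.

Lemma ht_Es_attained j : (mt_r p <= j <= mt_r p + mt_d p)%N -> exists2 x, x \in W & Es j *m x != 0.
Proof.
move=> /andP [rj jd]; have LS := ht_ls HT; exists (split_basis A (mt_mu p) w (j - mt_r p)).
  exact: split_basis_mem LS _.
have jd' : (j - mt_r p <= mt_d p)%N by rewrite leq_subLR.
by have := split_basis_fdiag LS jd'; rewrite subnKC // => ->; exact: (ls_w LS).
Qed.

Lemma ht_E_attained j : (mt_t p <= j <= mt_t p + mt_d p)%N -> exists2 x, x \in W & E j *m x != 0.
Proof.
move=> /andP [tj jd]; have LS := ht_ls HT; exists (split_basis A (mt_mu p) w (mt_t p + mt_d p - j)).
  exact: split_basis_mem LS _.
have jd' : (mt_t p + mt_d p - j <= mt_d p)%N by rewrite leq_subLR leq_add2r.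
by have := split_basis_ediag LS jd'; rewrite subKn.
Qed.

End HasType.

(* Schur's lemma makes the type an isomorphism invariant. *)
Lemma has_type_iso W W' w w' p p' (F : 'M[C]_n) :
  has_type W w p -> has_type W' w' p' ->
  F *m A = A *m F -> F *m As = As *m F ->
  (forall i, (i <= D)%N -> F *m E i = E i *m F) -> (forall i, (i <= D)%N -> F *m Es i = Es i *m F) ->
  (forall v, v \in W -> F *m v = 0 -> v = 0) ->
  (forall v, v \in W -> F *m v \in W') ->
  (forall v', v' \in W' -> exists2 v, v \in W & F *m v = v') ->
  p = p' /\ exists s, forall i, F *m split_basis A (mt_mu p) w i = s *: split_basis A (mt_mu p') w' i.
Proof.
move=> HT HT' FA FAs FE FEs Finj FW Fsurj.
(* The endpoint and diameter are read off from the set of j for which [G j] is nonzero on the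
   module, a set preserved by [F]. *)
have supp (r d r' d' : nat) (G : nat -> 'M[C]_n) :
    (r + d <= D)%N -> (r' + d' <= D)%N -> (forall i, (i <= D)%N -> F *m G i = G i *m F) ->
    (forall j v, (r <= j <= r + d)%N -> v \in W -> G j *m v \in W) ->
    (forall j v, (j <= D)%N -> v \in W -> G j *m v != 0 -> (r <= j <= r + d)%N) ->
    (forall j v, (j <= D)%N -> v \in W' -> G j *m v != 0 -> (r' <= j <= r' + d')%N) ->
    (forall j, (r <= j <= r + d)%N -> exists2 v, v \in W & G j *m v != 0) ->
    (forall j, (r' <= j <= r' + d')%N -> exists2 v, v \in W' & G j *m v != 0) ->
    r = r' /\ d = d'.
  move=> rd rd' FG GW s s' at_ at_'.
  have h j : (r <= j <= r + d)%N -> (r' <= j <= r' + d')%N.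
    move=> jr; have jD : (j <= D)%N by lia.
    have [x xW Gx] := at_ j jr; apply: (s' j (F *m x)) => //; first exact: FW.
    rewrite mulmxA -FG // -mulmxA; apply: contraNneq Gx => Gx0; apply/eqP.
    by apply: Finj Gx0; apply: GW.
  have h' j : (r' <= j <= r' + d')%N -> (r <= j <= r + d)%N.
    move=> jr; have jD : (j <= D)%N by lia.
    have [y /Fsurj [x xW <-] Gx] := at_' j jr; apply: (s j x) => //.
    by apply: contraNneq Gx => Gx0; rewrite mulmxA -FG // -mulmxA Gx0 mulmx0.
  by move: (h r) (h (r + d)%N) (h' r') (h' (r' + d')%N); lia.
have LS := ht_ls HT; have LS' := ht_ls HT'.
have [rE dE] : mt_r p = mt_r p' /\ mt_d p = mt_d p'.
  apply: (supp _ _ _ _ Es (ht_rd HT) (ht_rd HT') FEs _ (ht_Es HT) (ht_Es HT')).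
  - move=> j x /andP [rj jd] xW; rewrite -(subnKC rj); apply: (ls_f LS) => //.
    by rewrite leq_subLR.
  - exact: ht_Es_attained HT.
  - exact: ht_Es_attained HT'.
have [tE _] : mt_t p = mt_t p' /\ mt_d p = mt_d p'.
  apply: (supp _ _ _ _ E (ht_td HT) (ht_td HT') FE _ (ht_E HT) (ht_E HT')).
  - move=> j x /andP [tj jd] xW; rewrite -(subKn jd); apply: (ls_e LS) => //.
    by rewrite leq_subLR leq_add2r.
  - exact: ht_E_attained HT.
  - exact: ht_E_attained HT'.
have muE : mt_mu p' = mt_mu p by rewrite /mt_mu /mt_a /mt_b dE tE.
have nuE : mt_nu p' = mt_nu p by rewrite /mt_nu /mt_as /mt_bs dE rE.
have w0W := ls_w0 LS.
have [s sE] : exists s, F *m w 0 = s *: w' 0.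
  have fw0 : Es (mt_r p) *m w 0 = w 0 by have := ls_fw0 LS; rewrite /= addn0.
  have rD : (mt_r p <= D)%N by apply: leq_trans (ht_rd HT); apply: leq_addr.
  have [s sE] := ls_thin LS' (leq0n _) (FW _ w0W); exists s.
  by rewrite -sE /= addn0 -rE mulmxA -FEs // -mulmxA fw0.
have Fw0 : F *m w 0 != 0.
  by apply: contraNneq (ls_w LS (leq0n _)) => h; apply/eqP/Finj.
have s0 : s != 0 by apply: contraNneq Fw0 => e; rewrite sE e scale0r.
have FuE i : F *m split_basis A (mt_mu p) w i = s *: split_basis A (mt_mu p') w' i.
  rewrite muE; elim: i => [|i IH]; first exact: sE.
  by rewrite /= mulmxBr mulmxA FA -mulmxA -scalemxAr IH -scalemxAr scalerBr !scalerA mulrC.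
split; last by exists s.
suff phiE : mt_phi p = mt_phi p'.
  by move: rE tE dE phiE; case: (p) => ? ? ? ?; case: (p') => ? ? ? ? /= -> -> -> ->.
have [ph0 phgt phS _] := ht_phi HT; have [ph0' phgt' phS' _] := ht_phi HT'.
apply: funext => i; have [id|di] := leqP i (mt_d p); last by rewrite phgt // phgt' // -dE.
case: i id => [|i] id; first by rewrite ph0 ph0'.
have := congr1 (mulmx F) (phS _ (leqW id)); rewrite mulmxA FAs -mulmxA FuE -scalemxAr.
rewrite phS' -?dE ?leqW // mulmxDr -!scalemxAr !FuE nuE scalerDr !scalerA [s * _]mulrC => /addrI.
rewrite mulrC; move/eqP; rewrite -subr_eq0 -scalerBl scaler_eq0 -mulrBl mulf_eq0 (negPf s0) orbF subr_eq0.
case/orP => [/eqP //|/eqP u'0].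
have id' : (i <= mt_d p')%N by rewrite -dE ltnW.
by have := split_basis_fdiag LS' id'; rewrite u'0 mulmx0 => /esym/eqP; rewrite (negPf (ls_w LS' id')).
Qed.

Hypothesis q0 : q != 0.

Lemma lamE d k : lam d q k = q ^ ((2 * k)%:Z - d%:Z).
Proof. by rewrite /lam expfzDr // exprnN. Qed.

(** Taking the idempotents [E] in decreasing order puts the coefficient from u in front of 1 / lam
    k, the diagonal of x_01. *)
Lemma mt_muE p k : (k <= mt_d p)%N ->
  u * q ^ ((2 * (mt_t p + mt_d p - k))%:Z - D%:Z) + v * q ^ (D%:Z - (2 * (mt_t p + mt_d p - k))%:Z) = mt_mu p k.
Proof.
move=> kd; rewrite /mt_mu /qeig /mt_a /mt_b lamE invr_expz -!mulrA -!expfzDr //.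
by congr (u * q ^ _ + v * q ^ _); lia.
Qed.

Lemma mt_nuE p k :
  us * q ^ ((2 * (mt_r p + k))%:Z - D%:Z) + vs * q ^ (D%:Z - (2 * (mt_r p + k))%:Z) = mt_nu p k.
Proof.
rewrite /mt_nu /qeig /mt_as /mt_bs lamE invr_expz -!mulrA -!expfzDr // addrC.
by congr (vs * q ^ _ + us * q ^ _); lia.
Qed.

Lemma mt_mu_rev p k : (k <= mt_d p)%N -> mt_mu' p k = mt_mu p (mt_d p - k)%N.
Proof. by move=> kd; apply: mu_rev. Qed.

Hypothesis qi : forall i : nat, (1 <= i <= D)%N -> q ^+ (2 * i) != 1.
Hypotheses (u0 : u != 0) (us0 : us != 0) (v0 : v != 0) (vs0 : vs != 0) (D1 : (1 <= D)%N).

Lemma module_model_type W w p : has_type W w p -> is_module_model (module_model p).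
Proof.
move=> HT.
rewrite /module_model; case: pselect => [ex|[]]; first exact: projT2 (cid ex).
have LS := ht_ls HT; have LS' := leonard_rev LS (@mt_mu_rev p).
have [phi' phi'P] := second_split_exists LS'.
have qi' i : (1 <= i <= mt_d p)%N -> q ^+ (2 * i) != 1.
  by move=> id; apply: qi; have := ht_rd HT; move: id; lia.
have [||||c c0 cP] := leonard_evaluation q0 qi' _ _ _ _ LS (ht_phi HT) phi'P.
1-4: by rewrite mulf_neq0 // expfz_neq0.
have [|||X [X1 X2 X3]] := @tetrahedron_model C (mt_d p) q (mt_a p) (mt_b p) (mt_as p) (mt_bs p) c q0 c0.
- by move=> i /cP [].
- by move=> i /cP [].
- by apply: (qi (i := 1)); rewrite D1.
exists X; split=> //.
rewrite X3; apply/matrixP => i j; rewrite !mxE; case: (i == j); first by rewrite addrC.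
by case: eqP => // ji; have [|-> //] := cP j; apply/andP; split; [rewrite ji|rewrite -ltnS].
Qed.

End Modules.

Lemma expr_eval_intertwine (K : fieldType) (G : Type) n k (X : G -> 'M[K]_n) (Y : G -> 'M[K]_k) (M : 'M[K]_(n, k)) :
  (forall g, X g *m M = M *m Y g) -> forall s, expr_eval X s *m M = M *m expr_eval Y s.
Proof.
move=> XM; elim=> [g|||s IHs t IHt|s IHs|s IHs t IHt|c s IHs] /=.
- exact: XM.
- by rewrite mul0mx mulmx0.
- by rewrite mul1mx mulmx1.
- by rewrite mulmxDl mulmxDr IHs IHt.
- by rewrite mulNmx mulmxN IHs.
- by rewrite -mulmxA IHt mulmxA IHs mulmxA.
- by rewrite -scalemxAl -scalemxAr IHs.
Qed.

Lemma expr_eval_closed (K : fieldType) (G : Type) n (X : G -> 'M[K]_n) (T : 'M[K]_n -> Prop) :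
  T 1%:M -> (forall x y, T x -> T y -> T (x + y)) -> (forall c x, T x -> T (c *: x)) ->
  (forall x y, T x -> T y -> T (x *m y)) -> (forall g, T (X g)) -> forall s, T (expr_eval X s).
Proof.
move=> T1 TD TZ TM TX; elim=> [g|||s IHs t IHt|s IHs|s IHs t IHt|c s IHs] /=; auto.
- by rewrite -(scale0r 1%:M); auto.
- by rewrite -scaleN1r; auto.
Qed.

(** * From the models of the irreducible modules to an action inside T *)

Section Assembly.
Variables (C : numClosedFieldType) (n D : nat) (q u us v vs : C).
Hypotheses (q0 : q != 0) (qi : forall i : nat, (1 <= i <= D)%N -> q ^+ (2 * i) != 1).
Hypotheses (u0 : u != 0) (us0 : us != 0) (v0 : v != 0) (vs0 : vs != 0) (D1 : (1 <= D)%N).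
Local Notation V := 'cV[C]_n.
Variables (A As : 'M[C]_n) (E Es : nat -> 'M[C]_n).
Local Notation has_type := (has_type D q u us v vs A As E Es).
Local Notation mu := (mt_mu D q u v).
Local Notation nu := (mt_nu D q us vs).
Local Notation model := (@module_model C D q u us v vs).

Definition module_basis p (w : nat -> V) : 'M[C]_(n, (mt_d p).+1) :=
  \matrix_(y, i) split_basis A (mu p) w i y 0.

Section Basis.
Variables (W : {vspace V}) (w : nat -> V) (p : module_type C).
Hypothesis HT : has_type W w p.
Local Notation B := (module_basis p w).
Local Notation ub := (@split_basis C n A (mu p) w).

Lemma module_basisE (c : 'cV[C]_((mt_d p).+1)) : B *m c = \sum_i c i 0 *: ub i.
Proof.
by apply/matrixP => x y; rewrite ord1 summxE mxE; apply: eq_bigr => i _; rewrite !mxE mulrC.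
Qed.

Lemma module_basis_mem c : B *m c \in W.
Proof.
rewrite module_basisE; apply: memv_suml => i _; apply: memvZ.
exact: split_basis_mem (ht_ls HT) _.
Qed.

Lemma module_basis_inj (c : 'cV_((mt_d p).+1)) : B *m c = 0 -> c = 0.
Proof.
move=> Bc; apply/matrixP => i j; rewrite ord1 mxE.
have := @split_basis_free _ _ _ _ _ _ _ _ _ _ _ (ht_ls HT) (fun k => c (inord k) 0) _ i.
rewrite inord_val -ltnS ltn_ord; apply=> //.
by rewrite -[RHS]Bc module_basisE; apply: eq_bigr => k _; rewrite inord_val.
Qed.

Lemma module_basis_onto x : x \in W -> exists c : 'cV_((mt_d p).+1), x = B *m c.
Proof.
move=> /(split_basis_span (ht_ls HT)) [c ->]; exists (\col_i c i).
by rewrite module_basisE; apply: eq_bigr => i _; rewrite mxE.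
Qed.

Lemma module_basis_mul (N : 'M[C]_n) (M : 'M_((mt_d p).+1)) :
  (forall j : 'I_(mt_d p).+1, N *m ub j = \sum_i M i j *: ub i) -> N *m B = B *m M.
Proof.
move=> NM; apply/matrixP => x j; have /matrixP/(_ x 0) := NM j; rewrite summxE !mxE => h.
under eq_bigr => y _ do rewrite mxE.
by rewrite h; apply: eq_bigr => i _; rewrite !mxE mulrC.
Qed.

Lemma module_basis_A :
  A *m B = B *m (mt_a D q u p *: model p (tet_pair tet01) + mt_b D q v p *: model p (tet_pair tet12)).
Proof.
have [_ -> _] := module_model_type q0 qi u0 us0 v0 vs0 D1 HT.
apply: module_basis_mul => j; rewrite split_basisS (bigD1 j) // mxE eqxx; congr (_ + _).
have [jd|] := ltnP j (mt_d p); last first.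
  move=> dj; rewrite (split_basis_gt (ht_ls HT) (j := j.+1)) // big1 // => i ij.
  by rewrite mxE (negPf ij) ifN ?scale0r //; have := ltn_ord i; lia.
have jd' : (j.+1 < (mt_d p).+1)%N by [].
rewrite (bigD1 (Ordinal jd')); last by rewrite -val_eqE /= gtn_eqF.
rewrite mxE -val_eqE /= gtn_eqF // eqxx scale1r big1 ?addr0 // => i /andP [ij ij'].
by rewrite mxE (negPf ij) ifN ?scale0r //; apply: contra ij' => /eqP h; apply/eqP/val_inj.
Qed.

Lemma module_basis_As :
  As *m B = B *m (mt_as D q us p *: model p (tet_pair tet23) + mt_bs D q vs p *: model p (tet_pair tet30)).
Proof.
have [_ _ ->] := module_model_type q0 qi u0 us0 v0 vs0 D1 HT.
have [ph0 _ uAs _] := ht_phi HT.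
apply: module_basis_mul => j; rewrite uAs; last by rewrite leqW // -ltnS.
rewrite (bigD1 j) //= mxE eqxx; congr (_ + _).
case: (posnP j) => [j0|j0].
  rewrite j0 ph0 scale0r big1 // => i ij.
  by rewrite mxE (negPf ij) j0 scale0r.
have jd' : (j.-1 < (mt_d p).+1)%N by have := ltn_ord j; lia.
rewrite (bigD1 (Ordinal jd')) /=; last by rewrite -val_eqE /=; lia.
rewrite mxE -val_eqE /= ifN; last by lia.
rewrite prednK // eqxx big1 ?addr0 // => i /andP [ij ij'].
rewrite mxE (negPf ij) ifN ?scale0r //; apply: contra ij' => /eqP h; apply/eqP/val_inj.
by rewrite /= h.
Qed.

End Basis.

(** Once the types are identified, [F] carries one split basis to [s] times the other, so the block
    [P *m F *m module_basis p w] is a scalar matrix and commutes with the common model. *)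
Lemma module_model_transport p p' w w' F s (P : 'M[C]_((mt_d p').+1, n)) g :
  p = p' -> P *m module_basis p' w' = 1%:M ->
  (forall i, F *m split_basis A (mu p) w i = s *: split_basis A (mu p') w' i) ->
  model p' g *m (P *m F *m module_basis p w) = P *m F *m module_basis p w *m model p g.
Proof.
move=> pp'; case: p' / pp' P => P PB Fu.
have FB : F *m module_basis p w = s *: module_basis p w'.
  by apply/matrixP => x j; have /matrixP/(_ x 0) := Fu j; rewrite !mxE => <-; apply: eq_bigr => y _; rewrite mxE.
by rewrite -mulmxA FB -scalemxAr PB -scalemxAr mulmx1 -scalemxAl mul1mx.
Qed.

Variable T : 'M[C]_n -> Prop.
Hypotheses (T1 : T 1%:M) (TD : forall x y, T x -> T y -> T (x + y)) (TZ : forall c x, T x -> T (c *: x)).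
Hypotheses (TM : forall x y, T x -> T y -> T (x *m y)) (Tadj : forall x, T x -> T (adjm x)).
Hypotheses (TA : T A) (TAs : T As).
Hypotheses (TE : forall i, (i <= D)%N -> T (E i)) (TEs : forall i, (i <= D)%N -> T (Es i)).
Hypothesis Ttype : forall W, irreducible_space T W -> exists w p, has_type W w p.

Definition acts_by (c : module_type C -> C) (N : 'M[C]_n) :=
  forall W w p, irreducible_space T W -> has_type W w p -> forall x, x \in W -> N *m x = c p *: x.

Theorem tetrahedron_action : exists Th : tet_gen -> 'M[C]_n,
  [/\ forall s t, qtet_rel q s t -> expr_eval Th s = expr_eval Th t,
      forall s, T (expr_eval Th s)
    & forall Phi Psi,
        acts_by (fun p => q ^ ((mt_r p + mt_t p + mt_d p)%:Z - D%:Z)) Phi ->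
        acts_by (fun p => q ^ ((mt_r p)%:Z - (mt_t p)%:Z)) Psi ->
      A = u *: (Phi *m invmx Psi *m Th (tet_pair tet01)) + v *: (Psi *m invmx Phi *m Th (tet_pair tet12)) /\
      As = us *: (Phi *m Psi *m Th (tet_pair tet23)) + vs *: (invmx Psi *m invmx Phi *m Th (tet_pair tet30))].
Proof.
have fullst : stable_space T (fullv : {vspace V}) by move=> N _ x _; rewrite memvf.
have [m [W [Wirr Worth Wfull]]] := orth_decomposition Tadj fullst.
have [w /choice [p HT]] := choice (fun k => Ttype (Wirr k)).
pose B k := module_basis (p k) (w k).
have BW k c : B k *m c \in W k := module_basis_mem (HT k) c.
have Bonto k x : x \in W k -> exists c, x = B k *m c := @module_basis_onto _ _ _ (HT k) x.
have [P [PB PB0 BP1]] : exists P : forall k : 'I_m, 'M[C]_((mt_d (p k)).+1, n),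
    [/\ forall k, P k *m B k = 1%:M, forall j k, j != k -> P j *m B k = 0 & \sum_k B k *m P k = 1%:M].
  apply: orth_frame => [k c|j k jk|x].
  - exact: (module_basis_inj (HT k)).
  - apply: mx_col_ext => c; rewrite mul0mx; apply: dotc0; rewrite -mulmxA dotc_adj adjmK.
    by apply: (Worth k j); rewrite ?BW // eq_sym.
  have := memvf x; rewrite Wfull => /memv_sumP [y yW ->].
  exists (fun k => projT1 (cid (Bonto k (y k) (yW k isT)))).
  by apply: eq_bigr => k _; case: cid.
have Bext (M N : 'M[C]_n) : (forall k, M *m B k = N *m B k) -> M = N.
  move=> MN; rewrite -[M]mulmx1 -[N]mulmx1 -BP1 !mulmx_sumr.
  by apply: eq_bigr => k _; rewrite !mulmxA MN.
pose mdl k := model (p k); pose Th g := \sum_k B k *m mdl k g *m P k.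
have ThB k g : Th g *m B k = B k *m mdl k g.
  rewrite mulmx_suml (bigD1 k) //= big1 ?addr0 => [|j jk]; first by rewrite -mulmxA PB mulmx1.
  by rewrite -mulmxA PB0 ?mulmx0.
have EThB k s : expr_eval Th s *m B k = B k *m expr_eval (mdl k) s.
  exact: expr_eval_intertwine (ThB k) s.
have mdlP k := module_model_type q0 qi u0 us0 v0 vs0 D1 (HT k).
exists Th; split=> [s t st|s|Phi Psi PhiP PsiP].
- by apply: Bext => k; rewrite !EThB; have [h _ _] := mdlP k; rewrite (h _ _ st).
- apply: expr_eval_closed => // g {s}; apply: double_centralizer => // S ST.
  have WT k N x : T N -> x \in W k -> N *m x \in W k by move=> TN; have [h _ _] := Wirr k; apply: h.
  (* The projection to W_j along the other summands commutes with [T] because all summands are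
     stable. *)
  have PN j N : T N -> B j *m P j *m N = N *m (B j *m P j).
    move=> TN; apply: Bext => k; apply: mx_col_ext => c; rewrite -!mulmxA.
    have [c' c'E] := Bonto k _ (WT k N _ TN (BW k c)); rewrite c'E; have [->|jk] := eqVneq j k.
      by rewrite !(mulmxA (P k)) !PB !mul1mx.
    by rewrite !(mulmxA (P j)) !PB0 // !mul0mx !mulmx0.
  (* The commutant element [S] is cut into blocks. By Schur's lemma each block is zero or comes from
     an isomorphism, and isomorphic modules carry the same model. *)
  have key j k : mdl j g *m (P j *m S *m B k) = P j *m S *m B k *m mdl k g.
    have -> : P j *m S *m B k = P j *m (B j *m P j *m S) *m B k by rewrite !mulmxA PB mul1mx.
    set F := B j *m P j *m S.
    have FT N : T N -> F *m N = N *m F by move=> TN; rewrite /F -mulmxA ST // mulmxA PN // !mulmxA.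
    have FW x : x \in W k -> F *m x \in W j by move=> _; rewrite /F -!mulmxA BW.
    have [ex|nex] := pselect (exists2 x, x \in W k & F *m x != 0).
      have [Finj Fonto] := intertwiner_image (Wirr k) (Wirr j) FT FW ex.
      have [pE [s sE]] := has_type_iso (HT k) (HT j) (FT _ TA) (FT _ TAs) (fun i iD => FT _ (TE iD))
        (fun i iD => FT _ (TEs iD)) Finj FW Fonto.
      exact: module_model_transport pE (PB j) sE.
    have FB : F *m B k = 0.
      apply: mx_col_ext => c; rewrite mul0mx -mulmxA; apply/eqP/negPn/negP => h.
      by apply: nex; exists (B k *m c).
    by rewrite -[P j *m F *m B k]mulmxA FB !mulmx0 mul0mx.
  apply: Bext => k.
  have SB : S *m B k = \sum_j B j *m (P j *m S *m B k).
    rewrite -[LHS]mul1mx -BP1 mulmx_suml; apply: eq_bigr => j _; by rewrite !mulmxA.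
  rewrite -(mulmxA S) ThB mulmxA -(mulmxA (Th g)) SB mulmx_sumr [RHS]mulmx_suml.
  by apply: eq_bigr => j _; rewrite mulmxA ThB -!(mulmxA (B j)) key.
have PhiB k : Phi *m B k = q ^ ((mt_r (p k) + mt_t (p k) + mt_d (p k))%:Z - D%:Z) *: B k.
  apply: mx_col_ext => c; rewrite -mulmxA (PhiP _ _ _ (Wirr k) (HT k)) ?BW // scalemxAl //.
have PsiB k : Psi *m B k = q ^ ((mt_r (p k))%:Z - (mt_t (p k))%:Z) *: B k.
  apply: mx_col_ext => c; rewrite -mulmxA (PsiP _ _ _ (Wirr k) (HT k)) ?BW // scalemxAl //.
have invB (N : 'M[C]_n) (c : 'I_m -> C) : (forall k, c k != 0) -> (forall k, N *m B k = c k *: B k) ->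
    forall k, invmx N *m B k = (c k)^-1 *: B k.
  move=> c0 NB; have NU : N \in unitmx.
    have /mulmx1_unit [] // : N *m (\sum_k (c k)^-1 *: (B k *m P k)) = 1%:M.
    rewrite mulmx_sumr -BP1; apply: eq_bigr => k _.
    by rewrite -scalemxAr mulmxA NB -scalemxAl scalerA mulVf ?scale1r.
  move=> k; apply: (can_inj (mulKmx NU)); rewrite mulKVmx // -scalemxAr NB scalerA mulVf ?scale1r //.
have PhiVB := invB _ _ (fun k => expfz_neq0 _ q0) PhiB.
have PsiVB := invB _ _ (fun k => expfz_neq0 _ q0) PsiB.
have push (N : 'M[C]_n) c k k' (M : 'M_(_, k')) : N *m B k = c *: B k -> N *m (B k *m M) = c *: (B k *m M).
  by move=> NB; rewrite mulmxA NB -scalemxAl.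
split; apply: Bext => k; rewrite mulmxDl -!scalemxAl -!mulmxA !ThB.
  rewrite !(push _ _ _ _ _ (PhiVB k), push _ _ _ _ _ (PsiVB k)) -!scalemxAr.
  rewrite !(push _ _ _ _ _ (PhiB k), push _ _ _ _ _ (PsiB k)) !scalerA.
  rewrite (module_basis_A (HT k)) mulmxDr -!scalemxAr /mt_a /mt_b !invr_expz -!mulrA -!expfzDr //.
  by congr (_ * q ^ _ *: _ + _ * q ^ _ *: _); lia.
rewrite !(push _ _ _ _ _ (PhiVB k), push _ _ _ _ _ (PsiB k)) -!scalemxAr.
rewrite !(push _ _ _ _ _ (PhiB k), push _ _ _ _ _ (PsiVB k)) !scalerA.
rewrite (module_basis_As (HT k)) mulmxDr -!scalemxAr /mt_as /mt_bs !invr_expz -!mulrA -!expfzDr //.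
by congr (_ * q ^ _ *: _ + _ * q ^ _ *: _); lia.
Qed.

End Assembly.

(** * The split decompositions of the standard module *)

Section Terwilliger.
Variables (C : numClosedFieldType) (X : finType) (e : rel X) (D : nat) (x : X).
Hypothesis DR : distance_regular e.
Hypothesis diamD : diameter e = D.
Local Notation mxX := 'M[C]_#|X|.
Local Notation V := 'cV[C]_#|X|.
Local Notation Es := (dual_idempotent C e x).
Local Notation T := (@terwilliger C X e D x).
Variable E : 'I_D.+1 -> mxX.
Hypothesis PI : primitive_idempotents e E.

(* Meaningful for [i <= D] only: [inord] sends larger indices to [0]. *)
Definition idem (i : nat) : mxX := E (inord i).

Lemma adjmD (A B : mxX) : adjm (A + B) = adjm A + adjm B.
Proof. by apply/matrixP => y z; rewrite !mxE rmorphD. Qed.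

Lemma adjmZ k (A : mxX) : adjm (k *: A) = k^* *: adjm A.
Proof. by apply/matrixP => y z; rewrite !mxE rmorphM. Qed.

Lemma terw_idem i : T (idem i).
Proof. by apply: terw_bm; apply: idem_mem PI _. Qed.

Lemma terw_dual_idem i : (i <= D)%N -> T (Es i).
Proof.
move=> iD; have iD' : (i < D.+1)%N by [].
apply: terw_dual_bm; apply: memv_span; apply/mapP.
by exists (Ordinal iD'); rewrite ?mem_enum.
Qed.

Lemma dual_bose_mesner_ind (P : mxX -> Prop) :
  P 0 -> (forall A B, P A -> P B -> P (A + B)) -> (forall k A, P A -> P (k *: A)) ->
  (forall k, (k <= D)%N -> P (Es k)) -> forall B, B \in dual_bose_mesner C e D x -> P B.
Proof.
move=> P0 PD PZ PA B BB; have [U UP] := vspace_of_closed P0 PD PZ.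
apply/UP; apply: (subvP _ _ BB); apply/span_subvP => _ /mapP [k _ ->].
by apply/UP/PA; rewrite -ltnS.
Qed.

Lemma terw_adjm B : T B -> T (adjm B).
Proof.
elim=> {B} [B BB|B|||c B _ IH|B B' _ IH _ IH'].
- by apply/terw_bm/(bose_mesner_adj DR).
- move: B; apply: dual_bose_mesner_ind => [|A B hA hB|k A hA|k kD].
  + rewrite (_ : adjm 0 = 0 *: 1%:M) ?scale0r; last by apply/matrixP => i j; rewrite !mxE conjC0.
    by rewrite -(scale0r 1%:M); apply/terw_scale/terw_one.
  + by rewrite adjmD; apply: terw_add.
  + by rewrite adjmZ; apply: terw_scale.
  + by rewrite dual_idempotent_adj; apply: terw_dual_idem.
- rewrite (_ : adjm 1%:M = 1%:M); first exact: terw_one.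
  by apply/matrixP => i j; rewrite !mxE eq_sym conjC_nat.
- by move=> B B' _ IH _ IH'; rewrite adjmD; apply: terw_add.
- by rewrite adjmZ; apply: terw_scale.
- by rewrite adjmM; apply: terw_mul.
Qed.

Lemma T_moduleP (U : {vspace V}) :
  (forall i v, (i <= D)%N -> v \in U -> idem i *m v \in U) ->
  (forall i v, (i <= D)%N -> v \in U -> Es i *m v \in U) -> T_module e D x U.
Proof.
move=> UE UEs B; elim=> {B} [B|B||B B' _ IH _ IH'|c B _ IH|B B' _ IH _ IH'].
- move: B; apply: (bose_mesner_idem_ind PI) => [v _|A B hA hB v vU|k A hA v vU|k v vU].
  + by rewrite mul0mx mem0v.
  + by rewrite mulmxDl memvD ?hA ?hB.
  + by rewrite -scalemxAl memvZ ?hA.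
  + by have := UE k v; rewrite /idem inord_val -ltnS ltn_ord; apply.
- move: B; apply: dual_bose_mesner_ind => [v _|A B hA hB v vU|k A hA v vU|k kD v vU].
  + by rewrite mul0mx mem0v.
  + by rewrite mulmxDl memvD ?hA ?hB.
  + by rewrite -scalemxAl memvZ ?hA.
  + exact: UEs.
- by move=> v; rewrite mul1mx.
- by move=> v vU; rewrite mulmxDl memvD ?IH ?IH'.
- by move=> v vU; rewrite -scalemxAl memvZ ?IH.
- by move=> v vU; rewrite -mulmxA IH ?IH'.
Qed.

Lemma thin_proportional (W : {vspace V}) i y z : thin e D x W -> (i <= D)%N -> y \in W -> z \in W ->
  Es i *m y != 0 -> exists k, Es i *m z = k *: (Es i *m y).
Proof.
move=> Wthin iD yW zW y0; have iD' : (i < D.+1)%N by [].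
have fE v : mxact (Es i) v = Es i *m v by rewrite lfunE.
have : (<[Es i *m y]> == mxact (Es (Ordinal iD')) @: W)%VS.
  rewrite eqEdim -memvE -fE memv_img // andTb.
  apply: leq_trans (Wthin (Ordinal iD')) _; rewrite lt0n dimv_eq0 fE.
  by apply: contra y0 => /eqP h; rewrite -memv0 -h memv_line.
move=> /eqP h; apply/vlineP; rewrite h -fE; exact: memv_img.
Qed.

(** Turns membership in [Vdd] and [Vdu] into vanishing conditions, the form in which the split
    lemmas apply. *)
Lemma memv_sum_idem (F : nat -> mxX) (P : pred nat) v :
  (forall i j, (i <= D)%N -> (j <= D)%N -> F i *m F j = if i == j then F i else 0) ->
  \sum_(i < D.+1) F i = 1%:M ->
  (v \in \sum_(k < D.+1 | P k) limg (mxact (F k)))%VS <-> (forall k, (k <= D)%N -> ~~ P k -> F k *m v = 0).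
Proof.
move=> FF F1; split=> [/memv_sumP [y yF ->] k kD Pk|h].
  rewrite mulmx_sumr big1 // => i Pi; have /memv_imgP [z _ ->] := yF i Pi.
  have iD : (i <= D)%N by rewrite -ltnS.
  rewrite lfunE /= mulmxA FF //; case: eqP => [ki|_]; last by rewrite mul0mx.
  by case/negP: Pk; rewrite ki.
rewrite -[v]mul1mx -F1 mulmx_suml; apply: memv_suml => k _.
have [Pk|nPk] := boolP (P k); last by rewrite h ?mem0v // -ltnS.
rewrite (subvP (sumv_sup k _ (subvv _))) //.
by rewrite (_ : F k *m v = mxact (F k) v) ?memv_img ?memvf ?lfunE.
Qed.

End Terwilliger.

Section Modules.
Variables (C : numClosedFieldType) (X : finType) (e : rel X) (D : nat) (x : X).
Variables (q eta etas u us v vs : C) (E : 'I_D.+1 -> 'M[C]_#|X|).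
Hypothesis DR : distance_regular e.
Hypothesis diamD : diameter e = D.
Hypotheses (D1 : (1 <= D)%N) (q0 : q != 0).
Hypothesis QP : Q_polynomial e E.
Hypothesis thE : eigenvalue_sequence e E (fun i : 'I_D.+1 =>
  eta + u * q ^ ((2 * i)%:Z - D%:Z) + v * q ^ (D%:Z - (2 * i)%:Z)).
Hypothesis thsE : dual_eigenvalue_sequence e x E (fun i : 'I_D.+1 =>
  etas + us * q ^ ((2 * i)%:Z - D%:Z) + vs * q ^ (D%:Z - (2 * i)%:Z)).
Hypothesis Tthin : forall W : {vspace 'cV[C]_#|X|}, irreducible_T_module e D x W -> thin e D x W.
Local Notation V := 'cV[C]_#|X|.
Local Notation Es := (dual_idempotent C e x).
Local Notation T := (@terwilliger C X e D x).
Local Notation A := (adjmx C e - eta%:M).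
Local Notation As := (dual_adjmx x E - etas%:M).
Local Notation th i := (u * q ^ ((2 * i)%:Z - D%:Z) + v * q ^ (D%:Z - (2 * i)%:Z)).
Local Notation ths i := (us * q ^ ((2 * i)%:Z - D%:Z) + vs * q ^ (D%:Z - (2 * i)%:Z)).
Let PI : primitive_idempotents e E. Proof. by case: QP. Qed.

Lemma idem_mulE i j : (i <= D)%N -> (j <= D)%N -> idem E i *m idem E j = if i == j then idem E i else 0.
Proof.
move=> iD jD; rewrite /idem (idem_mul PI); congr (if _ then _ else _).
by rewrite -val_eqE /= !inordK.
Qed.

Lemma idem_sumE : \sum_(i < D.+1) idem E i = 1%:M.
Proof. by rewrite -(idem_sum PI); apply: eq_bigr => i _; rewrite /idem inord_val. Qed.

Lemma spectral_adjmx : spectral D A (idem E) (fun i => th i).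
Proof.
split=> [||| i j iD jD thij].
- exact: idem_mulE.
- exact: idem_sumE.
- rewrite thE -scalemx1 -(idem_sum PI) scaler_sumr -sumrB; apply: eq_bigr => i _.
  by rewrite -scalerBl /idem inord_val; congr (_ *: _); ring.
have := @eigenvalue_inj _ _ _ _ DR diamD _ PI _ thE (inord i) (inord j).
by rewrite !inordK // -!addrA thij => /(_ erefl) /(congr1 val); rewrite /= !inordK.
Qed.

Lemma spectral_dual_adjmx : spectral D As Es (fun i => ths i).
Proof.
split=> [||| i j iD jD thij].
- by move=> i j _ _; apply: dual_idempotent_mul.
- exact: dual_idempotent_sum.
- rewrite thsE -scalemx1 -(dual_idempotent_sum C x diamD) scaler_sumr -sumrB; apply: eq_bigr => i _.
  by rewrite -scalerBl; congr (_ *: _); ring.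
have := @dual_eigenvalue_inj _ _ _ _ _ DR diamD _ QP _ thsE D1 (inord i) (inord j).
by rewrite !inordK // -!addrA thij => /(_ erefl) /(congr1 val); rewrite /= !inordK.
Qed.

Lemma tridiagonal_idem : tridiagonal_for D (idem E) As.
Proof.
move=> i j iD jD ij; rewrite mulmxBr mulmxBl /idem (tridiagonal_dual x DR diamD QP D1); last by rewrite !inordK.
rewrite mul_mx_scalar -scalemxAl (idem_mul PI) -val_eqE /= !inordK // ifN ?scaler0 ?subr0 //.
by move: ij; lia.
Qed.

Lemma tridiagonal_dual_idem : tridiagonal_for D Es A.
Proof.
move=> i j iD jD ij; rewrite mulmxBr mulmxBl (dual_tridiagonal _ x DR diamD) //.
rewrite mul_mx_scalar -scalemxAl dual_idempotent_mul ifN ?scaler0 ?subr0 //.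
by move: ij; lia.
Qed.

Local Notation has_type := (has_type D q u us v vs A As (idem E) Es).

Lemma irreducible_has_type W : irreducible_space T W -> exists w p, has_type W w p.
Proof.
move=> Wirr; have [Wst W0 Wmin] := Wirr; have Wthin := Tthin Wirr.
have [|||||r [t [d [w [rd td rsupp tsupp LS]]]]] := thin_irreducible_leonard spectral_adjmx spectral_dual_adjmx
   tridiagonal_idem tridiagonal_dual_idem (W := W).
- exact: W0.
- by move=> i y _ yW; apply: Wst => //; apply: terw_idem.
- by move=> i y iD yW; apply: Wst => //; apply: terw_dual_idem.
- by move=> U UW UE UEs; exact: (Wmin U (T_moduleP PI UE UEs) UW).
- by move=> i y z iD yW zW; apply: thin_proportional Wthin iD yW zW.
pose p phi := ModuleType r t d phi : module_type C.
have {}LS := leonard_ext LS (@mt_muE _ _ _ u v q0 (p (fun=> 0))) (fun i _ => @mt_nuE _ _ _ us vs q0 (p (fun=> 0)) i).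
have [phi phiP] := second_split_exists LS.
by exists w, (p phi).
Qed.

Let adj_idem i : adjm (idem E i) = idem E i.
Proof. by rewrite /idem (idem_adj DR PI). Qed.

Let adj_Es i : adjm (Es i) = Es i.
Proof. exact: dual_idempotent_adj. Qed.

Let sum_idemE (P : pred nat) :
  (\sum_(k < D.+1 | P k) limg (mxact (E k)) = \sum_(k < D.+1 | P k) limg (mxact (idem E k)))%VS.
Proof. by apply: eq_bigr => k _; rewrite /idem inord_val. Qed.

Lemma mem_split_sums (P Q : pred nat) y :
  (y \in ((\sum_(k < D.+1 | P k) limg (mxact (Es k))) :&: \sum_(k < D.+1 | Q k) limg (mxact (E k)))%VS) <->
  (forall k, (k <= D)%N -> ~~ P k -> Es k *m y = 0) /\ (forall k, (k <= D)%N -> ~~ Q k -> idem E k *m y = 0).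
Proof.
have EsP := memv_sum_idem (F := Es) P y (fun k l _ _ => dual_idempotent_mul C e x k l) (dual_idempotent_sum C x diamD).
have EP := memv_sum_idem Q y idem_mulE idem_sumE.
rewrite memv_cap sum_idemE; split=> [/andP [/EsP h1 /EP h2] //|[h1 h2]].
by apply/andP; split; [apply/EsP|apply/EP].
Qed.

Lemma Vdd_mem i j y : y \in Vdd e x E i j <->
  (forall k, (k <= D)%N -> ~~ (k%:Z <= i)%R -> Es k *m y = 0) /\
  (forall k, (k <= D)%N -> ~~ (k%:Z <= j)%R -> idem E k *m y = 0).
Proof. exact: (mem_split_sums (fun k => k%:Z <= i)%R (fun k => k%:Z <= j)%R). Qed.

Lemma Vdu_mem i j y : y \in Vdu e x E i j <->
  (forall k, (k <= D)%N -> ~~ (k%:Z <= i)%R -> Es k *m y = 0) /\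
  (forall k, (k <= D)%N -> ~~ (D%:Z - j <= k%:Z)%R -> idem E k *m y = 0).
Proof. exact: (mem_split_sums (fun k => k%:Z <= i)%R (fun k => D%:Z - j <= k%:Z)%R). Qed.

Lemma split_tilde_intro (F : int -> int -> {vspace V}) i j y :
  y \in F i j -> (forall z, z \in F (i - 1) j -> dotc y z = 0) -> (forall z, z \in F i (j - 1) -> dotc y z = 0) ->
  split_tilde F i j y.
Proof.
move=> yF h1 h2; split=> // _ /memv_addP [z1 z1F [z2 z2F ->]].
by rewrite -[inner _ _]/(dotc y (z1 + z2)) dotcC dotcD [dotc z1 _]dotcC [dotc z2 _]dotcC h1 ?h2 // conjC0 addr0 conjC0.
Qed.

Section Shape.
Variables (W : {vspace V}) (w : nat -> V) (p : module_type C).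
Hypothesis HT : has_type W w p.
Local Notation r := (mt_r p).
Local Notation t := (mt_t p).
Local Notation d := (mt_d p).
Local Notation mu := (mt_mu D q u v p).
Local Notation mu' := (mt_mu' D q u v p).

(** The two indices sum to r + t + d whatever i is, which is why [Phi] is a scalar on [W]. *)
Lemma split_basis_dd i : (i <= d)%N ->
  split_tilde (Vdd e x E) (r + i)%:Z (t + d - i)%:Z (split_basis A mu w i).
Proof.
move=> id; have LS := ht_ls HT; have rd := ht_rd HT; have td := ht_td HT.
have uW := split_basis_mem LS i.
(* Vectors of the two smaller spaces need not lie in [W]. They are handled by [split_orth], with m =
   i when the first index is lowered and m = i + 1 when the second is. *)
have orth m z : (m <= d.+1)%N ->
    (forall k, (k <= D)%N -> (r + m <= k)%N -> Es k *m z = 0) ->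
    (forall k, (k <= D)%N -> (t + d < k + m)%N -> idem E k *m z = 0) -> dotc (split_basis A mu w i) z = 0.
  move=> md h1 h2; apply: (split_orth LS (fun k => adj_idem _) (fun k => adj_Es _) md) uW.
    by move=> j jd mj; apply: h1; lia.
  by move=> k kd km; apply: h2; lia.
apply: split_tilde_intro.
- apply/Vdd_mem; split=> k kD kij.
    apply: contraTeq kij => nz; have := ht_Es HT kD uW nz; rewrite negbK => /andP [rk krd].
    have [|ik] := leqP (k - r) i; first by lia.
    have kd : (k - r <= d)%N by lia.
    by have := split_basis_f0 LS kd ik; rewrite subnKC // => h; rewrite h eqxx in nz.
  apply: contraTeq kij => nz; have := ht_E HT kD uW nz; rewrite negbK => /andP [tk ktd].
  have [|ik] := leqP i (t + d - k); first by lia.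
  have kd : (t + d - k <= d)%N by lia.
  by have := split_basis_e0 LS kd ik; rewrite subKn // => h; rewrite h eqxx in nz.
- move=> z /Vdd_mem [h1 h2]; apply: (orth i) => [|k kD ik|k kD ik]; first exact: leqW.
    by apply: h1 => //; lia.
  by apply: h2 => //; lia.
move=> z /Vdd_mem [h1 h2]; apply: (orth i.+1) => // k kD ik.
  by apply: h1 => //; lia.
by apply: h2 => //; lia.
Qed.

(** Reversing the order of the eigenvalues of [A] exchanges lower and upper sums of the E_k; the
    indices now sum to D + r - t. *)
Lemma split_basis_du i : (i <= d)%N ->
  split_tilde (Vdu e x E) (r + i)%:Z (D - t - i)%:Z (split_basis A mu' w i).
Proof.
move=> id; have LS := leonard_rev (ht_ls HT) (@mt_mu_rev _ _ _ _ _ q0 p); have rd := ht_rd HT; have td := ht_td HT.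
have uW := split_basis_mem LS i.
have eE k : (k <= d)%N -> rev_family d (fun k => idem E (t + d - k)%N) k = idem E (t + k).
  by move=> kd; rewrite /rev_family; congr idem; lia.
have orth m z : (m <= d.+1)%N ->
    (forall k, (k <= D)%N -> (r + m <= k)%N -> Es k *m z = 0) ->
    (forall k, (k <= D)%N -> (k < t + m)%N -> idem E k *m z = 0) -> dotc (split_basis A mu' w i) z = 0.
  move=> md h1 h2; apply: (split_orth LS (fun k => adj_idem _) (fun k => adj_Es _) md) uW.
    by move=> j jd mj; apply: h1; lia.
  by move=> k kd km; rewrite eE //; apply: h2; lia.
apply: split_tilde_intro.
- apply/Vdu_mem; split=> k kD kij.
    apply: contraTeq kij => nz; have := ht_Es HT kD uW nz; rewrite negbK => /andP [rk krd].
    have [|ik] := leqP (k - r) i; first by lia.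
    have kd : (k - r <= d)%N by lia.
    by have := split_basis_f0 LS kd ik; rewrite subnKC // => h; rewrite h eqxx in nz.
  apply: contraTeq kij => nz; have := ht_E HT kD uW nz; rewrite negbK => /andP [tk ktd].
  have [|ik] := leqP i (k - t); first by lia.
  have kd : (k - t <= d)%N by lia.
  by have := split_basis_e0 LS kd ik; rewrite eE // subnKC // => h; rewrite h eqxx in nz.
- move=> z /Vdu_mem [h1 h2]; apply: (orth i) => [|k kD ik|k kD ik]; first exact: leqW.
    by apply: h1 => //; lia.
  by apply: h2 => //; lia.
move=> z /Vdu_mem [h1 h2]; apply: (orth i.+1) => // k kD ik.
  by apply: h1 => //; lia.
by apply: h2 => //; lia.
Qed.

End Shape.

Lemma displacement_dd Phi : acts_as_displacement D q (Vdd e x E) Phi ->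
  acts_by D q u us v vs A As (idem E) Es T (fun p => q ^ ((mt_r p + mt_t p + mt_d p)%:Z - D%:Z)) Phi.
Proof.
move=> PhiP W w p _ HT y /(split_basis_span (ht_ls HT)) [c ->].
rewrite mulmx_sumr scaler_sumr; apply: eq_bigr => i _.
have id : (i <= mt_d p)%N by rewrite -ltnS.
have [rd td] := (ht_rd HT, ht_td HT).
have rD : (mt_r p + i < D.+1)%N by lia.
have tD : (mt_t p + mt_d p - i < D.+1)%N by lia.
rewrite -scalemxAr (PhiP (Ordinal rD) (Ordinal tD) _ (split_basis_dd HT id)) !scalerA mulrC.
by congr (q ^ _ * _ *: _); rewrite /=; lia.
Qed.

Lemma displacement_du Psi : acts_as_displacement D q (Vdu e x E) Psi ->
  acts_by D q u us v vs A As (idem E) Es T (fun p => q ^ ((mt_r p)%:Z - (mt_t p)%:Z)) Psi.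
Proof.
move=> PsiP W w p _ HT y.
move=> /(split_basis_span (leonard_rev (ht_ls HT) (@mt_mu_rev _ _ _ _ _ q0 p))) [c ->].
rewrite mulmx_sumr scaler_sumr; apply: eq_bigr => i _.
have id : (i <= mt_d p)%N by rewrite -ltnS.
have [rd td] := (ht_rd HT, ht_td HT).
have rD : (mt_r p + i < D.+1)%N by lia.
have tD : (D - mt_t p - i < D.+1)%N by lia.
rewrite -scalemxAr (PsiP (Ordinal rD) (Ordinal tD) _ (split_basis_du HT id)) !scalerA mulrC.
by congr (q ^ _ * _ *: _); rewrite /=; lia.
Qed.

End Modules.

(** * Homomorphisms out of a presented algebra *)

Section Lift.
Variables (K : fieldType) (G : Type) (rel : expr K G -> expr K G -> Prop) (n : nat) (X : G -> 'M[K]_n).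
Hypothesis Xrel : forall s t, rel s t -> expr_eval X s = expr_eval X t.

Lemma expr_eval_cong s t : expr_cong rel s t -> expr_eval X s = expr_eval X t.
Proof.
elim=> {s t} /=.
- exact: Xrel.
- by [].
- by move=> a b _ ->.
- by move=> a b c _ -> _ ->.
- by move=> a a' b b' _ -> _ ->.
- by move=> a a' _ ->.
- by move=> a a' b b' _ -> _ ->.
- by move=> k a a' _ ->.
- by move=> *; rewrite addrA.
- by move=> *; rewrite addrC.
- by move=> *; rewrite add0r.
- by move=> *; rewrite addNr.
- by move=> *; rewrite mulmxA.
- by move=> *; rewrite mul1mx.
- by move=> *; rewrite mulmx1.
- by move=> *; rewrite mulmxDl.
- by move=> *; rewrite mulmxDr.
- by move=> *; rewrite scalerA.
- by move=> *; rewrite scale1r.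
- by move=> *; rewrite scalerDr.
- by move=> *; rewrite scalerDl.
- by move=> *; rewrite scalemxAl.
- by move=> *; rewrite scalemxAr.
Qed.

Definition presalg_eval (a : presalg rel) : 'M[K]_n := expr_eval X (expr_of a).

Lemma presalg_evalE s : presalg_eval (presalg_of rel s) = expr_eval X s.
Proof. by apply: expr_eval_cong; apply: expr_of_cong. Qed.

Fact presalg_eval_additive : {morph presalg_eval : a b / a - b}.
Proof.
move=> a b; rewrite -{1}(expr_ofK a) -{1}(expr_ofK b) {1}/GRing.opp /= {1}/GRing.add /=.
by rewrite presalg_of_opp presalg_of_add presalg_evalE.
Qed.

Fact presalg_eval_multiplicative : GRing.monoid_morphism presalg_eval.
Proof.
split=> [|a b]; first exact: (presalg_evalE EOne).
by rewrite -[_ * _]/(presalg_of _ _) presalg_evalE.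
Qed.

Fact presalg_eval_scalable : scalable presalg_eval.
Proof.
by move=> k a; rewrite -{1}(expr_ofK a) {1}/GRing.scale /= presalg_of_scale presalg_evalE.
Qed.

Lemma presalg_lift : exists theta : {rmorphism presalg rel -> 'M[K]_n},
  scalable theta /\ theta =1 presalg_eval.
Proof.
pose aM := GRing.isZmodMorphism.Build _ _ presalg_eval presalg_eval_additive.
pose mM := GRing.isMonoidMorphism.Build _ _ presalg_eval presalg_eval_multiplicative.
pose theta : {rmorphism presalg rel -> 'M[K]_n} := HB.pack presalg_eval aM mM.
by exists theta; split=> //; exact: presalg_eval_scalable.
Qed.

End Lift.

Theorem theorem6p7 (R : realType) (X : finType) (e : rel X) (D : nat) (x : X)
    (q eta etas u us v vs : R[i])
    (E : 'I_D.+1 -> 'M[R[i]]_#|X|) (Phi Psi : 'M[R[i]]_#|X|) :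
  distance_regular e ->
  diameter e = D ->
  (3 <= D)%N ->
  q != 0 -> u != 0 -> us != 0 -> v != 0 -> vs != 0 ->
  (forall i : nat, (1 <= i <= D)%N -> q ^+ (2 * i) != 1) ->
  Q_polynomial e E ->
  eigenvalue_sequence e E (fun i : 'I_D.+1 =>
    eta + u * q ^ ((2 * i)%:Z - D%:Z) + v * q ^ (D%:Z - (2 * i)%:Z)) ->
  dual_eigenvalue_sequence e x E (fun i : 'I_D.+1 =>
    etas + us * q ^ ((2 * i)%:Z - D%:Z) + vs * q ^ (D%:Z - (2 * i)%:Z)) ->
  (forall W : {vspace 'cV[R[i]]_#|X|}, irreducible_T_module e D x W -> thin e D x W) ->
  acts_as_displacement D q (Vdd e x E) Phi ->
  acts_as_displacement D q (Vdu e x E) Psi ->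
  exists theta : {rmorphism qtet q -> 'M[R[i]]_#|X|},
    [/\ scalable theta,
        forall a, terwilliger e D x (theta a),
        adjmx R[i] e = eta%:M
          + u *: (Phi *m invmx Psi *m theta (qtet_x q tet01))
          + v *: (Psi *m invmx Phi *m theta (qtet_x q tet12))
      & dual_adjmx x E = etas%:M
          + us *: (Phi *m Psi *m theta (qtet_x q tet23))
          + vs *: (invmx Psi *m invmx Phi *m theta (qtet_x q tet30))].
Proof.
move=> DR diamD D3 q0 u0 us0 v0 vs0 qi QP thE thsE Tthin PhiP PsiP.
have D1 : (1 <= D)%N by apply: leq_trans D3.
have PI : primitive_idempotents e E by case: QP.
have T1 := @terw_one R[i] X e D x.
have TD := @terw_add R[i] X e D x; have TZ := @terw_scale R[i] X e D x.
(* The action is built for A - eta I and A* - etas I, whose eigenvalues have the two-term form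
   without a constant. *)
have Tshift (B : 'M[R[i]]_#|X|) (c : R[i]) : terwilliger e D x B -> terwilliger e D x (B - c%:M).
  by move=> TB; rewrite -scalemx1 -scaleNr; apply: TD => //; apply: TZ.
have TA : terwilliger e D x (adjmx R[i] e).
  by apply/terw_bm/distmx_mem.
have TAs : terwilliger e D x (dual_adjmx x E).
  rewrite thsE; apply/terw_dual_bm/memv_suml => i _; apply: memvZ.
  by apply: memv_span; apply/mapP; exists i; rewrite ?mem_enum.
have [Th [Threl ThT ThA]] := tetrahedron_action q0 qi u0 us0 v0 vs0 D1 T1 TD TZ (@terw_mul R[i] X e D x)
  (terw_adjm DR) (Tshift _ eta TA) (Tshift _ etas TAs) (fun i _ => terw_idem x PI i)
  (fun i => @terw_dual_idem R[i] X e D x i) (irreducible_has_type DR diamD D1 q0 QP thE thsE Tthin).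
have [hA hAs] := ThA _ _ (displacement_dd DR diamD D1 q0 QP PhiP) (displacement_du DR diamD D1 q0 QP PsiP).
have [theta [thetaZ thetaE]] := presalg_lift Threl.
have thetaX i j (ij : tet_adj i j) : theta (qtet_x q ij) = Th (tet_pair ij).
  by rewrite thetaE (presalg_evalE Threl).
exists theta; split.
- exact: thetaZ.
- by move=> a; rewrite thetaE; apply: ThT.
- by rewrite !thetaX -addrA -hA addrC subrK.
- by rewrite !thetaX -addrA -hAs addrC subrK.
Qed.
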